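(* Fix $0<p<1$. Let $t_p$ be as defined in the context, and set $\alpha_2=\sqrt{p/(2-p)}$. (i) If $0\leq t\leq t_p$, let $\alpha$ denote the unique real number in the interval $0\leq\alpha<\alpha_2$ such that $t=\alpha(1+\alpha^2)^{-1/p}$. Then \[\Phi_1(p,t)=\frac{1}{(1+\alpha^2)^{1/p}}\left(1+\left(\frac2p-1\right)\alpha^2\right),\] and an extremal is \[f(z)=\frac{\alpha+z}{1+\alpha z}\,\frac{(1+\alpha z)^{2/p}}{(1+\alpha^2)^{1/p}}.\] (ii) If $t_p\leq t\leq1$, let $\beta$ denote the unique real number in the interval $0\leq\beta\leq1$ such that $t=(1+\beta^2)^{-1/p}$. Then \[\Phi_1(p,t)=\frac{1}{(1+\beta^2)^{1/p}}\,\frac{2\beta}{p},\] and an extremal is \[f(z)=\frac{(1+\beta z)^{2/p}}{(1+\beta^2)^{1/p}}.\] The extremals are unique for $0\leq t\leq1$ with $t\neq t_p$. The only extremals for $\Phi_1(p,t_p)$ are the two functions given in (i) and (ii) (with $t=t_p$).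
   Context: Let $\mathbb{D}$ be the open unit disc. For $0<p<\infty$, $H^p$ is the space of analytic functions $f$ in $\mathbb{D}$ with $\|f\|_{H^p}^p=\lim_{r\to1^-}\int_0^{2\pi}|f(re^{i\theta})|^p\,\frac{d\theta}{2\pi}<\infty$. For $0\leq t\leq1$, \[\Phi_1(p,t)=\sup\left\{\operatorname{Re} f'(0)\,:\,f\in H^p,\ \|f\|_{H^p}\leq1\text{ and }f(0)=t\right\}.\] An extremal for $\Phi_1(p,t)$ is a function $f\in H^p$ with $\|f\|_{H^p}\leq1$ and $f(0)=t$ which attains this supremum. Powers such as $(1+\alpha z)^{2/p}$ are defined by the principal branch. For $0<p<1$ define \[F_p(\alpha)=p^2\alpha^{-2}+2p(2-p)+(2-p)^2\alpha^2-4\left(\alpha^{-p}+\alpha^{2-p}-1\right),\] let $\alpha_p$ denote the unique solution of $F_p(\alpha)=0$ on the interval $(0,1)$ (it exists and is unique, and satisfies $\alpha_p<\alpha_2$), and set \[t_p=\frac{\alpha_p}{(1+\alpha_p^2)^{1/p}}.\] *)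

(* Defs.v *)
From Stdlib Require Import Reals.
From Coquelicot Require Import Coquelicot.
Open Scope R_scope.

(* x^s for x >= 0 and s > 0; [Rpower 0 s] is 1, whereas here 0^s = 0. *)
Definition Rpow_nn (x s : R) : R := if Rlt_dec 0 x then Rpower x s else 0.

(* Principal argument of z <> 0, with values in (-PI, PI]. *)
Definition Carg (z : C) : R :=
  if Rle_dec 0 (Im z) then acos (Re z / Cmod z) else - acos (Re z / Cmod z).

(* Principal branch of z^s = exp (s (ln |z| + i arg z)), for z <> 0. *)
Definition Cpowr (z : C) (s : R) : C :=
  (RtoC (Rpower (Cmod z) s) * (cos (s * Carg z), sin (s * Carg z)))%C.

Definition in_disc (z : C) : Prop := Cmod z < 1.

Definition analytic_at (f : C -> C) (z0 : C) : Prop :=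
  exists (a : nat -> C) (rho : R), 0 < rho /\
    forall z : C, Cmod (z - z0)%C < rho ->
      @is_pseries C_AbsRing C_NormedModule a (z - z0)%C (f z).

Definition analytic_in_disc (f : C -> C) : Prop :=
  forall z : C, in_disc z -> analytic_at f z.

Definition circle_mean (p : R) (f : C -> C) (r : R) : R :=
  / (2 * PI) *
  RInt (fun th => Rpow_nn (Cmod (f (r * cos th, r * sin th))) p) 0 (2 * PI).

Definition is_mean_limit (p : R) (f : C -> C) (L : R) : Prop :=
  filterlim (circle_mean p f) (at_left 1) (locally L).

(* Elements of H^p are represented by total functions C -> C of which only the
   values in the unit disc matter. *)
Definition in_Hp (p : R) (f : C -> C) : Prop :=
  analytic_in_disc f /\ exists L : R, is_mean_limit p f L.

Definition Hp_norm (p : R) (f : C -> C) : R :=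
  Rpow_nn (@iota R_CompleteSpace (is_mean_limit p f)) (/ p).

Definition admissible (p t : R) (f : C -> C) : Prop :=
  in_Hp p f /\ Hp_norm p f <= 1 /\ f (RtoC 0) = RtoC t.

Definition Phi1 (p t : R) : Rbar :=
  Lub_Rbar (fun x : R =>
    exists f : C -> C, admissible p t f /\ x = Re (C_derive f (RtoC 0))).

Definition extremal (p t : R) (f : C -> C) : Prop :=
  admissible p t f /\ Finite (Re (C_derive f (RtoC 0))) = Phi1 p t.

Definition eq_on_disc (f g : C -> C) : Prop :=
  forall z : C, in_disc z -> f z = g z.

Definition Fp (p a : R) : R :=
  p ^ 2 * / a ^ 2 + 2 * p * (2 - p) + (2 - p) ^ 2 * a ^ 2
  - 4 * (Rpower a (- p) + Rpower a (2 - p) - 1).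

(* [iota] is definite description: "the" zero of Fp p in (0,1). *)
Definition alpha_ (p : R) : R :=
  @iota R_CompleteSpace (fun a : R => 0 < a < 1 /\ Fp p a = 0).

Definition t_ (p : R) : R := alpha_ p / Rpower (1 + alpha_ p ^ 2) (1 / p).

Definition alpha2 (p : R) : R := sqrt (p / (2 - p)).

Definition is_alpha (p t a : R) : Prop :=
  0 <= a < alpha2 p /\ t = a * Rpower (1 + a ^ 2) (- (1 / p)).

Definition is_beta (p t b : R) : Prop :=
  0 <= b <= 1 /\ t = Rpower (1 + b ^ 2) (- (1 / p)).

Definition f_alpha (p a : R) (z : C) : C :=
  ((RtoC a + z) / (RtoC 1 + RtoC a * z) *
   (Cpowr (RtoC 1 + RtoC a * z) (2 / p) / RtoC (Rpower (1 + a ^ 2) (1 / p))))%C.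

Definition f_beta (p b : R) (z : C) : C :=
  (Cpowr (RtoC 1 + RtoC b * z) (2 / p) / RtoC (Rpower (1 + b ^ 2) (1 / p)))%C.

(* Main.v *)
(** Let [f] be admissible and let [u] majorize log |f| on a circle of radius r
    close to 1.  With [G] the analytic function in the disc with boundary real
    part [u], [f (r z) = B(z) exp G(z)] with |B| <= 1, so no Blaschke product is
    needed.  Put [A = exp (mean u)] and [s = p * mean (u cos)].
    - Schwarz-Pick for [B] at 0 gives
      [r Re f'(0) <= A - t^2 / A + (2 / p) t s].
    - The first Lebedev-Milin inequality for [p u] gives
      [A^p (1 + s^2) <= mean (exp (p u)) <= 1 + o(1)].  It follows from
      [e^v >= e^w (1 + v - w)] with [w = c + log |1 + b e^(it)|^2]: since [e^w] is
      a trigonometric polynomial of degree 1, the mean of the right-hand side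
      only involves the first two Fourier coefficients of [v].
    Hence [Re f'(0)] is at most the maximum of
    [q(s) = A - t^2 / A + (2 / p) t s] with [A = (1 + s^2)^(-1/p) >= t], whose
    only candidates are [s = alpha] (where [t / A = s]) and [s = beta] (where
    [t = A]); the sign of [F_p] decides between them.
    For an extremal [f], both inequalities are asymptotically sharp as r -> 1: the
    first makes [B(z) (1 + a z)] converge to [a + z], the second makes [p u]
    converge in L^1 to [w], and this determines [f]. *)
Require Import Defs.
From Stdlib Require Import Reals Ranalysis5 Lra Lia Psatz IndefiniteDescription.
From Coquelicot Require Import Coquelicot.
Open Scope R_scope.

(** * Complex differentiability *)

(** Only circles of radius less than 1 enter, where nothing is exactly sharp. So each inequality
    carries a remainder that tends to 0 for an extremal, and uniqueness is read off in the limit.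
    For [a = B(0)] this says [|B'(0) + a^2| <= 1], and in the case of equality nothing is left
    besides [a + z]. The remainder in the Lebedev-Milin inequality controls an L^1 distance only if
    [|1 + b e^(it)|^2] stays away from 0. Hence the optimal parameter must be known to be less than
    1, which for beta amounts to [2^(-1/p) < t_p]. Compactness concerns a single real number: as r
    -> 1 the first cosine coefficients of [p u], cut off below at 0, cluster at some feasible sigma,
    and the one-variable maximum identifies it. *)

Lemma continuous_Cpair {T : UniformSpace} (f g : T -> R) (x : T) :
  continuous f x -> continuous g x ->
  continuous (fun y => (f y, g y) : C) x.
Proof.
intros Hf Hg P [eps HP].
assert (Hf' := Hf _ (locally_ball (f x) eps)).
assert (Hg' := Hg _ (locally_ball (g x) eps)).
unfold filtermap in *.
refine (filter_imp _ _ _ (filter_and _ _ Hf' Hg')).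
intros y [H1 H2]; apply HP; split; assumption.
Qed.

Lemma continuous_Re {T : UniformSpace} (f : T -> C) (x : T) :
  continuous f x -> continuous (fun y => Re (f y)) x.
Proof. intros H; apply (continuous_comp f (fst : C -> R)); [exact H|]; apply continuous_fst. Qed.

Lemma continuous_Im {T : UniformSpace} (f : T -> C) (x : T) :
  continuous f x -> continuous (fun y => Im (f y)) x.
Proof. intros H; apply (continuous_comp f (snd : C -> R)); [exact H|]; apply continuous_snd. Qed.

Lemma continuous_RtoC {T : UniformSpace} (f : T -> R) (x : T) :
  continuous f x -> continuous (fun y => RtoC (f y)) x.
Proof. intros H; apply continuous_Cpair; [exact H|]; apply continuous_const. Qed.

Lemma continuous_Rplus {T : UniformSpace} (f g : T -> R) (x : T) :
  continuous f x -> continuous g x -> continuous (fun y => f y + g y) x.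
Proof. intros; now apply (continuous_plus (V := R_NormedModule)). Qed.

Lemma continuous_Ropp {T : UniformSpace} (f : T -> R) (x : T) :
  continuous f x -> continuous (fun y => - f y) x.
Proof. intros; now apply (continuous_opp (V := R_NormedModule)). Qed.

Lemma continuous_Rminus {T : UniformSpace} (f g : T -> R) (x : T) :
  continuous f x -> continuous g x -> continuous (fun y => f y - g y) x.
Proof. intros; now apply (continuous_minus (V := R_NormedModule)). Qed.

Lemma continuous_Rmult {T : UniformSpace} (f g : T -> R) (x : T) :
  continuous f x -> continuous g x -> continuous (fun y => f y * g y) x.
Proof. intros; now apply (continuous_mult (K := R_AbsRing)). Qed.

Lemma continuous_Rinv_comp {T : UniformSpace} (f : T -> R) (x : T) :
  continuous f x -> f x <> 0 -> continuous (fun y => / f y) x.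
Proof. intros; apply (continuous_comp f Rinv); [assumption|]. now apply continuous_Rinv. Qed.

Lemma continuous_Rpow {T : UniformSpace} (f : T -> R) (x : T) (n : nat) :
  continuous f x -> continuous (fun y => f y ^ n) x.
Proof.
intros H; induction n as [|n IH]; simpl; [apply continuous_const|].
now apply continuous_Rmult.
Qed.

Lemma continuous_Rsqrt {T : UniformSpace} (f : T -> R) (x : T) :
  continuous f x -> continuous (fun y => sqrt (f y)) x.
Proof. intros H; apply (continuous_comp f sqrt); [exact H|]; apply continuous_sqrt. Qed.

Lemma continuous_Rcos {T : UniformSpace} (f : T -> R) (x : T) :
  continuous f x -> continuous (fun y => cos (f y)) x.
Proof. intros H; apply (continuous_comp f cos); [exact H|]; apply continuous_cos. Qed.

Lemma continuous_Rsin {T : UniformSpace} (f : T -> R) (x : T) :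
  continuous f x -> continuous (fun y => sin (f y)) x.
Proof. intros H; apply (continuous_comp f sin); [exact H|]; apply continuous_sin. Qed.

Lemma continuous_Rexp {T : UniformSpace} (f : T -> R) (x : T) :
  continuous f x -> continuous (fun y => exp (f y)) x.
Proof. intros H; apply (continuous_comp f exp); [exact H|]; apply continuous_exp. Qed.

Lemma continuous_Rabs_comp {T : UniformSpace} (f : T -> R) (x : T) :
  continuous f x -> continuous (fun y => Rabs (f y)) x.
Proof. intros H; apply (continuous_comp f Rabs); [exact H|]; apply continuous_Rabs. Qed.

Lemma continuous_Rln {T : UniformSpace} (f : T -> R) (x : T) :
  continuous f x -> 0 < f x -> continuous (fun y => ln (f y)) x.
Proof.
intros H H0; apply (continuous_comp f ln); [exact H|].
apply continuity_pt_filterlim, derivable_continuous_pt.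
exists (/ f x); now apply derivable_pt_lim_ln.
Qed.

Lemma continuous_Cplus {T : UniformSpace} (f g : T -> C) (x : T) :
  continuous f x -> continuous g x -> continuous (fun y => (f y + g y)%C) x.
Proof.
intros Hf Hg; assert (A1 := continuous_Re _ _ Hf); assert (A2 := continuous_Im _ _ Hf);
assert (B1 := continuous_Re _ _ Hg); assert (B2 := continuous_Im _ _ Hg).
apply continuous_Cpair; apply continuous_Rplus; assumption.
Qed.

Lemma continuous_Copp {T : UniformSpace} (f : T -> C) (x : T) :
  continuous f x -> continuous (fun y => (- f y)%C) x.
Proof.
intros Hf; assert (A1 := continuous_Re _ _ Hf); assert (A2 := continuous_Im _ _ Hf).
apply continuous_Cpair; apply continuous_Ropp; assumption.
Qed.

Lemma continuous_Cminus {T : UniformSpace} (f g : T -> C) (x : T) :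
  continuous f x -> continuous g x -> continuous (fun y => (f y - g y)%C) x.
Proof. intros Hf Hg; apply continuous_Cplus; [|apply continuous_Copp]; assumption. Qed.

Lemma continuous_Cmult {T : UniformSpace} (f g : T -> C) (x : T) :
  continuous f x -> continuous g x -> continuous (fun y => (f y * g y)%C) x.
Proof.
intros Hf Hg; assert (A1 := continuous_Re _ _ Hf); assert (A2 := continuous_Im _ _ Hf);
assert (B1 := continuous_Re _ _ Hg); assert (B2 := continuous_Im _ _ Hg).
apply continuous_Cpair; [apply continuous_Rminus | apply continuous_Rplus];
  apply continuous_Rmult; assumption.
Qed.

Lemma Csqr_pos (z : C) : z <> 0%C -> 0 < fst z ^ 2 + snd z ^ 2.
Proof.
intros Hz; destruct z as [a b]; simpl.
destruct (Req_dec a 0) as [Ha|Ha]; [destruct (Req_dec b 0) as [Hb|Hb]|]; try nra.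
subst; now elim Hz.
Qed.

Lemma continuous_Cinv {T : UniformSpace} (f : T -> C) (x : T) :
  continuous f x -> f x <> 0%C -> continuous (fun y => (/ f y)%C) x.
Proof.
intros Hf Hx; assert (Hp := Csqr_pos _ Hx).
assert (H1 := continuous_Re _ _ Hf); assert (H2 := continuous_Im _ _ Hf).
apply continuous_Cpair; apply continuous_Rmult; try apply continuous_Ropp; try assumption;
(apply continuous_Rinv_comp; [apply continuous_Rplus; apply continuous_Rpow; assumption | lra]).
Qed.

Lemma continuous_Cdiv {T : UniformSpace} (f g : T -> C) (x : T) :
  continuous f x -> continuous g x -> g x <> 0%C -> continuous (fun y => (f y / g y)%C) x.
Proof. intros Hf Hg Hx; apply continuous_Cmult; [|apply continuous_Cinv]; assumption. Qed.

Lemma continuous_Cmod {T : UniformSpace} (f : T -> C) (x : T) :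
  continuous f x -> continuous (fun y => Cmod (f y)) x.
Proof.
intros Hf; assert (A1 := continuous_Re _ _ Hf); assert (A2 := continuous_Im _ _ Hf).
apply continuous_Rsqrt, continuous_Rplus; apply continuous_Rpow; assumption.
Qed.

Lemma continuous_Cconj {T : UniformSpace} (f : T -> C) (x : T) :
  continuous f x -> continuous (fun y => Cconj (f y)) x.
Proof.
intros Hf; apply continuous_Cpair; [now apply continuous_Re | now apply continuous_Ropp, continuous_Im].
Qed.

Lemma continuous_Cpow {T : UniformSpace} (f : T -> C) (x : T) (n : nat) :
  continuous f x -> continuous (fun y => (f y ^ n)%C) x.
Proof.
intros H; induction n as [|n IH]; simpl; [apply continuous_const|].
now apply continuous_Cmult.
Qed.

(** Equalities may be typed in a carrier that is only convertible to [C]; restating them in [C] lets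
    [ring] and [field] find their structure. *)
Ltac cring := match goal with |- @eq _ ?a ?b => change (@eq C a b) end; ring.
Ltac cfield := match goal with |- @eq _ ?a ?b => change (@eq C a b) end; field.

Definition cis (th : R) : C := (cos th, sin th).

Lemma continuous_cis {T : UniformSpace} (f : T -> R) (x : T) :
  continuous f x -> continuous (fun y => cis (f y)) x.
Proof. intros H; apply continuous_Cpair; [now apply continuous_Rcos|now apply continuous_Rsin]. Qed.

(** Syntax-directed. The partial applications are eta-contracted functions; what remains are the
    conditions of non-vanishing and positivity. *)
Ltac cont :=
  repeat (match goal with
  | |- continuous (fun _ => ?c) _ => apply continuous_const
  | |- continuous (fun x => x) _ => apply continuous_id
  | H : context [continuous ?f _] |- continuous ?f _ => apply H
  | H : context [continuous ?f _] |- continuous (fun x => ?f x) _ => apply H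
  | |- continuous (fun _ => cis _) _ => apply continuous_cis
  | |- continuous cis _ => apply (continuous_cis (fun x => x))
  | |- continuous (fun _ => RtoC _) _ => apply continuous_RtoC
  | |- continuous (fun _ => Cmod _) _ => apply continuous_Cmod
  | |- continuous (fun _ => Cconj _) _ => apply continuous_Cconj
  | |- continuous (fun _ => Re _) _ => apply continuous_Re
  | |- continuous (fun _ => Im _) _ => apply continuous_Im
  | |- continuous (fun _ => Cplus _ _) _ => apply continuous_Cplus
  | |- continuous (fun _ => Cminus _ _) _ => apply continuous_Cminus
  | |- continuous (fun _ => Cmult _ _) _ => apply continuous_Cmult
  | |- continuous RtoC _ => apply (continuous_RtoC (fun x => x))
  | |- continuous (Rminus ?c) _ => apply (continuous_Rminus (fun _ => c) (fun x => x))
  | |- continuous (Rplus ?c) _ => apply (continuous_Rplus (fun _ => c) (fun x => x))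
  | |- continuous Cmod _ => apply (continuous_Cmod (fun x => x))
  | |- continuous Re _ => apply (continuous_Re (fun x => x))
  | |- continuous Im _ => apply (continuous_Im (fun x => x))
  | |- continuous Copp _ => apply (continuous_Copp (fun x => x))
  | |- continuous (Cmult ?c) _ => apply (continuous_Cmult (fun _ => c) (fun x => x))
  | |- continuous (Cplus ?c) _ => apply (continuous_Cplus (fun _ => c) (fun x => x))
  | |- continuous (Cminus ?c) _ => apply (continuous_Cminus (fun _ => c) (fun x => x))
  | |- continuous (Rmult ?c) _ => apply (continuous_Rmult (fun _ => c) (fun x => x))
  | |- continuous (fun _ => Cdiv _ _) _ => apply continuous_Cdiv
  | |- continuous (fun _ => Copp _) _ => apply continuous_Copp
  | |- continuous (fun _ => Cinv _) _ => apply continuous_Cinv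
  | |- continuous (fun _ => Cpow _ _) _ => apply continuous_Cpow
  | |- continuous (fun _ => Rplus _ _) _ => apply continuous_Rplus
  | |- continuous (fun _ => Rminus _ _) _ => apply continuous_Rminus
  | |- continuous (fun _ => Rmult _ _) _ => apply continuous_Rmult
  | |- continuous (fun _ => Rdiv _ _) _ => apply continuous_Rmult
  | |- continuous (fun _ => Ropp _) _ => apply continuous_Ropp
  | |- continuous (fun _ => Rinv _) _ => apply continuous_Rinv_comp
  | |- continuous (fun _ => pow _ _) _ => apply continuous_Rpow
  | |- continuous (fun _ => cos _) _ => apply continuous_Rcos
  | |- continuous (fun _ => sin _) _ => apply continuous_Rsin
  | |- continuous ln _ => apply (continuous_Rln (fun x => x))
  | |- continuous exp _ => apply continuous_exp
  | |- continuous cos _ => apply continuous_cos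
  | |- continuous sin _ => apply continuous_sin
  | |- continuous (fun _ => exp _) _ => apply continuous_Rexp
  | |- continuous (fun _ => ln _) _ => apply continuous_Rln
  | |- continuous (fun _ => Rabs _) _ => apply continuous_Rabs_comp
  | |- continuous (fun _ => sqrt _) _ => apply continuous_Rsqrt
  end; try assumption).

Lemma Cmod_cis (th : R) : Cmod (cis th) = 1.
Proof.
unfold Cmod, cis; simpl fst; simpl snd.
replace (cos th ^ 2 + sin th ^ 2) with 1; [apply sqrt_1|].
generalize (sin2_cos2 th); unfold Rsqr; intros H; simpl; lra.
Qed.

Lemma cis_neq0 (th : R) : cis th <> 0%C.
Proof. apply Cmod_gt_0; rewrite Cmod_cis; lra. Qed.

Lemma Cmult_integral (z w : C) : (z * w = 0)%C -> z = 0%C \/ w = 0%C.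
Proof.
intros H; destruct (Ceq_dec z 0%C) as [E|E]; [now left|].
destruct (Ceq_dec w 0%C) as [E'|E']; [now right|].
exfalso; exact (Cmult_neq_0 _ _ E E' H).
Qed.

Lemma cis_conj (th : R) : Cconj (cis th) = (/ cis th)%C.
Proof.
assert (H := cis_neq0 th).
assert (E : (cis th * Cconj (cis th) = 1)%C).
{ rewrite <- Cmod2_conj, Cmod_cis. f_equal; ring. }
rewrite <- (Cmult_1_l (Cconj _)), <- (Cinv_l _ H), <- Cmult_assoc, E; ring.
Qed.

Lemma Cmod_minus_ge (z w : C) : Cmod z - Cmod w <= Cmod (z - w).
Proof.
assert (H := Cmod_triangle (z - w) w).
replace (z - w + w)%C with z in H by ring; lra.
Qed.

Lemma Cmod_minus_sym (z w : C) : Cmod (z - w) = Cmod (w - z).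
Proof. rewrite <- Cmod_opp; f_equal; ring. Qed.

Lemma Cminus_neq0_of_mod (z w : C) : Cmod w < Cmod z -> (z - w)%C <> 0%C.
Proof. intros H; apply Cmod_gt_0; assert (K := Cmod_minus_ge z w); lra. Qed.

Lemma Cmod_ball (z w : C) (eps : R) :
  Cmod (w - z) < eps -> ball (M := C_UniformSpace) z eps w.
Proof. intros H. apply C_NormedModule_mixin_compat1; exact H. Qed.

(** Balls of [C] are squares, for the product uniform structure; 2 is a convenient bound for the
    resulting factor sqrt 2. *)
Lemma Cball_mod (z w : C) (eps : posreal) :
  ball (M := C_UniformSpace) z eps w -> Cmod (w - z) < 2 * eps.
Proof.
intros H; assert (K := C_NormedModule_mixin_compat2 z w eps H).
apply Rlt_le_trans with (1 := K).
apply Rmult_le_compat_r; [left; apply cond_pos|].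
rewrite <- (sqrt_square 2) at 2 by lra.
apply sqrt_le_1_alt; lra.
Qed.

Lemma locally_Cmod (z : C) (P : C -> Prop) :
  locally (T := C_UniformSpace) z P <-> exists d : R, 0 < d /\ forall w, Cmod (w - z) < d -> P w.
Proof.
split.
- intros [e He]; exists e; split; [apply cond_pos|].
  intros w Hw; apply He; now apply Cmod_ball.
- intros (d & Hd & H).
  assert (Hd2 : 0 < d / 2) by lra.
  exists (mkposreal _ Hd2); intros w Hw; apply H.
  apply Cball_mod in Hw; simpl in Hw; lra.
Qed.

Lemma continuous_Cmod_iff (F : C -> C) (z : C) :
  continuous F z <->
  forall eps, 0 < eps -> exists d : R, 0 < d /\ forall w, Cmod (w - z) < d -> Cmod (F w - F z) < eps.
Proof.
split.
- intros H eps He.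
  assert (He2 : 0 < eps / 2) by lra.
  assert (K := H _ (locally_ball (F z) (mkposreal _ He2))).
  apply locally_Cmod in K; destruct K as (d & Hd & K).
  exists d; split; [exact Hd|]; intros w Hw.
  apply K, Cball_mod in Hw; simpl in Hw; lra.
- intros H P [eps HP].
  destruct (H eps (cond_pos eps)) as (d & Hd & K).
  apply locally_Cmod; exists d; split; [exact Hd|].
  intros w Hw; apply HP, Cmod_ball, K, Hw.
Qed.

Lemma locally_Cmod_lt (z : C) (r : R) : Cmod z < r -> locally (T := C_UniformSpace) z (fun w => Cmod w < r).
Proof.
intros H; apply locally_Cmod; exists (r - Cmod z); split; [lra|].
intros w Hw; assert (K := Cmod_minus_ge w z); lra.
Qed.

Lemma locally_neq0 (F : C -> C) (z : C) : continuous F z -> F z <> 0%C ->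
  locally (T := C_UniformSpace) z (fun w => F w <> 0%C).
Proof.
intros H H0; apply locally_Cmod.
apply Cmod_gt_0 in H0.
destruct (proj1 (continuous_Cmod_iff F z) H _ H0) as (d & Hd & K).
exists d; split; [exact Hd|]; intros w Hw E.
specialize (K w Hw); rewrite E in K.
replace (0 - F z)%C with (- F z)%C in K by ring; rewrite Cmod_opp in K; lra.
Qed.

(* Caratheodory's form of complex differentiability: products, compositions and inverses reduce to continuity. *)
Definition cderiv (F : C -> C) (z l : C) : Prop :=
  exists Phi : C -> C, continuous Phi z /\ Phi z = l /\
    locally (T := C_UniformSpace) z (fun w => (F w - F z = Phi w * (w - z))%C).

(** The factor [Phi] is the difference quotient completed by the value [l] at [z]. This form serves
    the comparison with [C_derive] and with curves. *)
Lemma cderiv_eps (F : C -> C) (z l : C) :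
  cderiv F z l <->
  forall eps, 0 < eps -> exists d, 0 < d /\ forall w, Cmod (w - z) < d ->
    Cmod (F w - F z - l * (w - z)) <= eps * Cmod (w - z).
Proof.
split.
- intros (Phi & HP & Hl & HE) eps He.
  destruct (proj1 (continuous_Cmod_iff _ _) HP eps He) as (d1 & Hd1 & K1).
  apply locally_Cmod in HE; destruct HE as (d2 & Hd2 & K2).
  exists (Rmin d1 d2); split; [now apply Rmin_pos|].
  intros w Hw; rewrite K2 by (apply Rlt_le_trans with (1 := Hw), Rmin_r).
  rewrite <- Hl; replace (Phi w * (w - z) - Phi z * (w - z))%C with ((Phi w - Phi z) * (w - z))%C by ring.
  rewrite Cmod_mult; apply Rmult_le_compat_r; [apply Cmod_ge_0|].
  left; apply K1; apply Rlt_le_trans with (1 := Hw), Rmin_l.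
- intros H.
  exists (fun w => if Ceq_dec w z then l else ((F w - F z) / (w - z))%C); split; [|split].
  + apply continuous_Cmod_iff; intros eps He.
    destruct (H (eps / 2)) as (d & Hd & K); [lra|].
    exists d; split; [exact Hd|]; intros w Hw.
    destruct (Ceq_dec z z) as [_|]; [|easy].
    destruct (Ceq_dec w z) as [E|E].
    * replace (l - l)%C with (RtoC 0) by ring; rewrite Cmod_0; exact He.
    * assert (Hwz : (w - z)%C <> 0%C) by now apply Cminus_eq_contra.
      replace ((F w - F z) / (w - z) - l)%C with ((F w - F z - l * (w - z)) / (w - z))%C by (field; exact Hwz).
      rewrite Cmod_div by exact Hwz.
      specialize (K w Hw); apply Cmod_gt_0 in Hwz.
      apply Rle_lt_trans with (eps / 2); [|lra].
      apply Rle_div_l; assumption.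
  + destruct (Ceq_dec z z); easy.
  + apply locally_Cmod; exists 1; split; [lra|]; intros w _.
    destruct (Ceq_dec w z) as [->|E]; [cring|].
    field; now apply Cminus_eq_contra.
Qed.

Lemma cderiv_continuous (F : C -> C) (z l : C) : cderiv F z l -> continuous F z.
Proof.
intros (Phi & HP & Hl & HE).
apply continuous_ext_loc with (fun w => (F z + Phi w * (w - z))%C).
- refine (filter_imp _ _ _ HE); intros w Hw; rewrite <- Hw; cring.
- cont.
Qed.

Lemma cderiv_ext_loc (F G : C -> C) (z l : C) :
  locally (T := C_UniformSpace) z (fun w => F w = G w) -> cderiv F z l -> cderiv G z l.
Proof.
intros HFG (Phi & HP & Hl & HE); exists Phi; repeat split; try assumption.
assert (E := locally_singleton _ _ HFG); simpl in E.
refine (filter_imp _ _ _ (filter_and _ _ HFG HE)); intros w [H1 H2].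
now rewrite <- H1, <- E.
Qed.

Lemma cderiv_const (c z : C) : cderiv (fun _ => c) z 0%C.
Proof.
exists (fun _ => RtoC 0); repeat split; [cont|].
apply filter_forall; intros; cring.
Qed.

Lemma cderiv_id (z : C) : cderiv (fun w => w) z 1%C.
Proof.
exists (fun _ => RtoC 1); repeat split; [cont|].
apply filter_forall; intros; cring.
Qed.

Lemma cderiv_plus (F G : C -> C) (z l m : C) :
  cderiv F z l -> cderiv G z m -> cderiv (fun w => F w + G w)%C z (l + m)%C.
Proof.
intros (P & HP & Hl & HE) (Q & HQ & Hm & HE').
exists (fun w => P w + Q w)%C; split; [cont|split; [now rewrite Hl, Hm|]].
refine (filter_imp _ _ _ (filter_and _ _ HE HE')); intros w [H1 H2].
replace (F w + G w - (F z + G z))%C with ((F w - F z) + (G w - G z))%C by ring.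
rewrite H1, H2; cring.
Qed.

Lemma cderiv_mult (F G : C -> C) (z l m : C) :
  cderiv F z l -> cderiv G z m -> cderiv (fun w => F w * G w)%C z (l * G z + F z * m)%C.
Proof.
intros HF HG; assert (HGc := cderiv_continuous _ _ _ HG).
destruct HF as (P & HP & Hl & HE); destruct HG as (Q & HQ & Hm & HE').
exists (fun w => P w * G w + F z * Q w)%C; split; [cont|split; [now rewrite Hl, Hm|]].
refine (filter_imp _ _ _ (filter_and _ _ HE HE')); intros w [H1 H2].
replace (F w * G w - F z * G z)%C with ((F w - F z) * G w + F z * (G w - G z))%C by ring.
rewrite H1, H2; cring.
Qed.

Lemma cderiv_comp (F G : C -> C) (z l m : C) :
  cderiv F (G z) l -> cderiv G z m -> cderiv (fun w => F (G w)) z (l * m)%C.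
Proof.
intros (P & HP & Hl & HE) HG; assert (HGc := cderiv_continuous _ _ _ HG).
destruct HG as (Q & HQ & Hm & HE').
exists (fun w => P (G w) * Q w)%C; split; [|split; [now rewrite Hl, Hm|]].
- cont. now apply continuous_comp.
- assert (K := HGc _ HE); unfold filtermap in K.
  refine (filter_imp _ _ _ (filter_and _ _ K HE')); intros w [H1 H2].
  rewrite H1, H2; cring.
Qed.

Lemma cderiv_inv (z : C) : z <> 0%C -> cderiv Cinv z (- / (z * z))%C.
Proof.
intros Hz; exists (fun w => - / (w * z))%C; split; [|split; [easy|]].
- cont. now apply Cmult_neq_0.
- assert (K := locally_neq0 (fun w => w) z (continuous_id z) Hz).
  refine (filter_imp _ _ _ K); intros w Hw; cfield; now split.
Qed.

Lemma cderiv_eq (F : C -> C) (z l m : C) : cderiv F z l -> l = m -> cderiv F z m.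
Proof. now intros H <-. Qed.

Lemma cderiv_scal (c : C) (F : C -> C) (z l : C) :
  cderiv F z l -> cderiv (fun w => c * F w)%C z (c * l)%C.
Proof.
intros H; apply (cderiv_eq _ _ (0 * F z + c * l)%C); [|ring].
apply (cderiv_mult (fun _ => c)); [apply cderiv_const|exact H].
Qed.

Lemma cderiv_opp (F : C -> C) (z l : C) :
  cderiv F z l -> cderiv (fun w => - F w)%C z (- l)%C.
Proof.
intros (P & HP & Hl & HE).
exists (fun w => - P w)%C; split; [cont|split; [now rewrite Hl|]].
refine (filter_imp _ _ _ HE); intros w H.
replace (- F w - - F z)%C with (- (F w - F z))%C by ring; rewrite H; cring.
Qed.

Lemma cderiv_unique (F : C -> C) (z l m : C) : cderiv F z l -> cderiv F z m -> l = m.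
Proof.
intros Hl Hm; apply Ceq_minus.
destruct (Ceq_dec (l - m)%C 0%C) as [E|E]; [exact E|exfalso].
apply Cmod_gt_0 in E.
destruct (proj1 (cderiv_eps _ _ _) Hl (Cmod (l - m) / 4)) as (d1 & Hd1 & K1); [lra|].
destruct (proj1 (cderiv_eps _ _ _) Hm (Cmod (l - m) / 4)) as (d2 & Hd2 & K2); [lra|].
set (d := Rmin d1 d2 / 2).
assert (Hd : 0 < d) by (unfold d; assert (H := Rmin_pos _ _ Hd1 Hd2); lra).
assert (L1 : d < d1) by (unfold d in *; assert (H := Rmin_l d1 d2); lra).
assert (L2 : d < d2) by (unfold d in *; assert (H := Rmin_r d1 d2); lra).
assert (Ew : Cmod ((z + d) - z) = d).
{ replace (z + d - z)%C with (RtoC d) by ring; rewrite Cmod_R, Rabs_pos_eq; lra. }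
specialize (K1 (z + d)%C); specialize (K2 (z + d)%C); rewrite Ew in K1, K2.
specialize (K1 L1); specialize (K2 L2).
assert (T := Cmod_triangle (F (z + d)%C - F z - m * (z + d - z)) (- (F (z + d)%C - F z - l * (z + d - z)))).
rewrite Cmod_opp in T.
replace (F (z + d)%C - F z - m * (z + d - z) + - (F (z + d)%C - F z - l * (z + d - z)))%C
  with ((l - m) * d)%C in T by ring.
rewrite Cmod_mult, Cmod_R, (Rabs_pos_eq d) in T by lra.
nra.
Qed.

Lemma is_derive_of_cderiv (F : C -> C) (z l : C) :
  cderiv F z l -> is_derive (K := C_AbsRing) (V := C_NormedModule) F z l.
Proof.
intros H; split.
- apply is_linear_scal_l.
- intros x Hx.
  apply (is_filter_lim_locally_unique (V := AbsRing_NormedModule C_AbsRing)) in Hx; subst x.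
  intros eps.
  destruct (proj1 (cderiv_eps _ _ _) H eps (cond_pos eps)) as (d & Hd & K).
  exists (mkposreal d Hd); intros w Hw.
  specialize (K w Hw).
  replace (l * (w - z))%C with ((w - z) * l)%C in K by ring.
  exact K.
Qed.

Lemma C_derive_cderiv (F : C -> C) (z l : C) : cderiv F z l -> C_derive F z = l.
Proof. intros H; now apply is_C_derive_unique, is_derive_of_cderiv. Qed.

(** Holomorphy with a named derivative. Continuity of the derivative is built in, so that Cauchy's
    formula follows by differentiation under the integral sign instead of Goursat's argument. *)
Definition chol (D : C -> Prop) (F F' : C -> C) : Prop :=
  forall z, D z -> cderiv F z (F' z) /\ continuous F' z.

Definition disk (r : R) (z : C) : Prop := Cmod z < r.

(** * Means over the circle *)

Definition mean (g : R -> R) : R := / (2 * PI) * RInt g 0 (2 * PI).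

Lemma ex_RInt_cont (g : R -> R) (a b : R) : (forall t, continuous g t) -> ex_RInt g a b.
Proof. intros H; apply (ex_RInt_continuous (V := R_CompleteNormedModule)); intros; apply H. Qed.

Lemma two_PI_pos : 0 < 2 * PI.
Proof. generalize PI_RGT_0; lra. Qed.

Lemma mean_ext (f g : R -> R) : (forall t, f t = g t) -> mean f = mean g.
Proof. intros H; unfold mean; f_equal; apply RInt_ext; intros; apply H. Qed.

Lemma mean_plus (f g : R -> R) :
  (forall t, continuous f t) -> (forall t, continuous g t) ->
  mean (fun t => f t + g t) = mean f + mean g.
Proof.
intros Hf Hg; unfold mean; rewrite <- Rmult_plus_distr_l; f_equal.
apply (RInt_plus (V := R_CompleteNormedModule)); now apply ex_RInt_cont.
Qed.

Lemma mean_scal (c : R) (f : R -> R) :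
  (forall t, continuous f t) -> mean (fun t => c * f t) = c * mean f.
Proof.
intros Hf; unfold mean.
assert (E := RInt_scal (V := R_CompleteNormedModule) f 0 (2 * PI) c (ex_RInt_cont f _ _ Hf)).
unfold scal in E; simpl in E; unfold mult in E; simpl in E; rewrite E; ring.
Qed.

Lemma mean_opp (f : R -> R) :
  (forall t, continuous f t) -> mean (fun t => - f t) = - mean f.
Proof.
intros Hf; rewrite (mean_ext _ (fun t => (-1) * f t)) by (intros; ring).
rewrite mean_scal by assumption; ring.
Qed.

Lemma mean_minus (f g : R -> R) :
  (forall t, continuous f t) -> (forall t, continuous g t) ->
  mean (fun t => f t - g t) = mean f - mean g.
Proof.
intros Hf Hg; unfold Rminus; rewrite mean_plus, mean_opp; try easy.
intros t; now apply continuous_Ropp.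
Qed.

Lemma mean_const (c : R) : mean (fun _ => c) = c.
Proof.
unfold mean; rewrite RInt_const; unfold scal; simpl; unfold mult; simpl.
generalize two_PI_pos; intros; field; generalize PI_RGT_0; lra.
Qed.

Lemma mean_le (f g : R -> R) :
  (forall t, continuous f t) -> (forall t, continuous g t) ->
  (forall t, 0 <= t <= 2 * PI -> f t <= g t) -> mean f <= mean g.
Proof.
intros Hf Hg H; generalize two_PI_pos; intros HP; unfold mean.
apply Rmult_le_compat_l; [left; now apply Rinv_0_lt_compat|].
apply RInt_le; [lra|now apply ex_RInt_cont|now apply ex_RInt_cont|].
intros; apply H; lra.
Qed.

Lemma mean_sqr_le (f : R -> R) :
  (forall t, continuous f t) -> mean f ^ 2 <= mean (fun t => f t ^ 2).
Proof.
intros Hf; set (m := mean f).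
assert (H : mean (fun _ => 0) <= mean (fun t => (f t ^ 2 + (- 2 * m) * f t) + m ^ 2)).
{ apply mean_le; intros; cont.
  replace (f t ^ 2 + -2 * m * f t + m ^ 2) with ((f t - m) ^ 2) by ring.
  apply pow2_ge_0. }
rewrite mean_plus, mean_plus, mean_scal, !mean_const in H; try (intros; cont).
fold m in H; nra.
Qed.

Definition Cmean (F : R -> C) : C := (mean (fun t => Re (F t)), mean (fun t => Im (F t))).

Lemma Cmean_ext (F G : R -> C) : (forall t, F t = G t) -> Cmean F = Cmean G.
Proof. intros H; unfold Cmean; f_equal; apply mean_ext; intros; now rewrite H. Qed.

Lemma Cmean_plus (F G : R -> C) :
  (forall t, continuous F t) -> (forall t, continuous G t) ->
  Cmean (fun t => F t + G t)%C = (Cmean F + Cmean G)%C.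
Proof.
intros HF HG; unfold Cmean, Cplus; simpl; f_equal; rewrite <- mean_plus; try easy;
  intros; cont.
Qed.

Lemma Cmean_scal (c : C) (F : R -> C) :
  (forall t, continuous F t) -> Cmean (fun t => c * F t)%C = (c * Cmean F)%C.
Proof.
intros HF; unfold Cmean, Cmult; simpl; f_equal.
- rewrite <- !mean_scal by (intros; cont); rewrite <- mean_minus by (intros; cont); easy.
- rewrite <- !mean_scal by (intros; cont); rewrite <- mean_plus by (intros; cont); easy.
Qed.

Lemma Cmean_opp (F : R -> C) :
  (forall t, continuous F t) -> Cmean (fun t => - F t)%C = (- Cmean F)%C.
Proof.
intros HF; rewrite (Cmean_ext _ (fun t => (-1) * F t)%C) by (intros; cring).
rewrite Cmean_scal by assumption; ring.
Qed.

Lemma Cmean_minus (F G : R -> C) :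
  (forall t, continuous F t) -> (forall t, continuous G t) ->
  Cmean (fun t => F t - G t)%C = (Cmean F - Cmean G)%C.
Proof.
intros HF HG; unfold Cminus; rewrite Cmean_plus, Cmean_opp; try easy.
intros; cont.
Qed.

Lemma Cmean_const (c : C) : Cmean (fun _ => c) = c.
Proof. unfold Cmean; rewrite !mean_const; symmetry; apply surjective_pairing. Qed.

Lemma Cmean_conj (F : R -> C) :
  (forall t, continuous F t) -> Cmean (fun t => Cconj (F t)) = Cconj (Cmean F).
Proof.
intros HF; unfold Cmean, Cconj; simpl; f_equal; rewrite <- mean_opp; try easy.
intros; cont.
Qed.

Lemma Re_Cmean (F : R -> C) : Re (Cmean F) = mean (fun t => Re (F t)).
Proof. reflexivity. Qed.

Lemma Cmean_RtoC (f : R -> R) : Cmean (fun t => RtoC (f t)) = RtoC (mean f).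
Proof. unfold Cmean, RtoC; simpl; now rewrite mean_const. Qed.

Lemma Re_le_Cmod (z : C) : Re z <= Cmod z.
Proof. apply Rle_trans with (2 := re_le_Cmod z), Rle_abs. Qed.

(** Pairing with the constant [Cconj m] makes [Cmod m ^ 2] the mean of a real part, which is at most
    [Cmod m * Cmod (F t)]. *)
Lemma Cmod_Cmean_le (F : R -> C) :
  (forall t, continuous F t) -> Cmod (Cmean F) <= mean (fun t => Cmod (F t)).
Proof.
intros HF; set (m := Cmean F).
destruct (Ceq_dec m 0%C) as [E|E].
- rewrite E, Cmod_0; rewrite <- (mean_const 0).
  apply mean_le; intros; cont; apply Cmod_ge_0.
- apply Cmod_gt_0 in E.
  assert (H : Cmod m ^ 2 = mean (fun t => Re (Cconj m * F t)%C)).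
  { rewrite <- Re_Cmean, Cmean_scal by assumption; fold m.
    rewrite Cmult_comm, <- Cmod2_conj; reflexivity. }
  assert (K : mean (fun t => Re (Cconj m * F t)%C) <= mean (fun t => Cmod m * Cmod (F t))).
  { apply mean_le; intros; cont.
    apply Rle_trans with (1 := Re_le_Cmod _); rewrite Cmod_mult, Cmod_conj; lra. }
  rewrite mean_scal in K by (intros; cont).
  rewrite <- H in K; nra.
Qed.

(** * Curves in the plane and integrals depending on a parameter *)

Definition rderiv (F : R -> C) (t : R) (l : C) : Prop :=
  is_derive (fun s => Re (F s)) t (Re l) /\ is_derive (fun s => Im (F s)) t (Im l).

Lemma is_derive_eps (f : R -> R) (x l : R) :
  is_derive f x l <->
  forall eps, 0 < eps -> exists d, 0 < d /\ forall y, Rabs (y - x) < d ->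
    Rabs (f y - f x - l * (y - x)) <= eps * Rabs (y - x).
Proof.
split.
- intros [_ H] eps He.
  destruct (H x (fun P HP => HP) (mkposreal eps He)) as [d Hd].
  exists d; split; [apply cond_pos|]; intros y Hy.
  specialize (Hd y Hy); unfold norm, minus, plus, opp, scal in Hd; simpl in Hd;
  unfold abs, mult in Hd; simpl in Hd.
  replace (f y - f x - l * (y - x)) with (f y + - f x + - ((y + - x) * l)) by ring; exact Hd.
- intros H; split; [apply is_linear_scal_l|].
  intros x' Hx.
  apply (is_filter_lim_locally_unique (V := R_NormedModule)) in Hx; subst x'.
  intros eps; destruct (H eps (cond_pos eps)) as (d & Hd & K).
  exists (mkposreal d Hd); intros y Hy; specialize (K y Hy).
  unfold norm, minus, plus, opp, scal; simpl; unfold abs, mult; simpl.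
  replace (f y + - f x + - ((y + - x) * l)) with (f y - f x - l * (y - x)) by ring; exact K.
Qed.

Lemma rderiv_eps (F : R -> C) (t : R) (l : C) :
  rderiv F t l <->
  forall eps, 0 < eps -> exists d, 0 < d /\ forall s, Rabs (s - t) < d ->
    Cmod (F s - F t - l * (s - t)%R) <= eps * Rabs (s - t).
Proof.
assert (ER : forall s, Re (F s - F t - l * (s - t)%R) = Re (F s) - Re (F t) - Re l * (s - t)).
{ intros s; unfold Re; simpl; ring. }
assert (EI : forall s, Im (F s - F t - l * (s - t)%R) = Im (F s) - Im (F t) - Im l * (s - t)).
{ intros s; unfold Im; simpl; ring. }
split.
- intros [H1 H2] eps He.
  destruct (proj1 (is_derive_eps _ _ _) H1 (eps / 2)) as (d1 & Hd1 & K1); [lra|].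
  destruct (proj1 (is_derive_eps _ _ _) H2 (eps / 2)) as (d2 & Hd2 & K2); [lra|].
  exists (Rmin d1 d2); split; [now apply Rmin_pos|]; intros s Hs.
  specialize (K1 s (Rlt_le_trans _ _ _ Hs (Rmin_l _ _))).
  specialize (K2 s (Rlt_le_trans _ _ _ Hs (Rmin_r _ _))).
  rewrite <- ER in K1; rewrite <- EI in K2.
  apply Rle_trans with (1 := Cmod_2Rmax _).
  change (sqrt 2 * Rmax (Rabs (Re (F s - F t - l * (s - t)%R))) (Rabs (Im (F s - F t - l * (s - t)%R))) <= eps * Rabs (s - t)).
  assert (Hm : Rmax (Rabs (Re (F s - F t - l * (s - t)%R))) (Rabs (Im (F s - F t - l * (s - t)%R))) <= eps / 2 * Rabs (s - t))
    by (apply Rmax_lub; assumption).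
  assert (S2 : 0 <= sqrt 2 <= 2).
  { split; [apply sqrt_pos|]; rewrite <- (sqrt_square 2) at 2 by lra; apply sqrt_le_1_alt; lra. }
  assert (Hm0 : 0 <= Rmax (Rabs (Re (F s - F t - l * (s - t)%R))) (Rabs (Im (F s - F t - l * (s - t)%R))))
    by (apply Rle_trans with (2 := Rmax_l _ _), Rabs_pos).
  nra.
- intros H; split; apply is_derive_eps; intros eps He;
  destruct (H eps He) as (d & Hd & K); exists d; split; try exact Hd; intros s Hs;
  specialize (K s Hs).
  + rewrite <- ER; now apply Rle_trans with (1 := re_le_Cmod _).
  + rewrite <- EI; apply Rle_trans with (2 := K), Rle_trans with (2 := Rmax_Cmod _), Rmax_r.
Qed.

Lemma rderiv_comp (F : C -> C) (g : R -> C) (t : R) (l m : C) :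
  cderiv F (g t) l -> rderiv g t m -> rderiv (fun s => F (g s)) t (l * m)%C.
Proof.
intros HF Hg; apply rderiv_eps; intros eps He.
(* [K] dominates [e1 + Cmod l + Cmod m], because [e1 <= eps]; the total error is then at most
   [e1 * K = eps / 2] times the increment. *)
set (K := Cmod l + Cmod m + 1 + eps).
assert (L0 := Cmod_ge_0 l); assert (M0 := Cmod_ge_0 m).
assert (HK : 1 <= K) by (unfold K; lra).
set (e1 := eps / (2 * K)).
assert (He1 : 0 < e1) by (apply Rdiv_lt_0_compat; lra).
assert (He1K : e1 * K = eps / 2) by (unfold e1; field; lra).
destruct (proj1 (cderiv_eps _ _ _) HF e1 He1) as (d1 & Hd1 & K1).
destruct (proj1 (rderiv_eps _ _ _) Hg e1 He1) as (d2 & Hd2 & K2).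
assert (Hd : 0 < Rmin d2 (d1 / K)) by (apply Rmin_pos; [|apply Rdiv_lt_0_compat]; lra).
exists (Rmin d2 (d1 / K)); split; [exact Hd|]; intros s Hs.
specialize (K2 s (Rlt_le_trans _ _ _ Hs (Rmin_l _ _))).
assert (Hs' := Rlt_le_trans _ _ _ Hs (Rmin_r _ _)).
assert (Hs0 := Rabs_pos (s - t)).
assert (Hgs : Cmod (g s - g t) <= (e1 + Cmod m) * Rabs (s - t)).
{ replace (g s - g t)%C with ((g s - g t - m * (s - t)%R) + m * (s - t)%R)%C by ring.
  apply Rle_trans with (1 := Cmod_triangle _ _); rewrite Cmod_mult, Cmod_R; lra. }
assert (He1' : e1 <= eps) by nra.
assert (Hgs' : Cmod (g s - g t) < d1).
{ apply Rle_lt_trans with (K * Rabs (s - t)).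
  - apply Rle_trans with (1 := Hgs); apply Rmult_le_compat_r; [exact Hs0|unfold K; lra].
  - apply Rmult_lt_compat_l with (r := K) in Hs'; [|lra].
    replace (K * (d1 / K)) with d1 in Hs' by (field; lra); exact Hs'. }
specialize (K1 _ Hgs').
replace (F (g s) - F (g t) - l * m * (s - t)%R)%C with
  ((F (g s) - F (g t) - l * (g s - g t)) + l * (g s - g t - m * (s - t)%R))%C by ring.
apply Rle_trans with (1 := Cmod_triangle _ _); rewrite Cmod_mult.
assert (Cmod l * Cmod (g s - g t - m * (s - t)%R) <= Cmod l * (e1 * Rabs (s - t)))
  by (apply Rmult_le_compat_l; assumption).
assert (e1 * Cmod (g s - g t) <= e1 * ((e1 + Cmod m) * Rabs (s - t)))
  by (apply Rmult_le_compat_l; [lra|assumption]).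
assert (e1 * (e1 + Cmod m + Cmod l) <= e1 * K)
  by (apply Rmult_le_compat_l; [lra|unfold K; lra]).
nra.
Qed.

Lemma Cmean_rderiv (F F' : R -> C) :
  (forall t, rderiv F t (F' t)) -> (forall t, continuous F' t) ->
  F (2 * PI) = F 0 -> Cmean F' = 0%C.
Proof.
intros HF HF' HE; unfold Cmean, mean.
rewrite (is_RInt_unique (V := R_CompleteNormedModule) _ _ _ (minus (Re (F (2 * PI))) (Re (F 0)))).
- rewrite (is_RInt_unique (V := R_CompleteNormedModule) _ _ _ (minus (Im (F (2 * PI))) (Im (F 0)))).
  + rewrite HE; unfold minus, plus, opp; simpl; unfold RtoC; f_equal; ring.
  + apply (is_RInt_derive (V := R_CompleteNormedModule) (fun t => Im (F t))).
    * intros; apply HF.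
    * intros; cont.
- apply (is_RInt_derive (V := R_CompleteNormedModule) (fun t => Re (F t))).
  + intros; apply HF.
  + intros; cont.
Qed.

(** Differentiation under the integral followed by the mean value theorem. The margin [eps] makes
    both ends of the parameter interval interior points, as two-sided derivatives require. *)
Lemma mean_param_const (H dH : R -> R -> R) (eps : R) : 0 < eps ->
  (forall l t, - eps < l < 1 + eps -> is_derive (fun x => H x t) l (dH l t)) ->
  (forall l t, - eps < l < 1 + eps -> continuous (fun p : R * R => dH (fst p) (snd p)) (l, t)) ->
  (forall l t, - eps < l < 1 + eps -> continuous (H l) t) ->
  (forall l, 0 <= l <= 1 -> mean (dH l) = 0) ->
  mean (H 1) = mean (H 0).
Proof.
intros He HD HC Hc H0.
assert (D : forall l, -eps < l < 1 + eps -> is_derive (fun l => mean (H l)) l (mean (dH l))).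
{ intros l Hl; unfold mean.
  assert (Hloc : locally l (fun x => - eps < x < 1 + eps)).
  { apply (locally_interval _ l (-eps) (1 + eps)); simpl; try apply Hl; intros; split; assumption. }
  apply (is_derive_scal (fun l => RInt (H l) 0 (2 * PI))).
  replace (RInt (dH l) 0 (2 * PI)) with (RInt (fun t => Derive (fun u => H u t) l) 0 (2 * PI))
    by (apply RInt_ext; intros; now apply is_derive_unique, HD).
  apply (is_derive_RInt_param H 0 (2 * PI) l).
  - refine (filter_imp _ _ _ Hloc); intros y Hy t _; exists (dH y t); now apply HD.
  - intros t _.
    apply (continuity_2d_pt_ext_loc dH).
    + assert (Hr : 0 < Rmin (l + eps) (1 + eps - l)) by (apply Rmin_pos; lra).
      exists (mkposreal _ Hr); simpl; intros u v Hu _.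
      symmetry; apply is_derive_unique, HD.
      apply Rabs_def2 in Hu; generalize (Rmin_l (l + eps) (1 + eps - l)) (Rmin_r (l + eps) (1 + eps - l)); lra.
    + apply continuity_2d_pt_filterlim; apply HC, Hl.
  - refine (filter_imp _ _ _ Hloc); intros y Hy.
    apply (ex_RInt_continuous (V := R_CompleteNormedModule)); intros; now apply Hc. }
destruct (MVT_gen (fun l => mean (H l)) 0 1 (fun l => mean (dH l))) as (c & Hc' & E).
- rewrite Rmin_left, Rmax_right by lra; intros; apply D; lra.
- rewrite Rmin_left, Rmax_right by lra; intros x Hx.
  apply continuity_pt_filterlim, (ex_derive_continuous (fun l => mean (H l))).
  eexists; apply D; lra.
- rewrite Rmin_left, Rmax_right in Hc' by lra.
  rewrite H0 in E by lra; lra.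
Qed.

(** * Cauchy's formula *)

Lemma Cmean_param_const (H dH : R -> R -> C) (eps : R) : 0 < eps ->
  (forall l t, - eps < l < 1 + eps -> rderiv (fun x => H x t) l (dH l t)) ->
  (forall l t, - eps < l < 1 + eps -> continuous (fun p : R * R => dH (fst p) (snd p)) (l, t)) ->
  (forall l t, - eps < l < 1 + eps -> continuous (H l) t) ->
  (forall l, 0 <= l <= 1 -> Cmean (dH l) = 0%C) ->
  Cmean (H 1) = Cmean (H 0).
Proof.
intros He HD HC Hc H0; unfold Cmean; f_equal.
- apply (mean_param_const (fun l t => Re (H l t)) (fun l t => Re (dH l t)) eps He).
  + intros l t Hl; now apply HD.
  + intros l t Hl; cont; now apply HC.
  + intros l t Hl; cont; now apply Hc.
  + intros l Hl; now rewrite <- Re_Cmean, H0.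
- apply (mean_param_const (fun l t => Im (H l t)) (fun l t => Im (dH l t)) eps He).
  + intros l t Hl; now apply HD.
  + intros l t Hl; cont; now apply HC.
  + intros l t Hl; cont; now apply Hc.
  + intros l Hl; assert (E := f_equal Im (H0 l Hl)); exact E.
Qed.

Lemma rderiv_cis (t : R) : rderiv cis t (Ci * cis t)%C.
Proof.
split; unfold cis, Re, Im; simpl.
- replace (0 * cos t - 1 * sin t) with (- sin t) by ring; apply is_derive_Reals, derivable_pt_lim_cos.
- replace (0 * sin t + 1 * cos t) with (cos t) by ring; apply is_derive_Reals, derivable_pt_lim_sin.
Qed.

Lemma rderiv_RtoC (t : R) : rderiv RtoC t 1%C.
Proof.
split; unfold Re, Im; simpl; [apply (is_derive_id (K := R_AbsRing))|apply (is_derive_const (K := R_AbsRing) (V := R_NormedModule) 0)].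
Qed.

Lemma cis_period : cis (2 * PI) = cis 0.
Proof. unfold cis; now rewrite cos_2PI, sin_2PI, cos_0, sin_0. Qed.

Lemma Cmean_cis : Cmean cis = 0%C.
Proof.
assert (E : Cmean (fun t => Ci * cis t)%C = 0%C).
{ apply (Cmean_rderiv cis); [apply rderiv_cis|intros; cont|apply cis_period]. }
rewrite Cmean_scal in E by (intros; cont).
replace (Cmean cis) with (/ Ci * (Ci * Cmean cis))%C by (field; apply Ci_nz).
rewrite E; ring.
Qed.

Lemma Cmean_cis_inv : Cmean (fun t => / cis t)%C = 0%C.
Proof.
rewrite (Cmean_ext _ (fun t => Cconj (cis t))) by (intros; symmetry; apply cis_conj).
rewrite Cmean_conj, Cmean_cis by (intros; cont).
unfold Cconj, RtoC; simpl; f_equal; ring.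
Qed.

Lemma cis_minus_neq0 (z : C) (t : R) : Cmod z < 1 -> (cis t - z)%C <> 0%C.
Proof. intros H; apply Cminus_neq0_of_mod; now rewrite Cmod_cis. Qed.

Lemma segment_bound (z0 : C) (l t eps : R) : Cmod z0 < 1 -> 0 < eps -> - eps < l < 1 + eps ->
  Cmod (z0 + l * (cis t - z0)) < 1 + 2 * eps.
Proof.
intros Hz He Hl.
replace (z0 + l * (cis t - z0))%C with (RtoC (1 - l) * z0 + l * cis t)%C by (rewrite RtoC_minus; ring).
apply Rle_lt_trans with (1 := Cmod_triangle _ _).
rewrite !Cmod_mult, !Cmod_R, Cmod_cis.
assert (H := Cmod_ge_0 z0).
assert (Rabs (1 - l) * Cmod z0 <= Rabs (1 - l) * 1) by (apply Rmult_le_compat_l; [apply Rabs_pos|lra]).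
unfold Rabs in *; destruct (Rcase_abs (1 - l)); destruct (Rcase_abs l); lra.
Qed.

(** The homotopy [l * z0] contracts the point to 0, where the kernel is 1. The t-derivative of the
    kernel is [- Ci * l] times its l-derivative, so the latter has mean 0; at [l = 0] this factor
    degenerates and the mean is computed directly. *)
Lemma Cmean_kernel (z0 : C) : Cmod z0 < 1 -> Cmean (fun t => cis t / (cis t - z0))%C = 1%C.
Proof.
intros Hz.
destruct (Rlt_le_dec 0 (Cmod z0)) as [H0|H0].
2:{ assert (E : z0 = 0%C) by (apply Cmod_eq_0; generalize (Cmod_ge_0 z0); lra).
    rewrite <- (Cmean_const 1); apply Cmean_ext; intros t; rewrite E; field.
    replace (cis t - 0)%C with (cis t) by ring; apply cis_neq0. }
(* The margin for which [l * z0] stays inside the unit disc. *)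
set (eps := (/ Cmod z0 - 1)).
assert (He : 0 < eps).
{ unfold eps; assert (1 < / Cmod z0) by (rewrite <- Rinv_1; apply Rinv_lt_contravar; lra); lra. }
assert (Hd : forall l t, - eps < l < 1 + eps -> (cis t - l * z0)%C <> 0%C).
{ intros l t Hl; apply Cminus_neq0_of_mod; rewrite Cmod_mult, Cmod_R, Cmod_cis.
  apply Rlt_le_trans with (/ Cmod z0 * Cmod z0); [|right; field; lra].
  apply Rmult_lt_compat_r; [exact H0|].
  unfold eps in Hl; unfold Rabs; destruct (Rcase_abs l); lra. }
assert (E := Cmean_param_const (fun l t => cis t / (cis t - l * z0))%C
  (fun l t => cis t * z0 / ((cis t - l * z0) * (cis t - l * z0)))%C eps He).
rewrite (Cmean_ext _ (fun t => cis t / (cis t - 1%R * z0))%C) by (intros; f_equal; f_equal; cring).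
rewrite E; clear E.
- rewrite <- (Cmean_const 1); apply Cmean_ext; intros t; field.
  replace (cis t - 0 * z0)%C with (cis t) by ring; apply cis_neq0.
- intros l t Hl.
  assert (K : cderiv (fun x : C => cis t * / (cis t - x * z0))%C l
      (cis t * (- / ((cis t - l * z0) * (cis t - l * z0)) * (- z0)))%C).
  { apply cderiv_scal, (cderiv_comp Cinv (fun x => cis t - x * z0)%C).
    - apply cderiv_inv, Hd, Hl.
    - apply (cderiv_eq _ _ (0 + - (1 * z0 + l * 0))%C); [|cring].
      apply (cderiv_plus (fun _ => cis t)); [apply cderiv_const|].
      apply cderiv_opp, (cderiv_mult (fun x => x) (fun _ => z0)); [apply cderiv_id|apply cderiv_const]. }
  assert (K2 := rderiv_comp _ RtoC l _ _ K (rderiv_RtoC l)).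
  replace (cis t * z0 / ((cis t - l * z0) * (cis t - l * z0)))%C with
   (cis t * (- / ((cis t - l * z0) * (cis t - l * z0)) * - z0) * 1)%C by (field; apply Hd, Hl).
  exact K2.
- intros l t Hl; assert (K := Hd l t Hl); cont.
  all: try apply continuous_fst; try apply continuous_snd.
  simpl; now apply Cmult_neq_0.
- intros l t Hl; assert (K := Hd l t Hl); cont.
- intros l Hl.
  destruct (Req_dec l 0) as [->|Hl0].
  + rewrite (Cmean_ext _ (fun t => z0 * / cis t)%C).
    * rewrite Cmean_scal, Cmean_cis_inv; [ring|]; intros; cont; apply cis_neq0.
    * intros t; replace (cis t - 0 * z0)%C with (cis t) by ring; field; apply cis_neq0.
  + assert (Hl' : -eps < l < 1 + eps) by lra.
    assert (E : Cmean (fun t => - Ci * l * (cis t * z0 / ((cis t - l * z0) * (cis t - l * z0))))%C = 0%C).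
    { apply (Cmean_rderiv (fun t => cis t * / (cis t - l * z0))%C).
      - intros t; assert (K := Hd l t Hl').
        assert (K1 : cderiv (fun x : C => x * / (x - l * z0))%C (cis t)
          (1 * / (cis t - l * z0) + cis t * (- / ((cis t - l * z0) * (cis t - l * z0)) * (1 + 0)))%C).
        { apply (cderiv_mult (fun x => x) (fun x => / (x - l * z0))%C); [apply cderiv_id|].
          apply (cderiv_comp Cinv (fun x => x + - (l * z0))%C); [exact (cderiv_inv _ K)|].
          apply cderiv_plus; [apply cderiv_id|apply cderiv_const]. }
        assert (K2 := rderiv_comp _ cis t _ _ K1 (rderiv_cis t)).
        match goal with |- rderiv _ _ ?x => match type of K2 with rderiv _ _ ?y =>
          replace x with y; [exact K2|] end end.
        field; exact K.
      - intros t; assert (K := Hd l t Hl'); cont; now apply Cmult_neq_0.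
      - now rewrite cis_period. }
    rewrite Cmean_scal in E.
    * apply Cmult_integral in E; destruct E as [E|E]; [|exact E].
      apply Cmult_integral in E; destruct E as [E|E].
      -- exfalso; apply (f_equal Im) in E; simpl in E; lra.
      -- exfalso; apply Hl0; exact (RtoC_inj _ _ E).
    * intros t; assert (K := Hd l t Hl'); cont; now apply Cmult_neq_0.
Qed.

(* The mean of [F (z0 + l (cis t - z0)) cis t / (cis t - z0)] does not depend on [l], because its
   [l]-derivative is an exact [t]-derivative. *)
Theorem cauchy_formula (F F' : C -> C) (rho : R) (z0 : C) :
  1 < rho -> chol (disk rho) F F' -> Cmod z0 < 1 ->
  Cmean (fun t => F (cis t) * (cis t / (cis t - z0)))%C = F z0.
Proof.
intros HR HF Hz.
set (eps := (rho - 1) / 2).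
assert (He : 0 < eps) by (unfold eps; lra).
assert (Hs : forall l t, - eps < l < 1 + eps -> disk rho (z0 + l * (cis t - z0))%C).
{ intros l t Hl; assert (K := segment_bound z0 l t eps Hz He Hl); unfold disk, eps in *; lra. }
assert (Hn := fun t => cis_minus_neq0 z0 t Hz).
assert (E := Cmean_param_const (fun l t => F (z0 + l * (cis t - z0)) * (cis t / (cis t - z0)))%C
  (fun l t => F' (z0 + l * (cis t - z0)) * cis t)%C eps He).
rewrite (Cmean_ext _ (fun t => F (z0 + 1%R * (cis t - z0)) * (cis t / (cis t - z0)))%C)
  by (intros; f_equal; f_equal; cring).
rewrite E; clear E.
- rewrite (Cmean_ext _ (fun t => F z0 * (cis t / (cis t - z0)))%C)
   by (intros; f_equal; f_equal; cring).
  rewrite Cmean_scal, Cmean_kernel; [ring|exact Hz|].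
  intros t; specialize (Hn t); cont.
- intros l t Hl.
  destruct (HF _ (Hs l t Hl)) as [K _].
  assert (K1 : cderiv (fun x : C => F (z0 + x * (cis t - z0)) * (cis t / (cis t - z0)))%C l
     (F' (z0 + l * (cis t - z0)) * (0 + (1 * (cis t - z0) + l * 0)) * (cis t / (cis t - z0)) +
       F (z0 + l * (cis t - z0)) * 0)%C).
  { apply (cderiv_mult (fun x => F (z0 + x * (cis t - z0))%C) (fun _ => (cis t / (cis t - z0))%C)); [|apply cderiv_const].
    apply (cderiv_comp F (fun x => z0 + x * (cis t - z0))%C); [exact K|].
    apply (cderiv_plus (fun _ => z0)); [apply cderiv_const|].
    apply (cderiv_mult (fun x => x) (fun _ => (cis t - z0)%C)); [apply cderiv_id|apply cderiv_const]. }
  assert (K2 := rderiv_comp _ RtoC l _ _ K1 (rderiv_RtoC l)).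
  match goal with |- rderiv _ _ ?x => match type of K2 with rderiv _ _ ?y =>
          replace x with y; [exact K2|] end end.
  field; apply Hn.
- intros l t Hl; destruct (HF _ (Hs l t Hl)) as [_ K].
  cont; try apply continuous_snd.
  apply (continuous_comp (fun p : R * R => z0 + fst p * (cis (snd p) - z0))%C F'); [|exact K].
  cont; [apply continuous_fst|apply continuous_snd].
- intros l t Hl; destruct (HF _ (Hs l t Hl)) as [K _].
  cont; [|apply Hn].
  apply (continuous_comp (fun t => z0 + l * (cis t - z0))%C F); [cont|].
  exact (cderiv_continuous _ _ _ K).
- intros l Hl.
  assert (Hl' : -eps < l < 1 + eps) by lra.
  assert (Hc : forall t, continuous (fun t => F' (z0 + l * (cis t - z0)))%C t).
  { intros t; destruct (HF _ (Hs l t Hl')) as [_ K].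
    apply (continuous_comp (fun t => z0 + l * (cis t - z0))%C F'); [cont|exact K]. }
  destruct (Req_dec l 0) as [->|Hl0].
  + rewrite (Cmean_ext _ (fun t => F' z0 * cis t)%C)
      by (intros; f_equal; f_equal; cring).
    rewrite Cmean_scal, Cmean_cis by (intros; cont); ring.
  + assert (E : Cmean (fun t => l * Ci * (F' (z0 + l * (cis t - z0)) * cis t))%C = 0%C).
    { apply (Cmean_rderiv (fun t => F (z0 + l * (cis t - z0)))%C).
      - intros t; destruct (HF _ (Hs l t Hl')) as [K _].
        assert (K1 : cderiv (fun x : C => F (z0 + l * (x + - z0)))%C (cis t)
         (F' (z0 + l * (cis t - z0)) * (0 + l * (1 + 0)))%C).
        { apply (cderiv_comp F (fun x => z0 + l * (x + - z0))%C); [exact K|].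
          apply (cderiv_plus (fun _ => z0)); [apply cderiv_const|].
          apply cderiv_scal, cderiv_plus; [apply cderiv_id|apply cderiv_const]. }
        assert (K2 := rderiv_comp _ cis t _ _ K1 (rderiv_cis t)).
        match goal with |- rderiv _ _ ?x => match type of K2 with rderiv _ _ ?y =>
          replace x with y; [exact K2|] end end.
        ring.
      - intros t; cont.
      - now rewrite cis_period. }
    rewrite Cmean_scal in E by (intros; cont).
    apply Cmult_integral in E; destruct E as [E|E]; [|exact E].
    apply Cmult_integral in E; destruct E as [E|E].
    * exfalso; apply Hl0; exact (RtoC_inj _ _ E).
    * now elim Ci_nz.
Qed.

Lemma chol_continuous_cis (F F' : C -> C) (rho : R) : 1 < rho -> chol (disk rho) F F' ->
  forall t, continuous (fun s => F (cis s)) t.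
Proof.
intros Hr HF t; apply (continuous_comp cis F); [cont|].
destruct (HF (cis t)) as [H _]; [unfold disk; now rewrite Cmod_cis|].
exact (cderiv_continuous _ _ _ H).
Qed.

Lemma Cmean_holomorphic (F F' : C -> C) (rho : R) : 1 < rho -> chol (disk rho) F F' ->
  Cmean (fun t => F (cis t)) = F 0%C.
Proof.
intros Hr HF; rewrite <- (cauchy_formula F F' rho 0) by (try rewrite Cmod_0; try assumption; lra).
apply Cmean_ext; intros t; replace (cis t - 0)%C with (cis t) by ring; field; apply cis_neq0.
Qed.

Lemma Cmod_cis_minus_ge (t : R) (z : C) : 1 - Cmod z <= Cmod (cis t - z).
Proof. rewrite <- (Cmod_cis t) at 1; apply Cmod_minus_ge. Qed.

(** The Cauchy kernel at [h] minus its first-order expansion is [h^2 / (cis t (cis t - h))], of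
    modulus at most [2 |h|^2] for [|h| <= 1/2]. So the mean is a derivative of [F] at 0, and
    derivatives are unique. *)
Lemma Cmean_holomorphic_coef1 (F F' : C -> C) (rho : R) : 1 < rho -> chol (disk rho) F F' ->
  Cmean (fun t => F (cis t) * / cis t)%C = F' 0%C.
Proof.
intros Hr HF; assert (Hc := chol_continuous_cis F F' rho Hr HF).
assert (Hn := cis_neq0).
destruct (HF 0%C) as [HD _]; [unfold disk; rewrite Cmod_0; lra|].
apply (cderiv_unique F 0); [|exact HD].
apply cderiv_eps; intros eps He.
set (B := mean (fun t => Cmod (F (cis t)))).
assert (HB : 0 <= B).
{ rewrite <- (mean_const 0); apply mean_le; intros; cont; apply Cmod_ge_0. }
exists (Rmin (1 / 2) (eps / (2 * B + 1))); split; [apply Rmin_pos; [lra|apply Rdiv_lt_0_compat; lra]|].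
intros h Hh; replace (h - 0)%C with h in * by ring.
assert (Hh1 := Rlt_le_trans _ _ _ Hh (Rmin_l _ _)).
assert (Hh2 := Rlt_le_trans _ _ _ Hh (Rmin_r _ _)).
assert (Hh3 : Cmod h < 1) by lra.
assert (Hm := fun t => cis_minus_neq0 h t Hh3).
rewrite <- (cauchy_formula F F' rho h Hr HF Hh3).
rewrite <- (Cmean_holomorphic F F' rho Hr HF).
rewrite (Cmult_comm _ h), <- Cmean_scal, <- !Cmean_minus
  by (intros t; specialize (Hn t); specialize (Hm t); cont).
eapply Rle_trans.
{ apply Cmod_Cmean_le; intros t; specialize (Hn t); specialize (Hm t); cont. }
apply Rle_trans with (mean (fun t => 2 * Cmod h ^ 2 * Cmod (F (cis t)))).
- apply mean_le; intros t; [specialize (Hn t); specialize (Hm t); cont|cont|].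
  intros _; replace (F (cis t) * (cis t / (cis t - h)) - F (cis t) - h * (F (cis t) * / cis t))%C
   with (F (cis t) * (h * h * / (cis t * (cis t - h))))%C by (field; split; [apply Hn|apply Hm]).
  rewrite !Cmod_mult, Cmod_inv, Cmod_mult, Cmod_cis by (apply Cmult_neq_0; [apply Hn|apply Hm]).
  assert (K := Cmod_cis_minus_ge t h).
  assert (K2 : / (1 * Cmod (cis t - h)) <= 2).
  { replace 2 with (/ (1 / 2)) by field; apply Rinv_le_contravar; lra. }
  assert (H0 := Cmod_ge_0 h); assert (H1 := Cmod_ge_0 (F (cis t))).
  assert (P : Cmod h * Cmod h * / (1 * Cmod (cis t - h)) <= Cmod h * Cmod h * 2)
    by (apply Rmult_le_compat_l; [now apply Rmult_le_pos|exact K2]).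
  apply Rmult_le_compat_l with (r := Cmod (F (cis t))) in P; [|exact H1]; lra.
- rewrite mean_scal by (intros; cont); fold B.
  assert (H0 := Cmod_ge_0 h).
  replace (2 * Cmod h ^ 2 * B) with ((2 * B * Cmod h) * Cmod h) by ring.
  apply Rmult_le_compat_r; [exact H0|].
  assert (K : Cmod h * (2 * B + 1) < eps).
  { apply Rmult_lt_compat_r with (r := 2 * B + 1) in Hh2; [|lra].
    replace (eps / (2 * B + 1) * (2 * B + 1)) with eps in Hh2 by (field; lra); exact Hh2. }
  nra.
Qed.

Lemma chol_minus_affine (D : C -> Prop) (F F' : C -> C) (a b : C) : chol D F F' ->
  chol D (fun z => F z - a - b * z)%C (fun z => F' z - b)%C.
Proof.
intros HF z Hz; destruct (HF z Hz) as [H1 H2]; split; [|cont].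
apply (cderiv_eq _ _ (F' z + - 0 + - (b * 1))%C); [|cring].
apply cderiv_plus; [apply cderiv_plus; [exact H1|apply cderiv_opp, cderiv_const]|].
apply cderiv_opp, cderiv_scal, cderiv_id.
Qed.

Lemma chol_mult (D : C -> Prop) (F F' G G' : C -> C) : chol D F F' -> chol D G G' ->
  chol D (fun z => F z * G z)%C (fun z => F' z * G z + F z * G' z)%C.
Proof.
intros HF HG z Hz; destruct (HF z Hz) as [H1 H2]; destruct (HG z Hz) as [H3 H4].
assert (H5 := cderiv_continuous _ _ _ H1); assert (H6 := cderiv_continuous _ _ _ H3).
split; [now apply cderiv_mult|cont].
Qed.

Lemma chol_id (D : C -> Prop) : chol D (fun z => z) (fun _ => 1%C).
Proof. intros z _; split; [apply cderiv_id|cont]. Qed.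

Lemma Cmean_holomorphic_mul (F F' : C -> C) (rho : R) : 1 < rho -> chol (disk rho) F F' ->
  Cmean (fun t => F (cis t) * cis t)%C = 0%C.
Proof.
intros Hr HF.
rewrite (Cmean_holomorphic (fun z => F z * z)%C _ rho Hr (chol_mult _ _ _ _ _ HF (chol_id _))); ring.
Qed.

Lemma Cmod2_plus (z w : C) : Cmod (z + w) ^ 2 = Cmod z ^ 2 + Cmod w ^ 2 + 2 * Re (Cconj z * w).
Proof. rewrite !Cmod2_alt; unfold Re, Im; simpl; ring. Qed.

(** Parseval with two coefficients: [G], which is [F] without its affine part, is orthogonal to 1
    and [cis], so its mean square is exactly the right-hand side. Cauchy's formula, with a kernel of
    modulus at most [1 / (1 - Cmod z)], makes this a pointwise bound. *)
Lemma remainder_bound (F F' : C -> C) (rho : R) (z : C) :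
  1 < rho -> chol (disk rho) F F' -> Cmod z < 1 ->
  (1 - Cmod z) ^ 2 * Cmod (F z - F 0 - F' 0 * z)%C ^ 2 <=
    mean (fun t => Cmod (F (cis t)) ^ 2) - Cmod (F 0%C) ^ 2 - Cmod (F' 0%C) ^ 2.
Proof.
intros Hr HF Hz.
set (c0 := F 0%C); set (c1 := F' 0%C).
set (G := fun z => (F z - c0 - c1 * z)%C).
assert (HG : chol (disk rho) G (fun z => F' z - c1)%C) by now apply chol_minus_affine.
assert (G0 : G 0%C = 0%C) by (unfold G, c0; ring).
assert (HcF := chol_continuous_cis F F' rho Hr HF).
assert (HcG := chol_continuous_cis G _ rho Hr HG).
assert (Hn := cis_neq0).
assert (Hm := fun t => cis_minus_neq0 z t Hz).
change (F z - c0 - c1 * z)%C with (G z).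
assert (E : mean (fun t => Cmod (F (cis t)) ^ 2) = Cmod c0 ^ 2 + Cmod c1 ^ 2 + mean (fun t => Cmod (G (cis t)) ^ 2)).
{ rewrite (mean_ext _ (fun t => Cmod (G (cis t)) ^ 2 + (Cmod c0 ^ 2 + Cmod c1 ^ 2) +
    (2 * Re (Cconj c0 * c1 * cis t)%C + 2 * Re (Cconj c0 * G (cis t) + Cconj c1 * (G (cis t) * / cis t))%C))).
  - rewrite !mean_plus, !mean_scal, !mean_const, <- !Re_Cmean, Cmean_plus, !Cmean_scal, Cmean_cis;
     try (intros t; specialize (Hn t); cont).
    rewrite (Cmean_holomorphic G _ rho Hr HG), (Cmean_holomorphic_coef1 G _ rho Hr HG).
    rewrite G0; change (F' 0%C) with c1.
    replace (Cconj c0 * c1 * 0)%C with (RtoC 0) by ring.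
    replace (Cconj c0 * 0 + Cconj c1 * (c1 - c1))%C with (RtoC 0) by ring.
    rewrite re_RtoC; ring.
  - intros t.
    replace (F (cis t)) with ((c0 + c1 * cis t) + G (cis t))%C by (unfold G; ring).
    rewrite 2!Cmod2_plus, Cmod_mult, Cmod_cis, Cplus_conj, Cmult_conj, cis_conj.
    replace ((Cconj c0 + Cconj c1 * / cis t) * G (cis t))%C
      with (Cconj c0 * G (cis t) + Cconj c1 * (G (cis t) * / cis t))%C by ring.
    rewrite Cmult_assoc; ring. }
rewrite E; ring_simplify (Cmod c0 ^ 2 + Cmod c1 ^ 2 + mean (fun t : R => Cmod (G (cis t)) ^ 2) - Cmod c0 ^ 2 - Cmod c1 ^ 2).
apply Rle_trans with (2 := mean_sqr_le (fun t => Cmod (G (cis t))) (fun t => continuous_Cmod _ _ (HcG t))).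
rewrite <- Rpow_mult_distr.
apply pow_incr; split; [apply Rmult_le_pos; [lra|apply Cmod_ge_0]|].
rewrite <- (cauchy_formula G _ rho z Hr HG Hz).
apply Rle_trans with ((1 - Cmod z) * mean (fun t => / (1 - Cmod z) * Cmod (G (cis t)))).
- apply Rmult_le_compat_l; [lra|].
  eapply Rle_trans; [apply Cmod_Cmean_le; intros t; specialize (Hm t); cont|].
  apply mean_le; intros t; [specialize (Hm t); cont|cont|intros _].
  rewrite Cmod_mult, Cmod_div, Cmod_cis by apply Hm; rewrite Rmult_comm.
  apply Rmult_le_compat_r; [apply Cmod_ge_0|].
  unfold Rdiv; rewrite Rmult_1_l; apply Rinv_le_contravar; [lra|apply Cmod_cis_minus_ge].
- rewrite mean_scal by (intros; cont); right; field; lra.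
Qed.

(** * Power series *)

Lemma pow_n_Cpow (z : C) (n : nat) : pow_n (K := C_AbsRing) z n = (z ^ n)%C.
Proof. induction n as [|n IH]; simpl; [reflexivity|now rewrite IH]. Qed.

Definition Cpsum (a : nat -> C) (w : C) : nat -> C :=
  sum_n (G := C_NormedModule) (fun k => (w ^ k * a k)%C).

Lemma Cpsum_0 (a : nat -> C) (w : C) : Cpsum a w 0 = a 0%nat.
Proof. unfold Cpsum; rewrite sum_O; apply Cmult_1_l. Qed.

Lemma Cpsum_S (a : nat -> C) (w : C) (n : nat) :
  Cpsum a w (S n) = (Cpsum a w n + w ^ S n * a (S n))%C.
Proof. unfold Cpsum; now rewrite sum_Sn. Qed.

Lemma is_pseries_Cpsum (a : nat -> C) (w l : C) :
  is_pseries (K := C_AbsRing) (V := C_NormedModule) a w l <->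
  filterlim (Cpsum a w) eventually (locally (T := C_UniformSpace) l).
Proof.
assert (E : forall n, Cpsum a w n = sum_n (G := C_NormedModule) (fun k => scal (pow_n (K := C_AbsRing) w k) (a k)) n).
{ intros n; apply sum_n_ext; intros k; now rewrite <- pow_n_Cpow. }
split; apply filterlim_ext; intros n; now rewrite E.
Qed.

Lemma chol_comp_affine (F F' : C -> C) (D E : C -> Prop) (z0 : C) (r : R) :
  (forall w, E w -> D (z0 + r * w)%C) -> chol D F F' ->
  chol E (fun w => F (z0 + r * w)%C) (fun w => r * F' (z0 + r * w))%C.
Proof.
intros HDE HF w Hw; destruct (HF _ (HDE w Hw)) as [H1 H2]; split.
- apply (cderiv_eq _ _ (F' (z0 + r * w) * (0 + r * 1))%C); [|cring].
  apply (cderiv_comp F (fun w => z0 + r * w)%C); [exact H1|].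
  apply (cderiv_plus (fun _ => z0)); [apply cderiv_const|apply cderiv_scal, cderiv_id].
- cont; apply (continuous_comp (fun w => z0 + r * w)%C F'); [cont|exact H2].
Qed.

(** The Cauchy kernel is expanded as a finite geometric sum with an explicit remainder, so that no
    series is exchanged with the integral. *)
Lemma geometric_partial_sum (G G' : C -> C) (rho : R) (w : C) (n : nat) :
  1 < rho -> chol (disk rho) G G' -> Cmod w < 1 ->
  Cpsum (fun k => Cmean (fun t => G (cis t) * (/ cis t) ^ k)%C) w n =
  (G w - Cmean (fun t => G (cis t) * ((w * / cis t) ^ S n * (cis t / (cis t - w)))))%C.
Proof.
intros Hr HG Hw.
assert (Hc := chol_continuous_cis G G' rho Hr HG).
assert (Hn := cis_neq0).
assert (Hm := fun t => cis_minus_neq0 w t Hw).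
induction n as [|n IH].
- rewrite Cpsum_0, <- (cauchy_formula G G' rho w Hr HG Hw), <- Cmean_minus
    by (intros t; specialize (Hn t); specialize (Hm t); cont).
  apply Cmean_ext; intros t; simpl; field; split; [apply Hm|apply Hn].
- rewrite Cpsum_S, IH, <- (cauchy_formula G G' rho w Hr HG Hw); cbv beta.
  rewrite <- Cmean_scal, <- !Cmean_minus, <- Cmean_plus
    by (intros t; specialize (Hn t); specialize (Hm t); cont).
  apply Cmean_ext; intros t.
  rewrite (Cpow_S _ (S n)), Cpow_mult_l; field; split; [apply Hm|apply Hn].
Qed.

(** Serves the candidates: they are differentiated by rules, whereas membership in H^p is stated
    through power series. *)
Theorem analytic_of_chol (F F' : C -> C) (rho : R) (z0 : C) :
  chol (disk rho) F F' -> Cmod z0 < rho -> analytic_at F z0.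
Proof.
intros HF Hz0.
(* Half the distance to the boundary: the rescaled function [G] is holomorphic on the disc of radius
   2, hence across the unit circle. *)
set (r := (rho - Cmod z0) / 2).
assert (Hr : 0 < r) by (unfold r; lra).
assert (Hr0 : RtoC r <> 0%C) by (intros E; apply RtoC_inj in E; lra).
set (G := fun w => F (z0 + r * w)%C).
set (G' := fun w => (r * F' (z0 + r * w))%C).
assert (HG : chol (disk 2) G G').
{ apply (chol_comp_affine F F' (disk rho)); [|exact HF].
  unfold disk; intros w Hw; apply Rle_lt_trans with (1 := Cmod_triangle _ _).
  rewrite Cmod_mult, Cmod_R, Rabs_pos_eq by lra.
  apply Rlt_le_trans with (Cmod z0 + r * 2); [|unfold r; lra].
  apply Rplus_lt_compat_l, Rmult_lt_compat_l; assumption. }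
assert (Hc : forall t, continuous (fun s => G (cis s)) t)
 by (apply (chol_continuous_cis G G' 2); [lra|exact HG]).
assert (Hn := cis_neq0).
exists (fun k => (/ r) ^ k * Cmean (fun t => G (cis t) * (/ cis t) ^ k))%C, r; split; [exact Hr|].
intros z Hz; set (w := ((z - z0) / r)%C).
assert (Hw : Cmod w < 1).
{ unfold w; rewrite Cmod_div, Cmod_R, (Rabs_pos_eq r) by (try exact Hr0; lra).
  apply Rlt_div_l; lra. }
assert (Ez : (z - z0)%C = (r * w)%C) by (unfold w; field; exact Hr0).
assert (EF : F z = G w) by (unfold G; rewrite <- Ez; f_equal; ring).
assert (Hm := fun t => cis_minus_neq0 w t Hw).
rewrite EF; apply is_pseries_Cpsum.
apply filterlim_ext with (fun n => (G w - Cmean (fun t => G (cis t) * ((w * / cis t) ^ S n * (cis t / (cis t - w)))))%C).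
{ intros n; rewrite <- (geometric_partial_sum G G' 2 w n) by (try exact HG; try exact Hw; lra).
  apply sum_n_ext; intros k; rewrite Ez, Cmult_assoc, <- Cpow_mult_l.
  now replace (r * w * / r)%C with w by (field; exact Hr0). }
set (B := mean (fun t => Cmod (G (cis t)))).
assert (HB : 0 <= B).
{ rewrite <- (mean_const 0); apply mean_le; intros; cont; apply Cmod_ge_0. }
assert (Hbound : forall n, Cmod (Cmean (fun t => G (cis t) * ((w * / cis t) ^ S n * (cis t / (cis t - w))))%C)
   <= (B / (1 - Cmod w)) * Cmod w ^ S n).
{ intros n; eapply Rle_trans; [apply Cmod_Cmean_le; intros t; specialize (Hn t); specialize (Hm t); cont|].
  apply Rle_trans with (mean (fun t => / (1 - Cmod w) * Cmod w ^ S n * Cmod (G (cis t)))).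
  - apply mean_le; intros t; [specialize (Hn t); specialize (Hm t); cont|cont|intros _].
    rewrite !Cmod_mult, Cmod_pow, Cmod_mult, Cmod_inv, Cmod_div, Cmod_cis by first [apply Hn|apply Hm].
    rewrite Rinv_1, Rmult_1_r, Rmult_comm; apply Rmult_le_compat_r; [apply Cmod_ge_0|].
    rewrite Rmult_comm; apply Rmult_le_compat_r; [apply pow_le, Cmod_ge_0|].
    unfold Rdiv; rewrite Rmult_1_l; apply Rinv_le_contravar; [lra|apply Cmod_cis_minus_ge].
  - rewrite mean_scal by (intros; cont); fold B; right; field; lra. }
intros P [eps HP].
assert (L : is_lim_seq (fun n => (B / (1 - Cmod w)) * Cmod w ^ S n) 0).
{ replace (Finite 0) with (Rbar_mult (B / (1 - Cmod w)) (Finite 0)) by (simpl; f_equal; ring).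
  apply is_lim_seq_scal_l, (is_lim_seq_incr_1 (fun n => Cmod w ^ n)), is_lim_seq_geom.
  rewrite Rabs_pos_eq; [exact Hw|apply Cmod_ge_0]. }
apply is_lim_seq_spec in L; destruct (L eps) as [N HN].
exists N; intros n Hn'; apply HP, Cmod_ball.
specialize (HN n Hn'); rewrite Rminus_0_r in HN; apply Rabs_def2 in HN.
match goal with |- Cmod ?x < _ => match x with (_ - ?y - _)%C => replace x with (- y)%C by ring end end.
rewrite Cmod_opp; apply Rle_lt_trans with (1 := Hbound n); apply HN.
Qed.

Lemma Cpow_diff_bound (w v : C) (m : R) (n : nat) : Cmod w <= m -> Cmod v <= m ->
  Cmod (w ^ S n - v ^ S n) <= INR (S n) * m ^ n * Cmod (w - v).
Proof.
intros Hw Hv; assert (H0 := Cmod_ge_0 w); assert (H1 := Cmod_ge_0 (w - v)).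
induction n as [|n IH].
- simpl; rewrite !Cmult_1_r; lra.
- replace (w ^ S (S n) - v ^ S (S n))%C with (w * (w ^ S n - v ^ S n) + (w - v) * v ^ S n)%C
    by (rewrite !(Cpow_S _ (S n)); ring).
  apply Rle_trans with (1 := Cmod_triangle _ _); rewrite !Cmod_mult, Cmod_pow.
  assert (K1 : Cmod v ^ S n <= m ^ S n) by (apply pow_incr; split; [apply Cmod_ge_0|exact Hv]).
  assert (K2 : Cmod w * Cmod (w ^ S n - v ^ S n) <= m * (INR (S n) * m ^ n * Cmod (w - v)))
    by (apply Rmult_le_compat; try assumption; apply Cmod_ge_0).
  assert (K3 : Cmod (w - v) * Cmod v ^ S n <= Cmod (w - v) * m ^ S n) by (now apply Rmult_le_compat_l).
  rewrite (S_INR (S n)); simpl (m ^ S n) in *; lra.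
Qed.

Lemma INR_le_pow2 (n : nat) : INR (S n) <= 2 ^ n.
Proof.
induction n as [|n IH]; [simpl; lra|].
rewrite S_INR; simpl (2 ^ S n); assert (K := pow_R1_Rle 2 n); lra.
Qed.

(* Strict differentiability: continuity of the derivative follows without differentiating the series. *)
Lemma analytic_strict (f : C -> C) (z0 : C) : analytic_at f z0 ->
  exists (a1 : C) (K d : R), 0 <= K /\ 0 < d /\
   forall z z' m, Cmod (z - z0) <= m -> Cmod (z' - z0) <= m -> m < d ->
     Cmod (f z - f z' - a1 * (z - z')) <= K * m * Cmod (z - z').
Proof.
intros (a & rho & Hrho & H).
set (s := rho / 2).
assert (Hs : 0 < s) by (unfold s; lra).
assert (HM : exists M, 0 <= M /\ forall n, Cmod (a n) * s ^ n <= M).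
{ assert (Hs' := H (z0 + s)%C); replace (z0 + s - z0)%C with (RtoC s) in Hs' by ring.
  rewrite Cmod_R, Rabs_pos_eq in Hs' by lra.
  assert (Hs2 : s < rho) by (unfold s; lra); specialize (Hs' Hs2).
  apply is_pseries_Cpsum in Hs'.
  destruct (filterlim_bounded (K := C_AbsRing) (V := C_NormedModule) _ (ex_intro _ _ Hs')) as [M HM].
  exists (2 * M); split.
  - specialize (HM 0%nat); apply Rle_trans with (2 := Rmult_le_compat_l 2 _ _ (Rlt_le _ _ Rlt_0_2) HM).
    apply Rmult_le_pos; [lra|apply norm_ge_0].
  - assert (E : forall n, Cmod (a n) * s ^ n = Cmod (s ^ n * a n)).
    { intros n; rewrite Cmod_mult, Cmod_pow, Cmod_R, Rabs_pos_eq by lra; ring. }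
    intros n; rewrite E; destruct n as [|n].
    + specialize (HM 0%nat); change (Cmod (Cpsum a s 0) <= M) in HM.
      rewrite Cpsum_0, <- (Cmult_1_l (a 0%nat)) in HM; change (RtoC 1) with (s ^ 0)%C in HM.
      assert (K0 := Cmod_ge_0 (s ^ 0 * a 0%nat)); lra.
    + assert (H1 := HM n); assert (H2 := HM (S n)).
      change (Cmod (Cpsum a s n) <= M) in H1; change (Cmod (Cpsum a s (S n)) <= M) in H2.
      rewrite Cpsum_S in H2.
      match type of H2 with Cmod (?x + ?y) <= _ =>
        replace y with ((x + y) + - x)%C by ring;
        assert (T := Cmod_triangle (x + y) (- x)); rewrite Cmod_opp in T end.
      lra. }
destruct HM as (M & HM0 & HM).
(* For [m <= s / 4], the bounds [Cmod (a n) <= M / s^n] and [INR (S (S n)) <= 2 ^ S n] make the term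
   of degree [n + 2] at most [(1/2)^(n+1) * K * m * d], and these sum to [K * m * d]. *)
set (K := 4 * M / s ^ 2).
assert (HK : 0 <= K).
{ unfold K; apply Rmult_le_pos; [lra|left; apply Rinv_0_lt_compat, pow_lt, Hs]. }
exists (a 1%nat), K, (s / 4); split; [exact HK|split; [lra|]].
intros z z' m Hz Hz' Hm.
set (w := (z - z0)%C) in *; set (v := (z' - z0)%C) in *.
replace (z - z')%C with (w - v)%C by (unfold w, v; ring).
assert (Hm0 : 0 <= m) by (apply Rle_trans with (2 := Hz), Cmod_ge_0).
assert (S1 : filterlim (Cpsum a w) eventually (locally (T := C_UniformSpace) (f z)))
  by (apply is_pseries_Cpsum, H; fold w; unfold s in *; lra).
assert (S2 : filterlim (Cpsum a v) eventually (locally (T := C_UniformSpace) (f z')))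
  by (apply is_pseries_Cpsum, H; fold v; unfold s in *; lra).
set (d := Cmod (w - v)).
assert (Hd : 0 <= d) by apply Cmod_ge_0.
assert (Hpart : forall n, Cmod (Cpsum a w (S n) - Cpsum a v (S n) - a 1%nat * (w - v))%C
   <= (1 - (1 / 2) ^ n) * (K * m * d)).
{ intros n; induction n as [|n IH].
  - rewrite !Cpsum_S, !Cpsum_0, !Cpow_1_r.
    match goal with |- Cmod ?x <= _ => replace x with (RtoC 0) by ring end.
    rewrite Cmod_0; simpl; lra.
  - rewrite (Cpsum_S a w (S n)), (Cpsum_S a v (S n)).
    match goal with |- Cmod (?x + ?y - (?x' + ?y') - ?c)%C <= _ =>
      replace (x + y - (x' + y') - c)%C with ((x - x' - c) + (w ^ S (S n) - v ^ S (S n)) * a (S (S n)))%C by ring end.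
    apply Rle_trans with (1 := Cmod_triangle _ _); rewrite Cmod_mult.
    assert (P := Cpow_diff_bound w v m (S n) Hz Hz'); fold d in P.
    assert (Hterm : Cmod (w ^ S (S n) - v ^ S (S n)) * Cmod (a (S (S n))) <= (1 / 2) ^ S n * (K * m * d)).
    { apply Rle_trans with (2 ^ S n * m ^ S n * d * Cmod (a (S (S n)))).
      - apply Rmult_le_compat_r; [apply Cmod_ge_0|].
        apply Rle_trans with (1 := P); apply Rmult_le_compat_r; [exact Hd|].
        apply Rmult_le_compat_r; [now apply pow_le|apply INR_le_pow2].
      - assert (Hmn : m ^ n <= (s / 4) ^ n) by (apply pow_incr; lra).
        specialize (HM (S (S n))).
        replace (2 ^ S n * m ^ S n * d * Cmod (a (S (S n)))) with
          ((m * d) * (2 ^ S n * Cmod (a (S (S n))) * m ^ n)) by (simpl; ring).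
        replace ((1 / 2) ^ S n * (K * m * d)) with ((m * d) * ((1 / 2) ^ S n * K)) by ring.
        apply Rmult_le_compat_l; [now apply Rmult_le_pos|].
        apply Rle_trans with (2 ^ S n * Cmod (a (S (S n))) * (s / 4) ^ n).
        + apply Rmult_le_compat_l; [|exact Hmn].
          apply Rmult_le_pos; [apply pow_le; lra|apply Cmod_ge_0].
        + replace (2 ^ S n * Cmod (a (S (S n))) * (s / 4) ^ n) with ((1 / 2) ^ S n * (4 * (Cmod (a (S (S n))) * s ^ (S (S n))) / s ^ 2)).
          * apply Rmult_le_compat_l; [apply pow_le; lra|]; unfold K.
            apply Rmult_le_compat_r; [left; apply Rinv_0_lt_compat, pow_lt, Hs|lra].
          * replace ((s / 4) ^ n) with (s ^ n * ((1 / 2) ^ n * (1 / 2) ^ n))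
              by (rewrite <- !Rpow_mult_distr; f_equal; field).
            assert (E : 2 ^ n * (1 / 2) ^ n = 1).
            { rewrite <- Rpow_mult_distr; replace (2 * (1 / 2)) with 1 by field; apply pow1. }
            simpl; field_simplify; [|lra].
            transitivity (2 * ((1 / 2) ^ n * Cmod (a (S (S n))) * s ^ n)); [field|].
            transitivity (2 * ((1 / 2) ^ n * Cmod (a (S (S n))) * s ^ n) * (2 ^ n * (1 / 2) ^ n)); [rewrite E; ring|field]. }
    apply Rle_trans with (1 := Rplus_le_compat _ _ _ _ IH Hterm).
    right; simpl; field. }
apply Rnot_lt_le; intros Hlt.
set (gap := Cmod (f z - f z' - a 1%nat * (w - v)) - K * m * d).
assert (Hgap : 0 < gap / 4) by (unfold gap; lra).
assert (N1 := S1 _ (locally_ball (f z) (mkposreal _ Hgap))).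
assert (N2 := S2 _ (locally_ball (f z') (mkposreal _ Hgap))).
destruct N1 as [N1 HN1]; destruct N2 as [N2 HN2].
set (N := (N1 + N2)%nat).
specialize (HN1 (S N)); specialize (HN2 (S N)); specialize (Hpart N).
assert (B1 := Cball_mod _ _ _ (HN1 ltac:(unfold N; lia))).
assert (B2 := Cball_mod _ _ _ (HN2 ltac:(unfold N; lia))).
simpl in B1, B2.
set (A1 := Cpsum a w (S N)) in *.
set (A2 := Cpsum a v (S N)) in *.
assert (T1 := Cmod_triangle (A1 - A2 - a 1%nat * (w - v)) ((f z - A1) + - (f z' - A2))).
assert (T2 := Cmod_triangle (f z - A1) (- (f z' - A2))).
rewrite Cmod_opp, (Cmod_minus_sym (f z)), (Cmod_minus_sym (f z')) in T2.
replace (A1 - A2 - a 1%nat * (w - v) + ((f z - A1) + - (f z' - A2)))%C with (f z - f z' - a 1%nat * (w - v))%C in T1 by ring.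
assert (Hp : 0 <= (1 / 2) ^ N * (K * m * d)).
{ apply Rmult_le_pos; [apply pow_le; lra|]. apply Rmult_le_pos; [now apply Rmult_le_pos|exact Hd]. }
unfold gap in *; lra.
Qed.

(** Strict differentiability with one point at the centre gives the derivative. With two points near
    the centre it compares the derivative at [w] with the one at [z], which gives continuity. *)
Theorem chol_of_analytic (f : C -> C) (D : C -> Prop) :
  (forall z, D z -> locally (T := C_UniformSpace) z D) ->
  (forall z, D z -> analytic_at f z) -> chol D f (C_derive f).
Proof.
intros Hopen Hf.
assert (Hd : forall z, D z -> exists l, cderiv f z l).
{ intros z Hz; destruct (analytic_strict f z (Hf z Hz)) as (a & K & d & HK & Hd & H).
  exists a; apply cderiv_eps; intros eps He.
  assert (Hm : 0 < Rmin d (eps / (K + 1))) by (apply Rmin_pos; [exact Hd|apply Rdiv_lt_0_compat; lra]).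
  exists (Rmin d (eps / (K + 1))); split; [exact Hm|]; intros w Hw.
  assert (Z0 : Cmod (z - z) <= Cmod (w - z)).
  { replace (z - z)%C with (RtoC 0) by ring; rewrite Cmod_0; apply Cmod_ge_0. }
  apply Rle_trans with (1 := H w z _ (Rle_refl _) Z0 (Rlt_le_trans _ _ _ Hw (Rmin_l _ _))).
  apply Rmult_le_compat_r; [apply Cmod_ge_0|].
  assert (Hw2 := Rlt_le_trans _ _ _ Hw (Rmin_r _ _)).
  apply Rmult_lt_compat_r with (r := K + 1) in Hw2; [|lra].
  replace (eps / (K + 1) * (K + 1)) with eps in Hw2 by (field; lra).
  assert (H0 := Cmod_ge_0 (w - z)); lra. }
intros z Hz; split.
- destruct (Hd z Hz) as [l Hl]; rewrite (C_derive_cderiv _ _ _ Hl); exact Hl.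
- destruct (analytic_strict f z (Hf z Hz)) as (a & K & d & HK & Hd0 & H).
  assert (Hnear : forall w l, Cmod (w - z) < d / 2 -> cderiv f w l -> Cmod (l - a) <= 2 * K * Cmod (w - z)).
  { intros w l Hw Hl; apply le_epsilon; intros eps He.
    destruct (proj1 (cderiv_eps _ _ _) Hl (eps / 2)) as (d1 & Hd1 & H1); [lra|].
    set (x := Rmin (Rmin (d / 4) (eps / (2 * K + 2))) (d1 / 2)).
    assert (Hx0 : 0 < x).
    { unfold x; repeat apply Rmin_pos; try lra; apply Rdiv_lt_0_compat; lra. }
    assert (Hx1 : x <= d / 4) by (unfold x; apply Rle_trans with (1 := Rmin_l _ _), Rmin_l).
    assert (Hx2 : x <= eps / (2 * K + 2)) by (unfold x; apply Rle_trans with (1 := Rmin_l _ _), Rmin_r).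
    assert (Hx3 : x <= d1 / 2) by (unfold x; apply Rmin_r).
    assert (Ex : Cmod (w + x - w) = x).
    { replace (w + x - w)%C with (RtoC x) by ring; rewrite Cmod_R, Rabs_pos_eq; lra. }
    specialize (H1 (w + x)%C); rewrite Ex in H1; specialize (H1 ltac:(lra)).
    assert (Hwx : Cmod (w + x - z) <= Cmod (w - z) + x).
    { replace (w + x - z)%C with ((w - z) + x)%C by ring.
      apply Rle_trans with (1 := Cmod_triangle _ _); rewrite (Cmod_R x), Rabs_pos_eq; lra. }
    specialize (H (w + x)%C w (Cmod (w - z) + x) Hwx ltac:(lra) ltac:(lra)); rewrite Ex in H.
    assert (T := Cmod_triangle (f (w + x)%C - f w - a * (w + x - w)) (- (f (w + x)%C - f w - l * (w + x - w)))).
    rewrite Cmod_opp in T.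
    replace (f (w + x)%C - f w - a * (w + x - w) + - (f (w + x)%C - f w - l * (w + x - w)))%C
      with ((l - a) * x)%C in T by ring.
    rewrite Cmod_mult, Cmod_R, (Rabs_pos_eq x) in T by lra.
    assert (Hkx : K * x <= eps / 2).
    { apply Rmult_le_compat_r with (r := 2 * K + 2) in Hx2; [|lra].
      replace (eps / (2 * K + 2) * (2 * K + 2)) with eps in Hx2 by (field; lra); lra. }
    apply Rmult_le_reg_r with x; [exact Hx0|].
    apply Rle_trans with (1 := T).
    assert (K * x * x <= eps / 2 * x) by (apply Rmult_le_compat_r; lra).
    assert (0 <= K * Cmod (w - z) * x) by (repeat apply Rmult_le_pos; try lra; apply Cmod_ge_0).
    lra. }
  assert (Ea : C_derive f z = a).
  { destruct (Hd z Hz) as [l Hl]; rewrite (C_derive_cderiv _ _ _ Hl).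
    apply Ceq_minus, Cmod_eq_0, Rle_antisym; [|apply Cmod_ge_0].
    assert (Z0 : Cmod (z - z) = 0) by (replace (z - z)%C with (RtoC 0) by ring; apply Cmod_0).
    apply Rle_trans with (1 := Hnear z l ltac:(lra) Hl); rewrite Z0; lra. }
  apply continuous_Cmod_iff; intros eps He.
  destruct (proj1 (locally_Cmod _ _) (Hopen z Hz)) as (d2 & Hd2 & HD).
  exists (Rmin d2 (Rmin (d / 2) (eps / (2 * K + 1)))); split.
  { repeat apply Rmin_pos; try lra; apply Rdiv_lt_0_compat; lra. }
  intros w Hw.
  assert (W1 := Rlt_le_trans _ _ _ Hw (Rmin_l _ _)).
  assert (W2 := Rlt_le_trans _ _ _ Hw (Rle_trans _ _ _ (Rmin_r _ _) (Rmin_l _ _))).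
  assert (W3 := Rlt_le_trans _ _ _ Hw (Rle_trans _ _ _ (Rmin_r _ _) (Rmin_r _ _))).
  destruct (Hd w (HD w W1)) as [l Hl]; rewrite (C_derive_cderiv _ _ _ Hl), Ea.
  apply Rle_lt_trans with (1 := Hnear w l W2 Hl).
  apply Rmult_lt_compat_r with (r := 2 * K + 1) in W3; [|lra].
  replace (eps / (2 * K + 1) * (2 * K + 1)) with eps in W3 by (field; lra).
  assert (H0 := Cmod_ge_0 (w - z)); lra.
Qed.

(** * Exponential and logarithm *)

Definition Cexp (z : C) : C := (exp (Re z) * cis (Im z))%C.

Lemma Cmod_Cexp (z : C) : Cmod (Cexp z) = exp (Re z).
Proof.
unfold Cexp; rewrite Cmod_mult, Cmod_cis, Cmod_R, Rabs_pos_eq; [ring|left; apply exp_pos].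
Qed.

Lemma Cexp_neq0 (z : C) : Cexp z <> 0%C.
Proof. apply Cmod_gt_0; rewrite Cmod_Cexp; apply exp_pos. Qed.

Lemma cis_plus (s t : R) : cis (s + t) = (cis s * cis t)%C.
Proof. unfold cis, Cmult; simpl; rewrite cos_plus, sin_plus; f_equal; ring. Qed.

Lemma Cexp_plus (z w : C) : Cexp (z + w) = (Cexp z * Cexp w)%C.
Proof. unfold Cexp; rewrite re_plus, im_plus, exp_plus, cis_plus, RtoC_mult; ring. Qed.

Lemma Cexp_RtoC (x : R) : Cexp x = exp x.
Proof.
unfold Cexp; rewrite re_RtoC, im_RtoC; unfold cis; rewrite cos_0, sin_0.
change (1, 0) with (RtoC 1); ring.
Qed.

Lemma Cexp_0 : Cexp 0 = 1%C.
Proof. now rewrite Cexp_RtoC, exp_0. Qed.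

Lemma Cexp_opp (z : C) : Cexp (- z) = (/ Cexp z)%C.
Proof.
assert (H := Cexp_neq0 z).
assert (E : (Cexp z * Cexp (- z))%C = 1%C).
{ rewrite <- Cexp_plus, <- Cexp_0; f_equal; ring. }
rewrite <- (Cmult_1_l (Cexp (- z))), <- (Cinv_l _ H), <- Cmult_assoc, E; ring.
Qed.

Lemma cderiv_Cexp_0 : cderiv Cexp 0 1.
Proof.
apply cderiv_eps; intros eps He; rewrite Cexp_0.
assert (E1 : is_derive exp 0 1) by (pattern 1 at 1; rewrite <- exp_0; apply is_derive_exp).
assert (E2 := rderiv_cis 0).
destruct (proj1 (is_derive_eps _ _ _) E1 (Rmin 1 (eps / 6))) as (d1 & Hd1 & K1); [apply Rmin_pos; lra|].
destruct (proj1 (rderiv_eps _ _ _) E2 (Rmin 1 (eps / 6))) as (d2 & Hd2 & K2); [apply Rmin_pos; lra|].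
exists (Rmin (Rmin d1 d2) (eps / 6)); split; [repeat apply Rmin_pos; lra|].
intros w Hw; replace (w - 0)%C with w in * by ring.
assert (L1 := Rle_lt_trans _ _ _ (re_le_Cmod w) Hw).
assert (L2 : Rabs (Im w) <= Cmod w) by (apply Rle_trans with (2 := Rmax_Cmod w), Rmax_r).
assert (L2' := Rle_lt_trans _ _ _ L2 Hw).
assert (M1 := Rmin_l (Rmin d1 d2) (eps / 6)); assert (M2 := Rmin_r (Rmin d1 d2) (eps / 6)).
assert (M3 := Rmin_l d1 d2); assert (M4 := Rmin_r d1 d2).
assert (M5 := Rmin_l 1 (eps / 6)); assert (M6 := Rmin_r 1 (eps / 6)).
specialize (K1 (Re w)); specialize (K2 (Im w)).
rewrite Rminus_0_r in K1, K2; specialize (K1 ltac:(lra)); specialize (K2 ltac:(lra)).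
rewrite exp_0 in K1.
replace (cis 0) with (RtoC 1) in K2 by (unfold cis; now rewrite cos_0, sin_0).
assert (Ew : w = (Re w + Ci * Im w)%C).
{ destruct w as [x y]; unfold Re, Im, Ci, RtoC, Cplus, Cmult; simpl; f_equal; ring. }
set (x := Re w) in *; set (y := Im w) in *.
assert (B1 : Rabs x <= Cmod w) by apply re_le_Cmod.
replace (Cexp w - 1 - 1 * w)%C with
 (cis y * RtoC (exp x - 1 - 1 * x) + x * (cis y - 1) + (cis y - 1 - Ci * 1 * y))%C.
2:{ unfold Cexp; fold x y; replace (1 * w)%C with (1 * (x + Ci * y))%C by (now rewrite <- Ew).
    rewrite !RtoC_minus, RtoC_mult; ring. }
set (m := Rmin 1 (eps / 6)) in *.
assert (T1 : Cmod (cis y - 1) <= 2 * Rabs y).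
{ replace (cis y - 1)%C with ((cis y - 1 - Ci * 1 * y) + Ci * y)%C by ring.
  apply Rle_trans with (1 := Cmod_triangle _ _); rewrite (Cmod_mult Ci), Cmod_Ci, Cmod_R.
  assert (H := Rabs_pos y); nra. }
apply Rle_trans with (1 := Cmod_triangle _ _).
apply Rle_trans with (1 := Rplus_le_compat_r _ _ _ (Cmod_triangle _ _)).
rewrite !Cmod_mult, Cmod_cis, !Cmod_R.
assert (P1 := Rabs_pos x); assert (P2 := Rabs_pos y).
assert (Q1 : Rabs x * Cmod (cis y - 1) <= eps / 6 * (2 * Cmod w)).
{ apply Rmult_le_compat; try assumption; try apply Cmod_ge_0; lra. }
nra.
Qed.

Lemma cderiv_Cexp (z : C) : cderiv Cexp z (Cexp z).
Proof.
apply (cderiv_ext_loc (fun w => Cexp z * Cexp (w + - z))%C).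
- apply filter_forall; intros w; rewrite <- Cexp_plus; f_equal; cring.
- apply (cderiv_eq _ _ (Cexp z * (1 * (1 + 0)))%C); [|cring].
  apply cderiv_scal, (cderiv_comp Cexp (fun w => w + - z)%C).
  + replace (z + - z)%C with (RtoC 0) by ring; apply cderiv_Cexp_0.
  + apply cderiv_plus; [apply cderiv_id|apply cderiv_const].
Qed.

Lemma continuous_Cexp {T : UniformSpace} (f : T -> C) (x : T) :
  continuous f x -> continuous (fun y => Cexp (f y)) x.
Proof. intros H; unfold Cexp; cont. Qed.

Lemma chol_Cexp (D : C -> Prop) (F F' : C -> C) : chol D F F' ->
  chol D (fun z => Cexp (F z)) (fun z => Cexp (F z) * F' z)%C.
Proof.
intros HF z Hz; destruct (HF z Hz) as [H1 H2]; split.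
- now apply (cderiv_comp Cexp F); [apply cderiv_Cexp|].
- cont; apply continuous_Cexp, (cderiv_continuous _ _ _ H1).
Qed.

Definition Clog (z : C) : C := (ln (Cmod z), Carg z).

Lemma Re_over_Cmod (z : C) : z <> 0%C -> -1 <= Re z / Cmod z <= 1.
Proof.
intros Hz; apply Cmod_gt_0 in Hz; assert (K := re_le_Cmod z); apply Rabs_le_between in K.
split; [apply Rle_div_r|apply Rle_div_l]; lra.
Qed.

Lemma Im_over_Cmod (z : C) : z <> 0%C -> sqrt (1 - (Re z / Cmod z)²) = Rabs (Im z) / Cmod z.
Proof.
intros Hz; apply Cmod_gt_0 in Hz.
rewrite <- (sqrt_Rsqr (Rabs (Im z) / Cmod z)).
- f_equal; assert (E := Cmod2_alt z); unfold Rsqr.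
  replace (Rabs (Im z) / Cmod z * (Rabs (Im z) / Cmod z)) with (Rabs (Im z) * Rabs (Im z) / Cmod z ^ 2) by (field; lra).
  replace (Rabs (Im z) * Rabs (Im z)) with (Cmod z ^ 2 - Re z ^ 2).
  + field; lra.
  + change (Cmod z ^ 2 - Re z ^ 2 = Rsqr (Rabs (Im z))); rewrite <- Rsqr_abs, E; unfold Rsqr; ring.
- apply Rdiv_le_0_compat; [apply Rabs_pos|exact Hz].
Qed.

Lemma cis_Carg (z : C) : z <> 0%C -> cis (Carg z) = (z / Cmod z)%C.
Proof.
intros Hz; assert (H1 := Re_over_Cmod z Hz); assert (H2 := Im_over_Cmod z Hz).
assert (H0 := proj1 (Cmod_gt_0 z) Hz).
assert (E : (z / Cmod z)%C = (Re z / Cmod z, Im z / Cmod z)).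
{ unfold Cdiv; rewrite <- RtoC_inv by lra; destruct z as [x y]; unfold RtoC, Cmult; simpl; f_equal; field; lra. }
rewrite E; unfold cis, Carg; destruct (Rle_dec 0 (Im z)) as [Hi|Hi].
- rewrite cos_acos, sin_acos, H2 by exact H1; now rewrite Rabs_pos_eq.
- rewrite cos_neg, sin_neg, cos_acos, sin_acos, H2 by exact H1.
  rewrite Rabs_left by lra; f_equal; field; lra.
Qed.

Lemma Cexp_Clog (z : C) : z <> 0%C -> Cexp (Clog z) = z.
Proof.
intros Hz; unfold Cexp, Clog; simpl.
rewrite exp_ln by now apply Cmod_gt_0.
rewrite cis_Carg by exact Hz; field.
intros E; apply Hz, Cmod_eq_0; now apply RtoC_inj.
Qed.

(** The definition of [Carg] through [acos] changes formula across the real axis. On the right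
    half-plane, which contains every [1 + b z] used below, this single formula yields continuity. *)
Lemma Carg_asin (z : C) : 0 < Re z -> Carg z = asin (Im z / Cmod z).
Proof.
intros Hr.
assert (Hz : z <> 0%C) by (intros E; rewrite E in Hr; simpl in Hr; lra).
assert (H0 := proj1 (Cmod_gt_0 z) Hz).
assert (Es : sin (Carg z) = Im z / Cmod z).
{ assert (E := f_equal Im (cis_Carg z Hz)).
  unfold Cdiv in E; rewrite <- RtoC_inv, im_scal_r in E by lra; exact E. }
rewrite <- Es, asin_sin; [reflexivity|].
assert (H1 := Re_over_Cmod z Hz).
assert (Hq : 0 <= Re z / Cmod z) by (apply Rdiv_le_0_compat; lra).
assert (B : 0 <= acos (Re z / Cmod z) <= PI / 2).
{ split; [apply acos_bound|].
  apply Rnot_lt_le; intros Hgt; assert (Hb := acos_bound (Re z / Cmod z)).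
  assert (K := cos_lt_0 _ Hgt ltac:(lra)); rewrite cos_acos in K by exact H1; lra. }
unfold Carg; destruct (Rle_dec 0 (Im z)); lra.
Qed.

Lemma continuous_Clog (z : C) : 0 < Re z -> continuous Clog z.
Proof.
intros Hr.
assert (Hz : z <> 0%C) by (intros E; rewrite E in Hr; simpl in Hr; lra).
assert (H0 := proj1 (Cmod_gt_0 z) Hz).
apply continuous_Cpair.
- cont; try exact H0.
- apply (continuous_ext_loc (T := C_UniformSpace) (U := R_UniformSpace)) with (fun w : C => asin (Im w / Cmod w)).
  + apply locally_Cmod; exists (Re z); split; [exact Hr|]; intros w Hw.
    symmetry; apply Carg_asin.
    assert (K := re_le_Cmod (w - z)); unfold Cminus in K; rewrite re_plus, re_opp in K.
    apply Rabs_le_between in K; unfold Cminus in Hw; lra.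
  + apply (continuous_comp (fun w : C => Im w / Cmod w) asin).
    * unfold Rdiv; cont; try apply continuous_id; lra.
    * apply continuity_pt_filterlim, derivable_continuous_pt, derivable_pt_asin.
      assert (E := Cmod2_alt z).
      assert (K : Rabs (Im z) < Cmod z).
      { apply Rabs_def1; nra. }
      apply Rabs_def2 in K; split; [apply Rlt_div_r|apply Rlt_div_l]; lra.
Qed.

(** Inverse function in Caratheodory's form: the factor of [Cexp] at [Clog z], composed with [Clog],
    does not vanish near [z], and its inverse is a factor for [Clog]. *)
Lemma cderiv_Clog (z : C) : 0 < Re z -> cderiv Clog z (/ z)%C.
Proof.
intros Hr.
assert (Hz : z <> 0%C) by (intros E; rewrite E in Hr; simpl in Hr; lra).
assert (HL := continuous_Clog z Hr).
destruct (cderiv_Cexp (Clog z)) as (Phi & H1 & H2 & H3).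
assert (E : Phi (Clog z) = z) by now rewrite H2, Cexp_Clog.
assert (Hc : continuous (fun w => Phi (Clog w)) z) by now apply continuous_comp.
exists (fun w => / Phi (Clog w))%C; split; [cont; simpl; rewrite E; exact Hz|split; [now rewrite E|]].
assert (N1 := HL _ H3).
assert (N2 := locally_neq0 (fun w => Phi (Clog w)) z Hc ltac:(simpl; rewrite E; exact Hz)).
assert (N3 := locally_neq0 (fun w => w) z (continuous_id z) Hz).
unfold filtermap in N1.
refine (filter_imp _ _ _ (filter_and _ _ N1 (filter_and _ _ N2 N3))).
intros w (K1 & K2 & K3).
rewrite !Cexp_Clog in K1 by assumption; rewrite K1; cfield; exact K2.
Qed.

Lemma Cpowr_Cexp (z : C) (s : R) : Cpowr z s = Cexp (s * Clog z).
Proof.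
unfold Cpowr, Cexp, Clog; rewrite re_scal_l, im_scal_l; reflexivity.
Qed.

(** * Schwarz integrals and the Schwarz-Pick inequality *)

Lemma exp_monotone (x y : R) : x <= y -> exp x <= exp y.
Proof. intros [H|H]; [left; now apply exp_increasing|rewrite H; lra]. Qed.

Lemma mean_nonneg (f : R -> R) : (forall t, continuous f t) -> (forall t, 0 <= f t) -> 0 <= mean f.
Proof. intros Hf H; rewrite <- (mean_const 0); apply mean_le; intros; cont; apply H. Qed.

Lemma continuous_Cmean_param (K : C -> R -> C) (m : R -> R) (z : C) (r : R) : 0 < r ->
  (forall t, continuous m t) ->
  (forall w t, Cmod (w - z) < r -> continuous (K w) t) ->
  (forall w t, Cmod (w - z) < r -> Cmod (K w t - K z t) <= m t * Cmod (w - z)) ->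
  continuous (fun w => Cmean (K w)) z.
Proof.
intros Hr Hm Hc HK; apply continuous_Cmod_iff; intros eps He.
assert (Hz : Cmod (z - z) < r) by (replace (z - z)%C with (RtoC 0) by ring; now rewrite Cmod_0).
set (M := Rmax 0 (mean m)).
assert (HM0 : 0 <= M) by apply Rmax_l.
assert (HM : mean m <= M) by apply Rmax_r.
exists (Rmin r (eps / (M + 1))); split; [apply Rmin_pos; [exact Hr|apply Rdiv_lt_0_compat; lra]|].
intros w Hw.
assert (H1 := Rlt_le_trans _ _ _ Hw (Rmin_l _ _)).
assert (H2 := Rlt_le_trans _ _ _ Hw (Rmin_r _ _)).
rewrite <- Cmean_minus by (intros t; now apply Hc).
eapply Rle_lt_trans; [apply Cmod_Cmean_le; intros t; apply continuous_Cminus; now apply Hc|].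
apply Rle_lt_trans with (mean (fun t => Cmod (w - z) * m t)).
- apply mean_le; intros t; [|cont|].
  + apply continuous_Cmod, continuous_Cminus; now apply Hc.
  + intros _; rewrite Rmult_comm; now apply HK.
- rewrite mean_scal by assumption.
  apply Rmult_lt_compat_r with (r := M + 1) in H2; [|lra].
  replace (eps / (M + 1) * (M + 1)) with eps in H2 by (field; lra).
  assert (H0 := Cmod_ge_0 (w - z)).
  assert (Cmod (w - z) * mean m <= Cmod (w - z) * M) by (now apply Rmult_le_compat_l); lra.
Qed.

(** The Schwarz integral, whose real part is the Poisson integral of [d]: its exponential is the
    outer function with boundary modulus [exp (d t)]. *)
Definition schwarz (d : R -> R) (z : C) : C :=
  Cmean (fun t => d t * ((cis t + z) / (cis t - z)))%C.

Definition schwarz' (d : R -> R) (z : C) : C :=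
  Cmean (fun t => d t * (2 * cis t / ((cis t - z) * (cis t - z))))%C.

Lemma cis_minus_near (z w : C) (t : R) : Cmod z < 1 -> Cmod (w - z) < (1 - Cmod z) / 2 ->
  (cis t - w)%C <> 0%C /\ / Cmod (cis t - w) <= 2 / (1 - Cmod z).
Proof.
intros Hz Hw; assert (K := Cmod_minus_ge w z).
assert (K2 := Cmod_cis_minus_ge t w).
assert (K3 : (1 - Cmod z) / 2 <= Cmod (cis t - w)) by lra.
split.
- apply Cmod_gt_0; lra.
- replace (2 / (1 - Cmod z)) with (/ ((1 - Cmod z) / 2)) by (field; lra).
  apply Rinv_le_contravar; lra.
Qed.

(** The difference quotient of the kernel is exactly [2 cis t / ((cis t - w) (cis t - z))], so the
    Caratheodory factor is again an integral, with an integrand Lipschitz in [w]. *)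
Lemma chol_schwarz (d : R -> R) : (forall t, continuous d t) ->
  chol (disk 1) (schwarz d) (schwarz' d).
Proof.
intros Hd z Hz; unfold disk in Hz.
set (q := 2 / (1 - Cmod z)).
assert (Hq : 0 < q) by (apply Rdiv_lt_0_compat; lra).
assert (Hr : 0 < (1 - Cmod z) / 2) by lra.
assert (Hnz : forall t, (cis t - z)%C <> 0%C /\ / Cmod (cis t - z) <= q).
{ intros t; apply cis_minus_near; [exact Hz|].
  replace (z - z)%C with (RtoC 0) by ring; now rewrite Cmod_0. }
split.
- exists (fun w => Cmean (fun t => d t * (2 * cis t / ((cis t - w) * (cis t - z))))%C); split; [|split].
  + apply (continuous_Cmean_param _ (fun t => 2 * q ^ 3 * Rabs (d t)) z ((1 - Cmod z) / 2) Hr); [intros; cont| |].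
    * intros w t Hw; destruct (cis_minus_near z w t Hz Hw) as [H1 _]; destruct (Hnz t) as [H2 _].
      cont; now apply Cmult_neq_0.
    * intros w t Hw; destruct (cis_minus_near z w t Hz Hw) as [H1 B1]; destruct (Hnz t) as [H2 B2]; fold q in B1.
      replace (d t * (2 * cis t / ((cis t - w) * (cis t - z))) - d t * (2 * cis t / ((cis t - z) * (cis t - z))))%C
        with (d t * 2 * cis t * (/ (cis t - w) * (/ (cis t - z) * / (cis t - z))) * (w - z))%C by (field; now split).
      rewrite !Cmod_mult, !Cmod_R, !Cmod_inv, Cmod_cis, (Rabs_pos_eq 2) by (try assumption; lra).
      apply Rmult_le_compat_r; [apply Cmod_ge_0|].
      replace (2 * q ^ 3 * Rabs (d t)) with (Rabs (d t) * 2 * 1 * (q * (q * q))) by ring.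
      assert (P1 : 0 < / Cmod (cis t - w)) by (apply Rinv_0_lt_compat; now apply Cmod_gt_0).
      assert (P2 : 0 < / Cmod (cis t - z)) by (apply Rinv_0_lt_compat; now apply Cmod_gt_0).
      apply Rmult_le_compat_l; [assert (K := Rabs_pos (d t)); lra|].
      apply Rmult_le_compat; [lra|nra|lra|].
      apply Rmult_le_compat; lra.
  + reflexivity.
  + apply locally_Cmod; exists ((1 - Cmod z) / 2); split; [exact Hr|]; intros w Hw.
    unfold schwarz; rewrite <- Cmean_minus, Cmult_comm, <- Cmean_scal.
    * apply Cmean_ext; intros t; destruct (cis_minus_near z w t Hz Hw) as [H1 B1]; destruct (Hnz t) as [H2 B2].
      field; now split.
    * intros t; destruct (cis_minus_near z w t Hz Hw) as [H1 B1]; destruct (Hnz t) as [H2 B2].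
      cont; now apply Cmult_neq_0.
    * intros t; destruct (cis_minus_near z w t Hz Hw) as [H1 B1]; cont.
    * intros t; destruct (Hnz t) as [H2 B2]; cont.
- apply (continuous_Cmean_param _ (fun t => 4 * q ^ 3 * Rabs (d t)) z ((1 - Cmod z) / 2) Hr); [intros; cont| |].
  + intros w t Hw; destruct (cis_minus_near z w t Hz Hw) as [H1 _].
    cont; now apply Cmult_neq_0.
  + intros w t Hw; destruct (cis_minus_near z w t Hz Hw) as [H1 B1]; destruct (Hnz t) as [H2 B2]; fold q in B1.
    replace (d t * (2 * cis t / ((cis t - w) * (cis t - w))) - d t * (2 * cis t / ((cis t - z) * (cis t - z))))%C
      with (d t * 2 * cis t * (/ (cis t - w) * / (cis t - z) * (/ (cis t - w) + / (cis t - z))) * (w - z))%C by (field; now split).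
    rewrite !Cmod_mult, !Cmod_R, Cmod_cis, (Rabs_pos_eq 2) by lra.
    apply Rmult_le_compat_r; [apply Cmod_ge_0|].
    assert (T := Cmod_triangle (/ (cis t - w)) (/ (cis t - z))).
    rewrite !Cmod_inv in * by assumption.
    replace (4 * q ^ 3 * Rabs (d t)) with (Rabs (d t) * 2 * 1 * (q * q * (q + q))) by ring.
    assert (P1 : 0 < / Cmod (cis t - w)) by (apply Rinv_0_lt_compat; now apply Cmod_gt_0).
    assert (P2 : 0 < / Cmod (cis t - z)) by (apply Rinv_0_lt_compat; now apply Cmod_gt_0).
    apply Rmult_le_compat_l; [assert (K := Rabs_pos (d t)); lra|].
    apply Rmult_le_compat; [nra|apply Cmod_ge_0| |lra].
    apply Rmult_le_compat; lra.
Qed.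

Lemma schwarz_0 (d : R -> R) : schwarz d 0 = mean d.
Proof.
unfold schwarz; rewrite <- Cmean_RtoC; apply Cmean_ext; intros t.
replace (cis t - 0)%C with (cis t) by ring; field; apply cis_neq0.
Qed.

Lemma Re_schwarz'_0 (d : R -> R) : (forall t, continuous d t) ->
  Re (schwarz' d 0) = 2 * mean (fun t => d t * cos t).
Proof.
intros Hd; unfold schwarz'; rewrite Re_Cmean, <- mean_scal by (intros; cont).
apply mean_ext; intros t.
replace (2 * cis t / ((cis t - 0) * (cis t - 0)))%C with (2 * Cconj (cis t))%C.
- unfold Re, Cconj, cis; simpl; ring.
- rewrite cis_conj; replace (cis t - 0)%C with (cis t) by ring; field; apply cis_neq0.
Qed.

Lemma Cmod_schwarz_le (d : R -> R) (z : C) : (forall t, continuous d t) -> Cmod z < 1 ->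
  Cmod (schwarz d z) <= 2 / (1 - Cmod z) * mean (fun t => Rabs (d t)).
Proof.
intros Hd Hz; assert (Hm := fun t => cis_minus_neq0 z t Hz).
unfold schwarz; eapply Rle_trans; [apply Cmod_Cmean_le; intros t; specialize (Hm t); cont|].
rewrite <- mean_scal by (intros; cont).
apply mean_le; intros t; [specialize (Hm t); cont|cont|intros _].
rewrite Cmod_mult, Cmod_div, Cmod_R, Rmult_comm by apply Hm.
apply Rmult_le_compat_r; [apply Rabs_pos|].
assert (T := Cmod_triangle (cis t) z); rewrite Cmod_cis in T.
apply Rmult_le_compat; [apply Cmod_ge_0| |lra|].
- left; apply Rinv_0_lt_compat; apply Cmod_gt_0, Hm.
- apply Rinv_le_contravar; [lra|apply Cmod_cis_minus_ge].
Qed.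

(** In product form, the identity gives the Poisson mean of the cosine from that of 1 by linearity,
    without expanding the kernel. *)
Lemma poisson_kernel (s th t : R) : 0 < s < 1 ->
  0 <= Re ((cis t + s * cis th) / (cis t - s * cis th))%C /\
  Re ((cis t + s * cis th) / (cis t - s * cis th))%C * (1 - 2 * s * cos (t - th) + s ^ 2) = 1 - s ^ 2.
Proof.
intros Hs.
assert (Hz : Cmod (s * cis th) < 1) by (rewrite Cmod_mult, Cmod_cis, Cmod_R, Rabs_pos_eq; lra).
assert (Hm := cis_minus_neq0 (s * cis th) t Hz).
assert (Hp := Csqr_pos _ Hm).
assert (E1 : fst (cis t - s * cis th)%C ^ 2 + snd (cis t - s * cis th)%C ^ 2 = 1 - 2 * s * cos (t - th) + s ^ 2).
{ rewrite cos_minus; assert (H1 := sin2_cos2 t); assert (H2 := sin2_cos2 th); unfold Rsqr in *.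
  unfold cis; simpl; nra. }
assert (E2 : Re ((cis t + s * cis th) / (cis t - s * cis th))%C = (1 - s ^ 2) / (1 - 2 * s * cos (t - th) + s ^ 2)).
{ unfold Cdiv, Cinv; rewrite E1; rewrite E1 in Hp.
  unfold Re, cis; simpl fst; simpl snd.
  assert (H1 := sin2_cos2 t); assert (H2 := sin2_cos2 th); unfold Rsqr in *.
  field_simplify; [|lra|lra]; f_equal; nra. }
rewrite E1 in Hp; rewrite E2; split.
- apply Rdiv_le_0_compat; nra.
- field; lra.
Qed.

(* Korovkin's argument: only the Poisson means of 1 and cos enter. *)
Lemma poisson_lower_bound (d : R -> R) (s th eta c : R) : (forall t, continuous d t) ->
  0 < s < 1 ->
  (forall t, 0 <= t <= 2 * PI -> d th - eta - c * (1 - cos (t - th)) <= d t) ->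
  d th - eta - c * (1 - s) <= Re (schwarz d (s * cis th)).
Proof.
intros Hd Hs H.
assert (Hz : Cmod (s * cis th) < 1) by (rewrite Cmod_mult, Cmod_cis, Cmod_R, Rabs_pos_eq; lra).
assert (Hm := fun t => cis_minus_neq0 (s * cis th) t Hz).
set (P := fun t => Re ((cis t + s * cis th) / (cis t - s * cis th))%C).
assert (HP : forall t, continuous P t) by (intros t; unfold P; specialize (Hm t); cont).
assert (HP0 : forall t, 0 <= P t) by (intros t; now apply poisson_kernel).
assert (E1 : mean P = 1).
{ unfold P; rewrite <- Re_Cmean, (Cmean_ext _ (fun t => 2 * (cis t / (cis t - s * cis th)) - 1)%C).
  - rewrite Cmean_minus, Cmean_scal, Cmean_kernel, Cmean_const by (try exact Hz; intros t; specialize (Hm t); cont).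
    unfold Re; simpl; ring.
  - intros t; field; apply Hm. }
assert (E2 : mean (fun t => cos (t - th) * P t) = s).
{ assert (E : mean (fun t => (1 + s ^ 2) * P t - 2 * s * (cos (t - th) * P t)) = 1 - s ^ 2).
  { rewrite <- (mean_const (1 - s ^ 2)); apply mean_ext; intros t.
    rewrite <- (proj2 (poisson_kernel s th t Hs)); unfold P; ring. }
  rewrite mean_minus, !mean_scal, E1 in E by (intros; cont).
  apply Rmult_eq_reg_l with (2 * s); [lra|lra]. }
assert (E3 : mean (fun t => (d th - eta - c) * P t + c * (cos (t - th) * P t)) = d th - eta - c * (1 - s)).
{ rewrite mean_plus, !mean_scal, E1, E2 by (intros; cont); ring. }
rewrite <- E3; unfold schwarz; rewrite Re_Cmean.
apply mean_le; intros t; [cont|specialize (Hm t); cont|intros Ht].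
rewrite re_scal_l; fold (P t).
replace ((d th - eta - c) * P t + c * (cos (t - th) * P t))
  with ((d th - eta - c * (1 - cos (t - th))) * P t) by ring.
apply Rmult_le_compat_r; [apply HP0|now apply H].
Qed.

(** If the two angles are close modulo 2 pi, uniform continuity suffices; otherwise
    [c * (1 - cos k)] equals the whole oscillation of [d]. Angles near opposite ends of the interval
    are compared through [d (2 * PI) = d 0], which costs two steps of [eta / 2]. *)
Lemma periodic_modulus (d : R -> R) (eta : R) : (forall t, continuous d t) -> d (2 * PI) = d 0 ->
  0 < eta -> exists c, 0 <= c /\ forall t th, 0 <= t <= 2 * PI -> 0 <= th <= 2 * PI ->
    d th - eta - c * (1 - cos (t - th)) <= d t.
Proof.
intros Hd Hper He; assert (HPI := PI_RGT_0).
assert (Hc : forall x, 0 <= x <= 2 * PI -> continuity_pt d x) by (intros; apply continuity_pt_filterlim, Hd).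
destruct (continuity_ab_maj d 0 (2 * PI) ltac:(lra) Hc) as (xM & HxM & _).
destruct (continuity_ab_min d 0 (2 * PI) ltac:(lra) Hc) as (xm & Hxm & _).
assert (He2 : 0 < eta / 2) by lra.
destruct (Heine_cor2 Hc (mkposreal _ He2)) as [k0 Hk0]; simpl in Hk0.
set (k := Rmin k0 (PI / 2)).
assert (Hk : 0 < k) by (apply Rmin_pos; [apply cond_pos|lra]).
assert (Hk1 : k <= k0) by apply Rmin_l.
assert (Hk2 : k <= PI / 2) by apply Rmin_r.
assert (Hcos : cos k < 1) by (rewrite <- cos_0; apply cos_decreasing_1; lra).
set (c := (d xM - d xm) / (1 - cos k)).
assert (HMm : d xm <= d xM) by (apply Rle_trans with (d 0); [apply Hxm|apply HxM]; lra).
assert (Hc0 : 0 <= c) by (apply Rdiv_le_0_compat; lra).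
exists c; split; [exact Hc0|]; intros t th Ht Hth.
assert (Hpos : 0 <= c * (1 - cos (t - th))).
{ apply Rmult_le_pos; [exact Hc0|assert (K := COS_bound (t - th)); lra]. }
assert (Hfar : cos (t - th) <= cos k -> d th - eta - c * (1 - cos (t - th)) <= d t).
{ intros Hle; assert (K : c * (1 - cos k) <= c * (1 - cos (t - th))) by (apply Rmult_le_compat_l; lra).
  assert (E : c * (1 - cos k) = d xM - d xm) by (unfold c; field; lra).
  specialize (HxM th Hth); specialize (Hxm t Ht); lra. }
assert (Hnear : forall x y, 0 <= x <= 2 * PI -> 0 <= y <= 2 * PI -> Rabs (x - y) < k -> d y - d x < eta / 2).
{ intros x y Hx Hy Hxy; specialize (Hk0 x y Hx Hy ltac:(lra)); apply Rabs_def2 in Hk0; lra. }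
assert (Hsmall : forall x, 0 <= x < k -> Rabs (x - 0) < k /\ Rabs (0 - x) < k /\
   Rabs (2 * PI - (2 * PI - x)) < k /\ Rabs (2 * PI - x - 2 * PI) < k).
{ intros x Hx; repeat split; apply Rabs_def1; lra. }
destruct (Rlt_le_dec (Rabs (t - th)) k) as [L1|L1].
{ specialize (Hnear t th Ht Hth L1); lra. }
destruct (Rle_lt_dec th t) as [L|L].
- rewrite Rabs_pos_eq in L1 by lra.
  destruct (Rle_lt_dec (t - th) (2 * PI - k)) as [L2|L2].
  + apply Hfar; destruct (Rle_lt_dec (t - th) PI) as [L3|L3].
    * apply cos_decr_1; lra.
    * replace (t - th) with (- (2 * PI - (t - th)) + 2 * PI) by ring.
      rewrite cos_plus, cos_2PI, sin_2PI, cos_neg, Rmult_1_r, Rmult_0_r, Rminus_0_r.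
      apply cos_decr_1; lra.
  + destruct (Hsmall th ltac:(lra)) as (_ & S2 & _ & _).
    destruct (Hsmall (2 * PI - t) ltac:(lra)) as (_ & _ & _ & S4).
    replace (2 * PI - (2 * PI - t) - 2 * PI) with (t - 2 * PI) in S4 by ring.
    assert (N1 := Hnear 0 th ltac:(lra) Hth S2).
    assert (N2 := Hnear t (2 * PI) Ht ltac:(lra) S4); lra.
- rewrite Rabs_left in L1 by lra; replace (t - th) with (- (th - t)) in * by ring; rewrite cos_neg in *.
  destruct (Rle_lt_dec (th - t) (2 * PI - k)) as [L2|L2].
  + apply Hfar; destruct (Rle_lt_dec (th - t) PI) as [L3|L3].
    * apply cos_decr_1; lra.
    * replace (th - t) with (- (2 * PI - (th - t)) + 2 * PI) by ring.
      rewrite cos_plus, cos_2PI, sin_2PI, cos_neg, Rmult_1_r, Rmult_0_r, Rminus_0_r.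
      apply cos_decr_1; lra.
  + destruct (Hsmall t ltac:(lra)) as (S1 & _ & _ & _).
    destruct (Hsmall (2 * PI - th) ltac:(lra)) as (_ & _ & S3 & _).
    replace (2 * PI - (2 * PI - (2 * PI - th))) with (2 * PI - th) in S3 by ring.
    assert (N1 := Hnear t 0 Ht ltac:(lra) S1).
    assert (N2 := Hnear (2 * PI) th ltac:(lra) Hth S3); lra.
Qed.

Lemma nonneg_of_continuous (g : R -> R) (x0 : R) : continuous g x0 ->
  (forall eps, 0 < eps -> exists x, Rabs (x - x0) < eps /\ 0 <= g x) -> 0 <= g x0.
Proof.
intros Hg H; apply Rnot_lt_le; intros Hlt.
assert (Hp : 0 < - g x0) by lra.
destruct (Hg _ (locally_ball (g x0) (mkposreal _ Hp))) as [e He].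
destruct (H e (cond_pos e)) as (x & Hx & Hgx).
specialize (He x Hx); apply Rabs_def2 in He.
unfold minus, plus, opp in He; simpl in He; lra.
Qed.

Lemma mean_cos : mean cos = 0.
Proof. exact (f_equal Re Cmean_cis). Qed.

Lemma mean_Cmod2_affine (a : R) : mean (fun t => Cmod (1 + a * cis t) ^ 2) = 1 + a ^ 2.
Proof.
rewrite (mean_ext _ (fun t => (1 + a ^ 2) + 2 * a * cos t)).
- rewrite mean_plus, mean_scal, mean_cos, mean_const by (intros; cont); ring.
- intros t; rewrite Cmod2_plus, Cmod_mult, Cmod_cis, !Cmod_R, Rabs_R1, Rmult_1_r, pow2_abs.
  unfold Re, Cconj, cis; simpl; ring.
Qed.

Lemma chol_weaken (D E : C -> Prop) (F F' : C -> C) :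
  (forall z, E z -> D z) -> chol D F F' -> chol E F F'.
Proof. intros H HF z Hz; apply HF, H, Hz. Qed.

Lemma chol_ext (D : C -> Prop) (F F' G G' : C -> C) :
  (forall z, F z = G z) -> (forall z, F' z = G' z) -> chol D F F' -> chol D G G'.
Proof.
intros H H' HF z Hz; destruct (HF z Hz) as [H1 H2]; split.
- rewrite <- H'; apply (cderiv_ext_loc F); [apply filter_forall, H|exact H1].
- apply continuous_ext with F'; assumption.
Qed.

Lemma chol_opp (D : C -> Prop) (F F' : C -> C) :
  chol D F F' -> chol D (fun z => - F z)%C (fun z => - F' z)%C.
Proof. intros HF z Hz; destruct (HF z Hz) as [H1 H2]; split; [now apply cderiv_opp|cont]. Qed.

Lemma chol_affine (D : C -> Prop) (a b : C) : chol D (fun z => a + b * z)%C (fun _ => b).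
Proof.
intros z _; split; [|cont].
apply (cderiv_eq _ _ (0 + b * 1)%C); [|cring].
apply (cderiv_plus (fun _ => a)); [apply cderiv_const|apply cderiv_scal, cderiv_id].
Qed.

(* Only [schwarz d (s z)] with [s < 1] is controlled on the unit circle; [s] tends to 1 at the end.
   [z = 0] gives the inequality between [b0] and [b1], general [z] the stability of the equality case. *)
Lemma schwarz_pick (F F' : C -> C) (rho : R) (d : R -> R) (a : R) (z : C) :
  1 < rho -> chol (disk rho) F F' -> (forall t, continuous d t) -> d (2 * PI) = d 0 ->
  (forall t, 0 <= t <= 2 * PI -> Cmod (F (cis t)) <= exp (d t)) -> Cmod z < 1 ->
  let b0 := (F 0 * exp (- mean d))%C in
  let b1 := ((F' 0 - F 0 * schwarz' d 0) * exp (- mean d))%C in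
  (1 - Cmod z) ^ 2 * Cmod (F z * Cexp (- schwarz d z) * (1 + a * z) - b0 - (b1 + a * b0) * z) ^ 2
   <= 1 + a ^ 2 - Cmod b0 ^ 2 - Cmod (b1 + a * b0) ^ 2.
Proof.
intros Hr HF Hd Hper Hbound Hz b0 b1.
assert (HcF := chol_continuous_cis F F' rho Hr HF).
assert (HS := chol_schwarz d Hd).
assert (Hdil : forall s, 0 < s < 1 -> forall eta, 0 < eta -> forall c,
  (forall t th, 0 <= t <= 2 * PI -> 0 <= th <= 2 * PI -> d th - eta - c * (1 - cos (t - th)) <= d t) ->
  let b1s := ((F' 0 - F 0 * (s * schwarz' d 0)) * exp (- mean d) + a * b0)%C in
  (1 - Cmod z) ^ 2 * Cmod (F z * Cexp (- schwarz d (0 + s * z)) * (1 + a * z) - b0 - b1s * z) ^ 2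
   <= exp (2 * (eta + c * (1 - s))) * (1 + a ^ 2) - Cmod b0 ^ 2 - Cmod b1s ^ 2).
{ intros s Hs eta Heta c Hmod b1s.
  (* [/ s] is the radius up to which the dilated Schwarz integral is holomorphic; it exceeds 1, so
     the Parseval bound applies. *)
  set (r := Rmin rho (/ s)).
  assert (Hs1 : 1 < / s) by (rewrite <- Rinv_1; apply Rinv_lt_contravar; lra).
  assert (Hr1 : 1 < r) by (now apply Rmin_glb_lt).
  assert (HSs : chol (disk r) (fun z => schwarz d (0 + s * z))%C (fun z => s * schwarz' d (0 + s * z))%C).
  { apply (chol_comp_affine _ _ (disk 1)); [|exact HS].
    unfold disk; intros w Hw; rewrite Cplus_0_l, Cmod_mult, Cmod_R, Rabs_pos_eq by lra.
    assert (Hw2 := Rlt_le_trans _ _ _ Hw (Rmin_r _ _)).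
    apply Rmult_lt_compat_l with (r := s) in Hw2; [|lra]; rewrite Rinv_r in Hw2; lra. }
  assert (HFr : chol (disk r) F F').
  { apply (chol_weaken (disk rho)); [|exact HF].
    unfold disk; intros w Hw; apply Rlt_le_trans with (1 := Hw), Rmin_l. }
  assert (HG := chol_mult _ _ _ _ _ (chol_mult _ _ _ _ _ HFr (chol_Cexp _ _ _ (chol_opp _ _ _ HSs)))
     (chol_affine _ 1 a)).
  set (G := fun z => (F z * Cexp (- schwarz d (0 + s * z)) * (1 + a * z))%C) in HG.
  assert (HB := remainder_bound G _ r z Hr1 HG Hz); cbv beta in HB.
  assert (E00 : (0 + s * 0)%C = RtoC 0) by ring.
  assert (E0 : Cexp (- schwarz d 0) = exp (- mean d)) by (rewrite schwarz_0, <- RtoC_opp; apply Cexp_RtoC).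
  assert (EG0 : G 0%C = b0) by (unfold G, b0; rewrite E00, E0; ring).
  rewrite EG0, E00, E0 in HB.
  match type of HB with context [Cmod (G z - b0 - ?x * z)] => replace x with b1s in HB by (unfold b1s, b0; ring) end.
  apply Rle_trans with (1 := HB).
  do 2 apply Rplus_le_compat_r.
  rewrite <- mean_Cmod2_affine, <- mean_scal by (intros; cont).
  assert (HcS := chol_continuous_cis _ _ r Hr1 HSs).
  apply mean_le; intros t.
  - unfold G; cont; apply continuous_Cexp; cont.
  - cont.
  - intros Ht; unfold G; rewrite Cmod_mult, Rpow_mult_distr.
    apply Rmult_le_compat_r; [apply pow2_ge_0|].
    replace (exp (2 * (eta + c * (1 - s)))) with (exp (eta + c * (1 - s)) ^ 2)
      by (simpl; rewrite Rmult_1_r, <- exp_plus; f_equal; ring).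
    apply pow_incr; split; [apply Cmod_ge_0|].
    rewrite Cmod_mult, Cmod_Cexp, re_opp, Cplus_0_l.
    assert (L := poisson_lower_bound d s t eta c Hd Hs (fun x Hx => Hmod x t Hx Ht)).
    apply Rle_trans with (exp (d t) * exp (- Re (schwarz d (s * cis t)))).
    + apply Rmult_le_compat_r; [left; apply exp_pos|now apply Hbound].
    + rewrite <- exp_plus; apply exp_monotone; lra. }
assert (Hlim : forall eta, 0 < eta ->
  (1 - Cmod z) ^ 2 * Cmod (F z * Cexp (- schwarz d z) * (1 + a * z) - b0 - (b1 + a * b0) * z) ^ 2
   <= exp (2 * eta) * (1 + a ^ 2) - Cmod b0 ^ 2 - Cmod (b1 + a * b0) ^ 2).
{ intros eta Heta; destruct (periodic_modulus d eta Hd Hper Heta) as (c & Hc & Hmod).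
  set (g := fun s : R => exp (2 * (eta + c * (1 - s))) * (1 + a ^ 2) - Cmod b0 ^ 2
     - Cmod ((F' 0 - F 0 * (s * schwarz' d 0)) * exp (- mean d) + a * b0)%C ^ 2
     - (1 - Cmod z) ^ 2 * Cmod (F z * Cexp (- schwarz d (0 + s * z)) * (1 + a * z) - b0 -
        ((F' 0 - F 0 * (s * schwarz' d 0)) * exp (- mean d) + a * b0) * z)%C ^ 2).
  assert (Hg : 0 <= g 1).
  { apply nonneg_of_continuous.
    - unfold g; cont; apply continuous_Cexp; cont.
      apply (continuous_comp (fun s : R => 0 + s * z)%C (schwarz d)); [cont|].
      assert (E1 : (0 + 1 * z)%C = z) by ring; rewrite E1.
      destruct (HS z Hz) as [K _]; exact (cderiv_continuous _ _ _ K).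
    - intros eps He; exists (1 - Rmin (1 / 2) (eps / 2)).
      assert (M1 : 0 < Rmin (1 / 2) (eps / 2)) by (apply Rmin_pos; lra).
      assert (M2 := Rmin_l (1 / 2) (eps / 2)); assert (M3 := Rmin_r (1 / 2) (eps / 2)).
      split; [apply Rabs_def1; lra|].
      assert (K := Hdil (1 - Rmin (1 / 2) (eps / 2)) ltac:(lra) eta Heta c Hmod); unfold g; simpl in *; lra. }
  unfold g in Hg.
  replace (0 + 1 * z)%C with z in Hg by ring.
  replace ((F' 0 - F 0 * (1 * schwarz' d 0)) * exp (- mean d) + a * b0)%C with (b1 + a * b0)%C in Hg by (unfold b1; ring).
  replace (2 * (eta + c * (1 - 1))) with (2 * eta) in Hg by ring.
  lra. }
set (g := fun eta : R => exp (2 * eta) * (1 + a ^ 2) - Cmod b0 ^ 2 - Cmod (b1 + a * b0) ^ 2 -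
  (1 - Cmod z) ^ 2 * Cmod (F z * Cexp (- schwarz d z) * (1 + a * z) - b0 - (b1 + a * b0) * z) ^ 2).
assert (Hg : 0 <= g 0).
{ apply nonneg_of_continuous.
  - unfold g; cont.
  - intros eps He; exists (eps / 2); split; [apply Rabs_def1; lra|].
    specialize (Hlim (eps / 2) ltac:(lra)); unfold g; lra. }
unfold g in Hg; rewrite Rmult_0_r, exp_0 in Hg; lra.
Qed.

(** * The Lebedev-Milin inequality *)

Definition log_weight (b t : R) : R := ln (1 + 2 * b * cos t + b ^ 2).

Lemma weight_lower (b t : R) : 0 <= b < 1 -> (1 - b) ^ 2 <= 1 + 2 * b * cos t + b ^ 2.
Proof. intros Hb; assert (K := COS_bound t); nra. Qed.

Lemma weight_pos (b t : R) : 0 <= b < 1 -> 0 < 1 + 2 * b * cos t + b ^ 2.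
Proof. intros Hb; apply Rlt_le_trans with (2 := weight_lower b t Hb); nra. Qed.

Lemma continuous_log_weight (b t : R) : 0 <= b < 1 -> continuous (log_weight b) t.
Proof. intros Hb; unfold log_weight; cont; now apply weight_pos. Qed.

Lemma exp_log_weight (b t : R) : 0 <= b < 1 -> exp (log_weight b t) = 1 + 2 * b * cos t + b ^ 2.
Proof. intros Hb; unfold log_weight; apply exp_ln; now apply weight_pos. Qed.

Lemma Re_one_plus (b : R) (z : C) : 0 <= b -> b * Cmod z < 1 -> 0 < Re (1 + b * z)%C.
Proof.
intros Hb Hz; rewrite re_plus, re_scal_l; change (Re 1) with 1.
assert (K := re_le_Cmod z); apply Rabs_le_between in K; nra.
Qed.

Lemma chol_log1p (b rho : R) : 0 <= b -> b * rho <= 1 ->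
  chol (disk rho) (fun z => Clog (1 + b * z)) (fun z => b / (1 + b * z))%C.
Proof.
intros Hb Hbr z Hz; unfold disk in Hz.
assert (Hp : 0 < Re (1 + b * z)%C).
{ apply Re_one_plus; [exact Hb|].
  destruct (Req_dec b 0) as [->|N]; [lra|]; nra. }
assert (H0 : (1 + b * z)%C <> 0%C) by (intros E; rewrite E in Hp; simpl in Hp; lra).
split; [|cont].
apply (cderiv_eq _ _ (/ (1 + b * z) * (0 + b * 1))%C); [|cfield; exact H0].
apply (cderiv_comp Clog (fun z => 1 + b * z)%C); [now apply cderiv_Clog|].
apply (cderiv_plus (fun _ => 1%C)); [apply cderiv_const|apply cderiv_scal, cderiv_id].
Qed.

Lemma Re_Clog_cis (b t : R) : 0 <= b < 1 -> 2 * Re (Clog (1 + b * cis t)) = log_weight b t.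
Proof.
intros Hb; unfold Clog, log_weight; simpl.
assert (E : Cmod (1 + b * cis t) ^ 2 = 1 + 2 * b * cos t + b ^ 2).
{ rewrite Cmod2_plus, Cmod_mult, Cmod_cis, !Cmod_R, Rabs_R1, Rmult_1_r, pow2_abs.
  unfold Re, Cconj, cis; simpl; ring. }
assert (Hp := weight_pos b t Hb).
assert (H0 : 0 < Cmod (1 + b * cis t)).
{ assert (K := Cmod_ge_0 (1 + b * cis t)); nra. }
change (1 + 2 * b * cos t + b * (b * 1)) with (1 + 2 * b * cos t + b ^ 2).
rewrite <- E; simpl; rewrite Rmult_1_r, ln_mult by assumption; ring.
Qed.

(** [log_weight b] is twice the real part of [F = Clog (1 + b z)] on the circle; [F] is holomorphic
    across it, with value 0 and derivative [b] at 0. The second mean uses [2 cos t Re F = Re (F /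
    cis t) + Re (F cis t)], where the last term has mean 0. *)
Lemma mean_log_weight (b : R) : 0 <= b < 1 ->
  mean (log_weight b) = 0 /\ mean (fun t => log_weight b t * cos t) = b.
Proof.
intros Hb; set (rho := 2 / (1 + b)).
assert (Hr : 1 < rho) by (apply Rlt_div_r; lra).
assert (Hbr : b * rho <= 1).
{ unfold rho; replace (b * (2 / (1 + b))) with (2 * b / (1 + b)) by (field; lra).
  apply Rle_div_l; lra. }
assert (HF := chol_log1p b rho (proj1 Hb) Hbr).
assert (Hc := chol_continuous_cis _ _ rho Hr HF).
assert (Hn := cis_neq0).
assert (E0 := Cmean_holomorphic _ _ rho Hr HF).
assert (E1 := Cmean_holomorphic_coef1 _ _ rho Hr HF).
assert (E2 := Cmean_holomorphic_mul _ _ rho Hr HF).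
cbv beta in *.
replace (1 + b * 0)%C with (RtoC 1) in * by ring.
split.
- rewrite (mean_ext _ (fun t => 2 * Re (Clog (1 + b * cis t)%C))) by (intros; now rewrite Re_Clog_cis).
  rewrite mean_scal, <- Re_Cmean, E0 by (intros; cont).
  unfold Clog; simpl; rewrite Cmod_1, ln_1; ring.
- rewrite (mean_ext _ (fun t => Re (Clog (1 + b * cis t) * / cis t)%C + Re (Clog (1 + b * cis t) * cis t)%C)).
  + rewrite mean_plus, <- !Re_Cmean, E1, E2 by (intros t; specialize (Hn t); cont).
    replace (b / 1)%C with (RtoC b) by field; unfold Re; simpl; ring.
  + intros t; rewrite <- Re_Clog_cis, <- cis_conj by exact Hb; unfold Re, Cconj, cis; simpl; ring.
Qed.

(** The gap between exp and its tangent line at [c + log_weight b t], evaluated at [v t]: the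
    remainder of the Lebedev-Milin inequality. *)
Definition exp_deficit (v : R -> R) (b c t : R) : R :=
  exp (v t) - exp (c + log_weight b t) * (1 + v t - (c + log_weight b t)).

Lemma continuous_exp_deficit (v : R -> R) (b c t : R) : 0 <= b < 1 -> (forall t, continuous v t) ->
  continuous (exp_deficit v b c) t.
Proof.
intros Hb Hv; assert (Hw := fun t => continuous_log_weight b t Hb); unfold exp_deficit; cont.
Qed.

Lemma mean_exp_deficit (v : R -> R) (b c : R) : 0 <= b < 1 -> (forall t, continuous v t) ->
  mean (exp_deficit v b c) = mean (fun t => exp (v t)) -
   exp c * ((1 + b ^ 2) * (1 + mean v - c) + 2 * b * mean (fun t => v t * cos t) - 2 * b ^ 2).
Proof.
intros Hb Hv; assert (Hw := fun t => continuous_log_weight b t Hb).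
destruct (mean_log_weight b Hb) as [E1 E2].
rewrite (mean_ext _ (fun t => exp (v t) - exp c * (((1 + b ^ 2) * (1 - c) + (2 * b * (1 - c)) * cos t
    + ((1 + b ^ 2) * v t + 2 * b * (v t * cos t)))
    - ((1 + b ^ 2) * log_weight b t + 2 * b * (log_weight b t * cos t))))).
- rewrite mean_minus, mean_scal, mean_minus, !mean_plus, !mean_scal, mean_cos, mean_const, E1, E2 by (intros; cont).
  ring.
- intros t; unfold exp_deficit; rewrite exp_plus, exp_log_weight by exact Hb; ring.
Qed.

(* From the tangent lines of exp at ln (1 + eta) and ln (1 - eta). *)
Lemma exp_deficit_lower (x eta : R) : 0 < eta < 1 -> Rabs x <= eta + (exp x - 1 - x) / eta.
Proof.
intros He.
assert (H : forall k, -1 < k < 1 -> k * x - k ^ 2 <= exp x - 1 - x).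
{ intros k Hk.
  assert (H1 := exp_ineq1_le (x - ln (1 + k))).
  assert (H2 := exp_ineq1_le (ln (1 + k))); rewrite exp_ln in H2 by lra.
  assert (E : exp (x - ln (1 + k)) = exp x * / (1 + k))
    by (unfold Rminus; rewrite exp_plus, exp_Ropp, exp_ln; lra).
  rewrite E in H1; apply Rmult_le_compat_l with (r := 1 + k) in H1; [|lra].
  replace ((1 + k) * (exp x * / (1 + k))) with (exp x) in H1 by (field; lra).
  nra. }
assert (H1 := H eta ltac:(lra)); assert (H2 := H (- eta) ltac:(lra)).
assert (K : eta * Rabs x <= eta * (eta + (exp x - 1 - x) / eta)).
{ replace (eta * (eta + (exp x - 1 - x) / eta)) with (eta ^ 2 + (exp x - 1 - x)) by (field; lra).
  unfold Rabs; destruct (Rcase_abs x); nra. }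
apply Rmult_le_reg_l with (2 := K); lra.
Qed.

Lemma exp_deficit_eq (v : R -> R) (b c t : R) :
  exp_deficit v b c t = exp (c + log_weight b t) *
   (exp (v t - (c + log_weight b t)) - 1 - (v t - (c + log_weight b t))).
Proof.
unfold exp_deficit; set (w := c + log_weight b t).
assert (E : exp (v t - w) = exp (v t) * / exp w) by (unfold Rminus; now rewrite exp_plus, exp_Ropp).
rewrite E; field; apply Rgt_not_eq, exp_pos.
Qed.

Lemma exp_deficit_nonneg (v : R -> R) (b c t : R) : 0 <= exp_deficit v b c t.
Proof.
rewrite exp_deficit_eq; apply Rmult_le_pos; [left; apply exp_pos|].
assert (K := exp_ineq1_le (v t - (c + log_weight b t))); lra.
Qed.

(** Stability of the Lebedev-Milin inequality: since [b < 1], the weight is at least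
    [exp c * (1 - b) ^ 2], and a small mean deficit forces a small L^1 distance. *)
Lemma mean_dist_log_weight (v : R -> R) (b c eta : R) : 0 <= b < 1 -> (forall t, continuous v t) ->
  0 < eta < 1 ->
  mean (fun t => Rabs (v t - (c + log_weight b t))) <=
    eta + mean (exp_deficit v b c) / (eta * exp c * (1 - b) ^ 2).
Proof.
intros Hb Hv He; assert (Hw := fun t => continuous_log_weight b t Hb).
assert (HD := fun t => continuous_exp_deficit v b c t Hb Hv).
assert (P1 := exp_pos c); assert (P2 : 0 < (1 - b) ^ 2) by nra.
set (q := / (eta * exp c * (1 - b) ^ 2)).
assert (Hq : 0 < q) by (apply Rinv_0_lt_compat; repeat apply Rmult_lt_0_compat; lra).
apply Rle_trans with (mean (fun t => eta + q * exp_deficit v b c t)).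
2:{ rewrite mean_plus, mean_const, mean_scal by (intros; cont); unfold q; right; field.
    repeat split; try lra; nra. }
apply mean_le; intros t; [cont|cont|intros _].
apply Rle_trans with (1 := exp_deficit_lower _ _ He); apply Rplus_le_compat_l.
rewrite exp_deficit_eq, exp_plus, exp_log_weight by exact Hb.
set (phi := exp (v t - (c + log_weight b t)) - 1 - (v t - (c + log_weight b t))).
assert (Hphi : 0 <= phi) by (unfold phi; assert (K := exp_ineq1_le (v t - (c + log_weight b t))); lra).
assert (K := weight_lower b t Hb).
replace (phi / eta) with (q * (exp c * (1 - b) ^ 2 * phi)) by (unfold q; field; repeat split; try lra; nra).
apply Rmult_le_compat_l; [lra|].
apply Rmult_le_compat_r; [exact Hphi|]; apply Rmult_le_compat_l; lra.
Qed.

Lemma continuity_pt_of_continuous (f : R -> R) (x : R) : continuous f x -> continuity_pt f x.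
Proof. apply continuity_pt_filterlim. Qed.

Lemma exp_ge_quadratic (y : R) : 0 <= y -> 1 + y + y ^ 2 / 2 <= exp y.
Proof.
intros [Hy|<-]; [|rewrite exp_0; lra].
destruct (MVT_gen (fun x => exp x - (1 + x + x ^ 2 / 2)) 0 y (fun x => exp x - (1 + x))) as (c & Hc & E).
- intros x _; auto_derive; [easy|field].
- intros x _; apply continuity_pt_of_continuous; cont.
- rewrite exp_0 in E; assert (K := exp_ineq1_le c).
  rewrite Rmin_left, Rmax_right in Hc by lra.
  assert (0 <= (exp c - (1 + c)) * (y - 0)) by (apply Rmult_le_pos; lra).
  lra.
Qed.

(** For [s < 1] the comparison weight has [b = Rmax 0 s] and [c = mean v]; if [s <= 0] this is
    Jensen's inequality. *)
Lemma lebedev_milin (v : R -> R) : (forall t, continuous v t) ->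
  let s := mean (fun t => v t * cos t) in
  exp (mean v) * (1 + (Rmax 0 s) ^ 2) <= mean (fun t => exp (v t)).
Proof.
intros Hv s.
assert (T : forall b c, 0 <= b < 1 ->
  exp c * ((1 + b ^ 2) * (1 + mean v - c) + 2 * b * s - 2 * b ^ 2) <= mean (fun t => exp (v t))).
{ intros b c Hb; assert (E := mean_exp_deficit v b c Hb Hv); fold s in E.
  assert (K : 0 <= mean (exp_deficit v b c)).
  { apply mean_nonneg; [intros; now apply continuous_exp_deficit|apply exp_deficit_nonneg]. }
  lra. }
destruct (Rlt_le_dec s 1) as [H1|H1].
- assert (K := T (Rmax 0 s) (mean v)).
  assert (B : 0 <= Rmax 0 s < 1) by (split; [apply Rmax_l|apply Rmax_lub_lt; lra]).
  specialize (K B); apply Rle_trans with (2 := K).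
  apply Rmult_le_compat_l; [left; apply exp_pos|].
  unfold Rmax; destruct (Rle_dec 0 s); nra.
- rewrite Rmax_right by lra.
  (* For [s >= 1] the comparison uses [b = 1], reached as a limit because that weight vanishes at
     pi. With [c = mean v + (s - 1)] the bracket equals 2, and [2 exp (s - 1) >= 1 + s^2] is the
     quadratic lower bound of exp. *)
  set (g := fun b : R => mean (fun t => exp (v t)) -
     exp (mean v + (s - 1)) * ((1 + b ^ 2) * (1 + mean v - (mean v + (s - 1))) + 2 * b * s - 2 * b ^ 2)).
  assert (Hg : 0 <= g 1).
  { apply nonneg_of_continuous; [unfold g; cont|].
    intros eps He; exists (1 - Rmin (1 / 2) (eps / 2)).
    assert (M1 : 0 < Rmin (1 / 2) (eps / 2)) by (apply Rmin_pos; lra).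
    assert (M2 := Rmin_l (1 / 2) (eps / 2)); assert (M3 := Rmin_r (1 / 2) (eps / 2)).
    split; [apply Rabs_def1; lra|].
    assert (K := T (1 - Rmin (1 / 2) (eps / 2)) (mean v + (s - 1)) ltac:(lra)); unfold g; lra. }
  unfold g in Hg.
  assert (Hexp : (1 + s ^ 2) / 2 <= exp (s - 1)).
  { assert (K := exp_ge_quadratic (s - 1) ltac:(lra)); nra. }
  rewrite exp_plus in Hg.
  assert (P := exp_pos (mean v)); nra.
Qed.

(** * The extremal problem in one real variable *)

Lemma strict_increasing_of_derive (f f' : R -> R) (x y : R) : x < y ->
  (forall c, x <= c <= y -> is_derive f c (f' c)) -> (forall c, x < c < y -> 0 < f' c) -> f x < f y.
Proof.
intros Hxy Hd Hp.
destruct (MVT_cor2 f f' x y Hxy) as (c & E & Hc).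
- intros c Hc; now apply is_derive_Reals, Hd.
- specialize (Hp c Hc); nra.
Qed.

Lemma strict_decreasing_of_derive (f f' : R -> R) (x y : R) : x < y ->
  (forall c, x <= c <= y -> is_derive f c (f' c)) -> (forall c, x < c < y -> f' c < 0) -> f y < f x.
Proof.
intros Hxy Hd Hp.
destruct (MVT_cor2 f f' x y Hxy) as (c & E & Hc).
- intros c Hc; now apply is_derive_Reals, Hd.
- specialize (Hp c Hc); nra.
Qed.

Lemma ivt_pos_neg (f : R -> R) (x y : R) : x < y -> (forall c, x <= c <= y -> continuity_pt f c) ->
  0 < f x -> f y < 0 -> exists z, x < z < y /\ f z = 0.
Proof.
intros Hxy Hc Hx Hy.
destruct (Ranalysis5.IVT_interv (fun u => - f u) x y) as (z & Hz & E); try lra.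
- intros a Ha; now apply continuity_pt_opp, Hc.
- exists z; split; [|lra].
  destruct Hz as [[H1|H1] [H2|H2]]; subst; lra.
Qed.

Definition profile (p s : R) : R := Rpower (1 + s ^ 2) (- (1 / p)).

(* The bound [A - t^2 / A + (2 / p) t s] for the largest [A] allowed by the Lebedev-Milin inequality. *)
Definition objective (p t s : R) : R := profile p s - t ^ 2 / profile p s + 2 / p * t * s.

Lemma profile_pos (p s : R) : 0 < profile p s.
Proof. apply exp_pos. Qed.

Lemma one_plus_sqr_pos (s : R) : 0 < 1 + s ^ 2.
Proof. nra. Qed.

Lemma profile_0 (p : R) : profile p 0 = 1.
Proof. unfold profile, Rpower; replace (1 + 0 ^ 2) with 1 by ring; rewrite ln_1, Rmult_0_r; apply exp_0. Qed.

Lemma is_derive_profile (p s : R) : 0 < p ->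
  is_derive (profile p) s (- (2 / p) * s / (1 + s ^ 2) * profile p s).
Proof.
intros Hp; assert (H := one_plus_sqr_pos s); unfold profile, Rpower; auto_derive; [simpl in H; lra|].
replace (1 + s * (s * 1)) with (1 + s ^ 2) by ring; field; simpl in H; lra.
Qed.

Lemma profile_decreasing (p x y : R) : 0 < p -> 0 <= x < y -> profile p y < profile p x.
Proof.
intros Hp Hxy; apply (strict_decreasing_of_derive _ (fun s => - (2 / p) * s / (1 + s ^ 2) * profile p s)); [lra| |].
- intros; now apply is_derive_profile.
- intros c Hc; assert (H := profile_pos p c); assert (H1 := one_plus_sqr_pos c).
  assert (H2 : 0 < 2 / p * c / (1 + c ^ 2) * profile p c).
  { apply Rmult_lt_0_compat; [|exact H]; apply Rdiv_lt_0_compat; [|exact H1].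
    apply Rmult_lt_0_compat; [apply Rdiv_lt_0_compat|]; lra. }
  replace (- (2 / p) * c / (1 + c ^ 2) * profile p c) with (- (2 / p * c / (1 + c ^ 2) * profile p c)) by (field; lra).
  lra.
Qed.

(** [s * profile p s] is the value of [t] for which [s] is a candidate of alpha type. It has a
    single peak, at [alpha2 p], which explains the interval prescribed for alpha. *)
Lemma is_derive_hump (p s : R) : 0 < p ->
  is_derive (fun s => s * profile p s) s (profile p s / (p * (1 + s ^ 2)) * (p - (2 - p) * s ^ 2)).
Proof.
intros Hp; assert (H := one_plus_sqr_pos s).
evar_last; [apply (is_derive_mult (K := R_AbsRing) (fun s => s) (profile p));
  [apply is_derive_id|now apply is_derive_profile|intros; apply Rmult_comm]|].
unfold plus, mult, one; simpl; field; simpl in H; lra.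
Qed.

(** In this factored form the sign can be followed: the first factor vanishes where the hump takes
    the value [t], the second where [t * s = profile p s]. The other candidate, beta, enters as the
    end of the feasible interval, where [profile p s = t]. *)
Lemma is_derive_objective (p t s : R) : 0 < p ->
  is_derive (objective p t) s
   (2 / p / (1 + s ^ 2) * ((t - s * profile p s) * (1 - t / profile p s * s))).
Proof.
intros Hp; assert (H := one_plus_sqr_pos s); assert (H1 := profile_pos p s).
assert (D := is_derive_profile p s Hp).
unfold objective; auto_derive.
- repeat split; [eexists; exact D|eexists; exact D|lra].
- replace (Derive (fun x => profile p x) s) with (- (2 / p) * s / (1 + s ^ 2) * profile p s)
    by (symmetry; now apply is_derive_unique).
  field; simpl in H; repeat split; lra.
Qed.

Lemma alpha2_sqr (p : R) : 0 < p < 1 -> 0 < alpha2 p < 1 /\ (2 - p) * alpha2 p ^ 2 = p.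
Proof.
intros Hp; unfold alpha2.
assert (H : 0 < p / (2 - p)) by (apply Rdiv_lt_0_compat; lra).
assert (E : sqrt (p / (2 - p)) ^ 2 = p / (2 - p)) by (rewrite pow2_sqrt; lra).
split; [split|].
- now apply sqrt_lt_R0.
- rewrite <- sqrt_1; apply sqrt_lt_1; try lra; apply Rlt_div_l; lra.
- rewrite E; field; lra.
Qed.

Lemma hump_increasing (p x y : R) : 0 < p < 1 -> 0 <= x < y -> y <= alpha2 p ->
  x * profile p x < y * profile p y.
Proof.
intros Hp Hxy Hy; destruct (alpha2_sqr p Hp) as [H1 H2].
apply (strict_increasing_of_derive (fun s => s * profile p s) _ x y ltac:(lra)
  (fun c _ => is_derive_hump p c (proj1 Hp))).
intros c Hc; assert (H := profile_pos p c); assert (H3 := one_plus_sqr_pos c).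
apply Rmult_lt_0_compat; [apply Rdiv_lt_0_compat; nra|].
assert (c ^ 2 < alpha2 p ^ 2) by nra; nra.
Qed.

Lemma hump_decreasing (p x y : R) : 0 < p < 1 -> alpha2 p <= x -> x < y ->
  y * profile p y < x * profile p x.
Proof.
intros Hp Hx Hxy; destruct (alpha2_sqr p Hp) as [H1 H2].
apply (strict_decreasing_of_derive (fun s => s * profile p s) _ x y ltac:(lra)
  (fun c _ => is_derive_hump p c (proj1 Hp))).
intros c Hc; assert (H := profile_pos p c); assert (H3 := one_plus_sqr_pos c).
assert (0 < profile p c / (p * (1 + c ^ 2))) by (apply Rdiv_lt_0_compat; nra).
assert (alpha2 p ^ 2 < c ^ 2) by nra.
assert (p - (2 - p) * c ^ 2 < 0) by nra; nra.
Qed.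

Lemma hump_between (p x y u : R) : 0 < p < 1 -> 0 <= x -> x < u < y ->
  Rmin (x * profile p x) (y * profile p y) < u * profile p u.
Proof.
intros Hp Hx Hu; destruct (Rle_lt_dec u (alpha2 p)) as [H|H].
- apply Rle_lt_trans with (1 := Rmin_l _ _); apply hump_increasing; try assumption; lra.
- apply Rle_lt_trans with (1 := Rmin_r _ _); apply hump_decreasing; try assumption; lra.
Qed.

Lemma objective_increasing (p t x y : R) : 0 < p -> x < y ->
  (forall u, x < u < y -> 0 < (t - u * profile p u) * (1 - t / profile p u * u)) ->
  objective p t x < objective p t y.
Proof.
intros Hp Hxy H.
apply (strict_increasing_of_derive (objective p t) _ x y Hxy (fun c _ => is_derive_objective p t c Hp)).
intros c Hc; apply Rmult_lt_0_compat; [|now apply H].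
apply Rdiv_lt_0_compat; [apply Rdiv_lt_0_compat; lra|apply one_plus_sqr_pos].
Qed.

Lemma objective_decreasing (p t x y : R) : 0 < p -> x < y ->
  (forall u, x < u < y -> (t - u * profile p u) * (1 - t / profile p u * u) < 0) ->
  objective p t y < objective p t x.
Proof.
intros Hp Hxy H.
apply (strict_decreasing_of_derive (objective p t) _ x y Hxy (fun c _ => is_derive_objective p t c Hp)).
intros c Hc; specialize (H c Hc).
assert (K : 0 < 2 / p / (1 + c ^ 2)) by
 (apply Rdiv_lt_0_compat; [apply Rdiv_lt_0_compat; lra|apply one_plus_sqr_pos]).
nra.
Qed.

Lemma ratio_increasing (p t x y : R) : 0 < p -> 0 < t -> 0 <= x < y -> t / profile p x < t / profile p y.
Proof.
intros Hp Ht Hxy; apply Rmult_lt_compat_l; [exact Ht|].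
apply Rinv_lt_contravar; [|now apply profile_decreasing].
apply Rmult_lt_0_compat; apply profile_pos.
Qed.

Lemma ratio_at (p t b : R) : 0 < t -> profile p b = t -> t / profile p b = 1.
Proof. intros Ht ->; field; lra. Qed.

(** To the left of [al] the objective increases. Beyond [al], the signs of the two factors of the
    derivative at [s] persist either back to [al], where the objective is larger, or on to [be].
    Persistence follows from the single peak of the hump and from the monotonicity of
    [t / profile p u * u]. *)
Lemma objective_two_candidates (p t al be s : R) : 0 < p < 1 -> 0 < al < alpha2 p ->
  al * profile p al = t -> profile p be = t -> al < be -> 0 <= s <= be -> s <> al -> s <> be ->
  objective p t s < Rmax (objective p t al) (objective p t be).
Proof.
intros Hp Hal Eal Ebe Hab Hs Hsal Hsbe.
assert (Hp0 := proj1 Hp).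
assert (Ht : 0 < t) by (rewrite <- Ebe; apply profile_pos).
assert (Hr1 : forall u, 0 <= u < be -> t / profile p u < 1).
{ intros u Hu; rewrite <- (ratio_at p t be Ht Ebe); now apply ratio_increasing. }
assert (Hr0 : forall u, 0 < t / profile p u) by (intros u; apply Rdiv_lt_0_compat; [exact Ht|apply profile_pos]).
destruct (alpha2_sqr p Hp) as [Ha2 _].
destruct (Rlt_le_dec s al) as [L|L].
{ apply Rlt_le_trans with (2 := Rmax_l _ _); apply objective_increasing; try assumption.
  intros u Hu; assert (K := hump_increasing p u al Hp ltac:(lra) ltac:(lra)).
  specialize (Hr1 u ltac:(lra)); specialize (Hr0 u).
  apply Rmult_lt_0_compat; [lra|nra]. }
assert (L' : al < s < be) by lra; clear L Hsal Hsbe Hs.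
assert (Hra : forall u v, 0 <= u < v -> t / profile p u * u < t / profile p v * v).
{ intros u v Huv; assert (K := ratio_increasing p t u v Hp0 Ht Huv); specialize (Hr0 u); nra. }
destruct (Rle_lt_dec t (s * profile p s)) as [H1|H1].
- destruct (Rle_lt_dec (t / profile p s * s) 1) as [H2|H2].
  + apply Rlt_le_trans with (2 := Rmax_l _ _); apply objective_decreasing; try lra.
    intros u Hu; assert (K := hump_between p al s u Hp ltac:(lra) Hu).
    assert (M : t <= Rmin (al * profile p al) (s * profile p s)) by (apply Rmin_glb; lra).
    specialize (Hra u s ltac:(lra)); nra.
  + apply Rlt_le_trans with (2 := Rmax_r _ _); apply objective_increasing; try lra.
    intros u Hu; assert (K := hump_between p s be u Hp ltac:(lra) Hu).
    assert (Hbe : 1 < be) by (specialize (Hr1 s ltac:(lra)); specialize (Hr0 s); nra).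
    assert (M : t <= Rmin (s * profile p s) (be * profile p be)) by (apply Rmin_glb; [lra|rewrite Ebe; nra]).
    specialize (Hra s u ltac:(lra)); nra.
- apply Rlt_le_trans with (2 := Rmax_r _ _); apply objective_increasing; try lra.
  assert (Hs2 : alpha2 p < s).
  { apply Rnot_le_lt; intros N; assert (K := hump_increasing p al s Hp ltac:(lra) N); lra. }
  intros u Hu; assert (K1 := hump_decreasing p s u Hp ltac:(lra) ltac:(lra)).
  assert (K2 := hump_decreasing p s be Hp ltac:(lra) ltac:(lra)); rewrite Ebe in K2.
  assert (Hbe : be < 1) by nra.
  specialize (Hr1 u ltac:(lra)); specialize (Hr0 u).
  apply Rmult_lt_0_compat; [lra|nra].
Qed.

(** For [t] at or above the peak value, [t - u * profile p u] can vanish only at the peak itself;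
    cutting the interval at [alpha2 p] keeps the derivative positive on each piece. *)
Lemma objective_one_candidate (p t be s : R) : 0 < p < 1 -> alpha2 p * profile p (alpha2 p) <= t ->
  profile p be = t -> 0 <= be -> 0 <= s < be -> objective p t s < objective p t be.
Proof.
intros Hp Hta Ebe Hbe0 Hs.
assert (Hp0 := proj1 Hp).
assert (Ht : 0 < t) by (rewrite <- Ebe; apply profile_pos).
destruct (alpha2_sqr p Hp) as [Ha2 _].
assert (Hbe : be < 1).
{ apply Rnot_le_lt; intros N.
  assert (K1 := hump_decreasing p (alpha2 p) 1 Hp ltac:(lra) ltac:(lra)).
  destruct N as [N|N].
  - assert (K2 := profile_decreasing p 1 be Hp0 ltac:(lra)); lra.
  - rewrite <- N in Ebe; lra. }
assert (Hstep : forall x y, 0 <= x < y -> y <= be -> (y <= alpha2 p \/ alpha2 p <= x) ->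
  objective p t x < objective p t y).
{ intros x y Hxy Hy Hside; apply objective_increasing; try lra; intros u Hu.
  assert (K1 : t / profile p u < 1).
  { rewrite <- (ratio_at p t be Ht Ebe); apply ratio_increasing; lra. }
  assert (K2 : 0 < t / profile p u) by (apply Rdiv_lt_0_compat; [exact Ht|apply profile_pos]).
  assert (K3 : u * profile p u < alpha2 p * profile p (alpha2 p)).
  { destruct Hside; [apply hump_increasing|apply hump_decreasing]; try assumption; lra. }
  apply Rmult_lt_0_compat; [lra|nra]. }
destruct (Rle_lt_dec be (alpha2 p)) as [H|H]; [apply Hstep; [lra|lra|now left]|].
destruct (Rlt_le_dec s (alpha2 p)) as [H'|H'].
- apply Rlt_trans with (objective p t (alpha2 p)); apply Hstep; try lra.
- apply Hstep; [lra|lra|now right].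
Qed.

Lemma profile_solution (p t : R) : 0 < p -> 0 < t <= 1 -> exists be, 0 <= be /\ profile p be = t.
Proof.
intros Hp Ht.
assert (H1 : 1 <= Rpower t (- p)).
{ rewrite <- (Rpower_O t) by lra; unfold Rpower.
  assert (ln t <= 0) by (rewrite <- ln_1; destruct (proj2 Ht) as [H| ->]; [left; apply ln_increasing|]; lra).
  assert (K : 0 * ln t <= - p * ln t) by nra.
  destruct K as [K|K]; [left; now apply exp_increasing|rewrite K; lra]. }
exists (sqrt (Rpower t (- p) - 1)); split; [apply sqrt_pos|].
unfold profile; rewrite pow2_sqrt by lra.
replace (1 + (Rpower t (- p) - 1)) with (Rpower t (- p)) by ring.
rewrite Rpower_mult; replace (- p * - (1 / p)) with 1 by (field; lra).
apply Rpower_1; lra.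
Qed.

Lemma profile_injective (p x y : R) : 0 < p -> 0 <= x -> 0 <= y -> profile p x = profile p y -> x = y.
Proof.
intros Hp Hx Hy E; destruct (Rtotal_order x y) as [H|[H|H]]; [|exact H|].
- assert (K := profile_decreasing p x y Hp ltac:(lra)); lra.
- assert (K := profile_decreasing p y x Hp ltac:(lra)); lra.
Qed.

(** * Comparison of the two candidates and the sign of F_p *)

Lemma beta_of_alpha (p al be : R) : 0 < p -> 0 < al -> profile p be = al * profile p al ->
  1 + be ^ 2 = (1 + al ^ 2) * Rpower al (- p).
Proof.
intros Hp Hal E.
assert (H1 := one_plus_sqr_pos al); assert (H2 := one_plus_sqr_pos be).
assert (L := f_equal ln E); rewrite ln_mult in L by (try apply profile_pos; assumption).
unfold profile, Rpower in L; rewrite !ln_exp in L.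
assert (L' : ln (1 + be ^ 2) = ln (1 + al ^ 2) + - p * ln al).
{ apply (f_equal (fun x => - p * x)) in L.
  replace (- p * (- (1 / p) * ln (1 + be ^ 2))) with (ln (1 + be ^ 2)) in L by (field; lra).
  rewrite L; field; lra. }
rewrite <- (exp_ln (1 + be ^ 2)), L', exp_plus, exp_ln by assumption; reflexivity.
Qed.

(** The origin of [F_p]: for equal [t], the value at alpha exceeds the value at beta exactly when
    [p / al + (2 - p) * al > 2 * be], and squaring eliminates beta. *)
Lemma Fp_of_beta (p al be : R) : 0 < p -> 0 < al -> profile p be = al * profile p al ->
  Fp p al = (p / al + (2 - p) * al) ^ 2 - (2 * be) ^ 2.
Proof.
intros Hp Hal E; assert (K := beta_of_alpha p al be Hp Hal E).
unfold Fp; replace (2 - p) with (2 + - p) at 3 by ring.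
rewrite Rpower_plus; replace (Rpower al 2) with (al ^ 2) by (rewrite <- (Rpower_pow 2 al Hal); f_equal; simpl; ring).
replace ((2 * be) ^ 2) with (4 * ((1 + al ^ 2) * Rpower al (- p) - 1)) by (rewrite <- K; ring).
field; lra.
Qed.

Lemma objective_beta (p t be : R) : profile p be = t -> objective p t be = 2 / p * t * be.
Proof.
intros E; assert (H := profile_pos p be); unfold objective; rewrite E in *.
replace (t ^ 2 / t) with t by (field; lra); ring.
Qed.

Lemma objective_alpha (p al : R) : objective p (al * profile p al) al = profile p al * (1 + (2 / p - 1) * al ^ 2).
Proof.
unfold objective; assert (H := profile_pos p al).
assert (E : (al * profile p al) ^ 2 / profile p al = al ^ 2 * profile p al) by (field; lra).
rewrite E; unfold Rdiv; ring.
Qed.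

Lemma objective_compare (p al be : R) : 0 < p < 1 -> 0 < al -> 0 <= be -> profile p be = al * profile p al ->
  let t := al * profile p al in
  (0 < Fp p al <-> objective p t be < objective p t al) /\ (Fp p al = 0 <-> objective p t be = objective p t al).
Proof.
intros Hp Hal Hbe E t.
assert (Ea : objective p t al = profile p al * (1 + (2 / p - 1) * al ^ 2)) by apply objective_alpha.
rewrite (Fp_of_beta p al be (proj1 Hp) Hal E), objective_beta, Ea by exact E.
set (u := p / al + (2 - p) * al).
assert (Hu : 0 < u).
{ unfold u; assert (0 < p / al) by (apply Rdiv_lt_0_compat; lra); nra. }
assert (D : profile p al * (1 + (2 / p - 1) * al ^ 2) - 2 / p * t * be = profile p al * al / p * (u - 2 * be)).
{ unfold u, t; field; lra. }
assert (Hk : 0 < profile p al * al / p).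
{ apply Rdiv_lt_0_compat; [apply Rmult_lt_0_compat; [apply profile_pos|exact Hal]|lra]. }
set (k := profile p al * al / p) in *.
split; split; intros H.
- assert (0 < u - 2 * be) by nra; nra.
- assert (0 < u - 2 * be) by nra; nra.
- assert (u - 2 * be = 0) by nra; nra.
- assert (Hz : k * (u - 2 * be) = 0) by lra.
  apply Rmult_integral in Hz; destruct Hz as [Hz|Hz]; [lra|].
  replace (2 * be) with u by lra; ring.
Qed.

Lemma alpha_lt_beta (p al be : R) : 0 < p -> 0 < al < 1 -> 0 <= be -> profile p be = al * profile p al -> al < be.
Proof.
intros Hp Hal Hbe E; assert (H := profile_pos p al).
apply Rnot_le_lt; intros N.
assert (K : profile p al <= profile p be).
{ destruct N as [N|N]; [left; apply profile_decreasing; lra|rewrite N; lra]. }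
nra.
Qed.

(* The objective increases from [al] to the root [be] of [profile p be = al * profile p al]. *)
Lemma Fp_neg_right (p al : R) : 0 < p < 1 -> alpha2 p <= al < 1 -> Fp p al < 0.
Proof.
intros Hp Hal; destruct (alpha2_sqr p Hp) as [Ha2 _].
assert (Hal0 : 0 < al) by lra.
assert (H0 := profile_pos p al).
assert (H1 : profile p al < 1) by (rewrite <- (profile_0 p); apply profile_decreasing; lra).
set (t := al * profile p al).
assert (Ht : 0 < t <= 1) by (unfold t; nra).
destruct (profile_solution p t ltac:(lra) Ht) as (be & Hbe & E).
assert (Hab := alpha_lt_beta p al be ltac:(lra) ltac:(lra) Hbe E).
assert (Hbe1 : be < 1).
{ apply Rnot_le_lt; intros N.
  assert (K1 := hump_decreasing p al 1 Hp ltac:(lra) ltac:(lra)); fold t in K1.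
  assert (K2 : profile p be <= profile p 1) by (destruct N as [N|N]; [left; apply profile_decreasing; lra|rewrite N; lra]).
  lra. }
assert (K : objective p t al < objective p t be).
{ apply objective_increasing; [lra|exact Hab|]; intros u Hu.
  assert (K1 := hump_decreasing p al u Hp ltac:(lra) ltac:(lra)); fold t in K1.
  assert (K2 := ratio_increasing p t u be ltac:(lra) ltac:(lra) ltac:(lra)).
  rewrite (ratio_at p t be) in K2 by lra.
  assert (K3 : 0 < t / profile p u) by (apply Rdiv_lt_0_compat; [lra|apply profile_pos]).
  apply Rmult_lt_0_compat; [lra|nra]. }
destruct (objective_compare p al be Hp Hal0 Hbe E) as [C1 C2]; fold t in C1, C2.
destruct (Rtotal_order (Fp p al) 0) as [L|[L|L]]; [exact L| |].
- apply C2 in L; lra.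
- apply C1 in L; lra.
Qed.

(* The substitution [x = a ^ 2] turns [Fp] into a function with a triple zero at [x = 1]: two further zeros
   in (0, 1) would give two zeros of its third derivative. *)
Definition kpoly (m x : R) : R :=
  m ^ 2 + (1 + 2 * m - 2 * m ^ 2) * x + (1 - m) ^ 2 * x ^ 2 - Rpower x (1 - m) - Rpower x (2 - m).

Definition kpoly1 (m x : R) : R :=
  (1 + 2 * m - 2 * m ^ 2) + 2 * (1 - m) ^ 2 * x - (1 - m) * Rpower x (- m) - (2 - m) * Rpower x (1 - m).

Definition kpoly2 (m x : R) : R :=
  2 * (1 - m) ^ 2 + (1 - m) * m * Rpower x (- m - 1) - (2 - m) * (1 - m) * Rpower x (- m).

Definition kpoly3 (m x : R) : R :=
  (1 - m) * m * Rpower x (- m - 2) * ((2 - m) * x - (1 + m)).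

Lemma Rpower_shift (x a : R) : 0 < x -> Rpower x (a + 1) = x * Rpower x a.
Proof. intros Hx; rewrite Rpower_plus, Rpower_1 by exact Hx; ring. Qed.

Lemma Rpower_shift_inv (x a : R) : 0 < x -> Rpower x a * / x = Rpower x (a - 1).
Proof.
intros Hx; replace a with ((a - 1) + 1) at 1 by ring; rewrite Rpower_shift by exact Hx; field; lra.
Qed.

Lemma is_derive_Rpower (a x : R) : 0 < x -> is_derive (fun x => Rpower x a) x (a * Rpower x (a - 1)).
Proof.
intros Hx; unfold Rpower at 1; auto_derive; [exact Hx|].
rewrite <- Rpower_shift_inv by exact Hx; unfold Rpower; field; lra.
Qed.

Lemma derivable_pt_lim_kpoly (m x : R) : 0 < x -> derivable_pt_lim (kpoly m) x (kpoly1 m x).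
Proof.
intros Hx; apply is_derive_Reals; unfold kpoly.
assert (D1 := is_derive_Rpower (1 - m) x Hx); assert (D2 := is_derive_Rpower (2 - m) x Hx).
auto_derive; [repeat split; eexists; eassumption|].
rewrite (is_derive_unique (fun y : R => Rpower y (1 - m)) x _ D1), (is_derive_unique (fun y : R => Rpower y (2 - m)) x _ D2).
unfold kpoly1; replace (1 - m - 1) with (- m) by ring; replace (2 - m - 1) with (1 - m) by ring; ring.
Qed.

Lemma derivable_pt_lim_kpoly1 (m x : R) : 0 < x -> derivable_pt_lim (kpoly1 m) x (kpoly2 m x).
Proof.
intros Hx; apply is_derive_Reals; unfold kpoly1.
assert (D1 := is_derive_Rpower (- m) x Hx); assert (D2 := is_derive_Rpower (1 - m) x Hx).
auto_derive; [repeat split; eexists; eassumption|].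
rewrite (is_derive_unique (fun y : R => Rpower y (- m)) x _ D1), (is_derive_unique (fun y : R => Rpower y (1 - m)) x _ D2).
unfold kpoly2; replace (1 - m - 1) with (- m) by ring; ring.
Qed.

Lemma derivable_pt_lim_kpoly2 (m x : R) : 0 < x -> derivable_pt_lim (kpoly2 m) x (kpoly3 m x).
Proof.
intros Hx; apply is_derive_Reals; unfold kpoly2.
assert (D1 := is_derive_Rpower (- m) x Hx); assert (D2 := is_derive_Rpower (- m - 1) x Hx).
auto_derive; [repeat split; eexists; eassumption|].
rewrite (is_derive_unique (fun y : R => Rpower y (- m)) x _ D1), (is_derive_unique (fun y : R => Rpower y (- m - 1)) x _ D2).
unfold kpoly3; replace (- m - 1 - 1) with (- m - 2) by ring.
replace (Rpower x (- m - 1)) with (x * Rpower x (- m - 2)) by (rewrite <- Rpower_shift by exact Hx; f_equal; ring).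
ring.
Qed.

Lemma Rpower_base_1 (a : R) : Rpower 1 a = 1.
Proof. unfold Rpower; rewrite ln_1, Rmult_0_r; apply exp_0. Qed.

Lemma rolle (f f' : R -> R) (x y : R) : x < y -> (forall c, x <= c <= y -> derivable_pt_lim f c (f' c)) ->
  f x = f y -> exists c, x < c < y /\ f' c = 0.
Proof.
intros Hxy Hd E; destruct (MVT_cor2 f f' x y Hxy Hd) as (c & Ec & Hc).
exists c; split; [exact Hc|]; assert (K : f' c * (y - x) = 0) by lra.
apply Rmult_integral in K; destruct K; lra.
Qed.

Lemma kpoly_zero_unique (m x y : R) : 0 < m < 1 / 2 -> 0 < x < y -> y < 1 -> kpoly m x = 0 -> kpoly m y = 0 -> False.
Proof.
intros Hm Hxy Hy Ex Ey.
assert (K0 : kpoly m 1 = 0) by (unfold kpoly; rewrite !Rpower_base_1; ring).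
assert (K1 : kpoly1 m 1 = 0) by (unfold kpoly1; rewrite !Rpower_base_1; ring).
assert (K2 : kpoly2 m 1 = 0) by (unfold kpoly2; rewrite !Rpower_base_1; ring).
destruct (rolle (kpoly m) (kpoly1 m) x y) as (a & Ha & Ea); [lra|intros; apply derivable_pt_lim_kpoly; lra|lra|].
destruct (rolle (kpoly m) (kpoly1 m) y 1) as (b & Hb & Eb); [lra|intros; apply derivable_pt_lim_kpoly; lra|lra|].
destruct (rolle (kpoly1 m) (kpoly2 m) a b) as (a' & Ha' & Ea'); [lra|intros; apply derivable_pt_lim_kpoly1; lra|lra|].
destruct (rolle (kpoly1 m) (kpoly2 m) b 1) as (b' & Hb' & Eb'); [lra|intros; apply derivable_pt_lim_kpoly1; lra|lra|].
destruct (rolle (kpoly2 m) (kpoly3 m) a' b') as (a'' & Ha'' & Ea''); [lra|intros; apply derivable_pt_lim_kpoly2; lra|lra|].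
destruct (rolle (kpoly2 m) (kpoly3 m) b' 1) as (b'' & Hb'' & Eb''); [lra|intros; apply derivable_pt_lim_kpoly2; lra|lra|].
assert (Z : forall u, 0 < u -> kpoly3 m u = 0 -> (2 - m) * u - (1 + m) = 0).
{ intros u Hu E; unfold kpoly3 in E; apply Rmult_integral in E; destruct E as [E|E]; [|exact E].
  assert (0 < Rpower u (- m - 2)) by apply exp_pos.
  assert (0 < (1 - m) * m) by nra.
  assert (0 < (1 - m) * m * Rpower u (- m - 2)) by (now apply Rmult_lt_0_compat); lra. }
apply Z in Ea''; [|lra]; apply Z in Eb''; [|lra]; nra.
Qed.

Lemma Fp_kpoly (p a : R) : 0 < a -> Fp p a = 4 / a ^ 2 * kpoly (p / 2) (a ^ 2).
Proof.
intros Ha.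
assert (E : forall s, Rpower (a ^ 2) s = Rpower a (2 * s)).
{ intros s; rewrite <- (Rpower_pow 2 a Ha), Rpower_mult; f_equal; simpl; ring. }
assert (E2 : Rpower a 2 = a ^ 2) by (rewrite <- (Rpower_pow 2 a Ha); f_equal; simpl; ring).
unfold kpoly, Fp; rewrite !E.
replace (2 * (1 - p / 2)) with (2 + - p) by field.
replace (2 * (2 - p / 2)) with (2 + (2 - p)) by field.
rewrite !(Rpower_plus 2), E2; field; lra.
Qed.

Lemma Fp_pos_near_0 (p : R) : 0 < p < 1 -> exists x0, 0 < x0 < 1 /\ forall a, 0 < a <= x0 -> 0 < Fp p a.
Proof.
(* Since [p < 1], both subtracted powers have exponent at least 1 in [a], so together they are at
   most [2 a <= p^2 / 8], less than the constant term [(p / 2)^2]. *)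
intros Hp; exists (p ^ 2 / 16); split; [split; nra|]; intros a Ha.
assert (Hb : forall s, 1 <= s -> Rpower a s <= a).
{ intros s Hs; rewrite <- (Rpower_1 a) at 2 by lra; unfold Rpower.
  assert (L : ln a < 0) by (rewrite <- ln_1; apply ln_increasing; nra).
  assert (K : s * ln a <= 1 * ln a) by nra.
  destruct K as [K|K]; [left; now apply exp_increasing|rewrite K; lra]. }
rewrite Fp_kpoly by lra; apply Rmult_lt_0_compat; [apply Rdiv_lt_0_compat; nra|].
assert (E : forall s, Rpower (a ^ 2) s = Rpower a (2 * s)).
{ intros s; rewrite <- (Rpower_pow 2 a (proj1 Ha)), Rpower_mult; f_equal; simpl; ring. }
unfold kpoly; rewrite !E.
assert (B1 := Hb (2 * (1 - p / 2)) ltac:(lra)); assert (B2 := Hb (2 * (2 - p / 2)) ltac:(lra)).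
assert (0 <= (1 + 2 * (p / 2) - 2 * (p / 2) ^ 2) * a ^ 2) by (apply Rmult_le_pos; nra).
assert (0 <= (1 - p / 2) ^ 2 * (a ^ 2) ^ 2) by (apply Rmult_le_pos; nra).
nra.
Qed.

Lemma Fp_continuous (p a : R) : 0 < a -> continuity_pt (Fp p) a.
Proof.
intros Ha; apply derivable_continuous_pt.
assert (D1 := is_derive_Rpower (- p) a Ha); assert (D2 := is_derive_Rpower (2 - p) a Ha).
apply ex_derive_Reals_0; unfold Fp; auto_derive; repeat split; try (eexists; eassumption).
nra.
Qed.

Lemma Fp_zero_unique (p a b : R) : 0 < p < 1 -> 0 < a < 1 -> 0 < b < 1 -> Fp p a = 0 -> Fp p b = 0 -> a = b.
Proof.
intros Hp.
assert (H : forall a b, 0 < a < b -> b < 1 -> Fp p a = 0 -> Fp p b = 0 -> False).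
{ intros x y Hxy Hy Ex Ey; rewrite Fp_kpoly in Ex, Ey by lra.
  apply (kpoly_zero_unique (p / 2) (x ^ 2) (y ^ 2)); try nra.
  - apply Rmult_integral in Ex; destruct Ex as [Ex|Ex]; [|exact Ex].
    assert (0 < 4 / x ^ 2) by (apply Rdiv_lt_0_compat; nra); lra.
  - apply Rmult_integral in Ey; destruct Ey as [Ey|Ey]; [|exact Ey].
    assert (0 < 4 / y ^ 2) by (apply Rdiv_lt_0_compat; nra); lra. }
intros Ha Hb Ea Eb; destruct (Rtotal_order a b) as [L|[L|L]]; [|exact L|]; exfalso.
- apply (H a b); lra.
- apply (H b a); lra.
Qed.

(** The zero is bracketed by the positive values near 0 and the negative value at [alpha2 p]. A
    wrong sign anywhere else would create a second zero. *)
Lemma alpha_p_spec (p : R) : 0 < p < 1 ->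
  0 < alpha_ p < alpha2 p /\ Fp p (alpha_ p) = 0 /\
  (forall a, 0 < a < alpha_ p -> 0 < Fp p a) /\ (forall a, alpha_ p < a < 1 -> Fp p a < 0).
Proof.
intros Hp; destruct (alpha2_sqr p Hp) as [Ha2 _].
assert (Hn : Fp p (alpha2 p) < 0) by (apply Fp_neg_right; lra).
destruct (Fp_pos_near_0 p Hp) as (x0 & Hx0 & Hpos).
assert (Hx2 : x0 < alpha2 p).
{ apply Rnot_le_lt; intros N; specialize (Hpos (alpha2 p) ltac:(lra)); lra. }
assert (Hivt : forall b, 0 < b < 1 -> Fp p b < 0 -> exists z, x0 < z < b /\ Fp p z = 0).
{ intros b Hb Fb.
  assert (x0 < b) by (apply Rnot_le_lt; intros N; specialize (Hpos b ltac:(lra)); lra).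
  apply ivt_pos_neg; try assumption; [intros; apply Fp_continuous; lra|apply Hpos; lra]. }
destruct (Hivt (alpha2 p) Ha2 Hn) as (z & Hz & Ez).
assert (E : alpha_ p = z).
{ apply (iota_unique (V := R_CompleteNormedModule)); [|split; [lra|exact Ez]].
  intros y [Hy Ey]; apply (Fp_zero_unique p); try assumption; lra. }
rewrite E; split; [lra|split; [exact Ez|split]].
- intros a Ha; destruct (Rtotal_order (Fp p a) 0) as [L|[L|L]]; [exfalso|exfalso|exact L].
  + destruct (Hivt a ltac:(lra) L) as (y & Hy & Ey).
    assert (K := Fp_zero_unique p y z Hp ltac:(lra) ltac:(lra) Ey Ez); lra.
  + assert (K := Fp_zero_unique p a z Hp ltac:(lra) ltac:(lra) L Ez); lra.
- intros a Ha; destruct (Rtotal_order (Fp p a) 0) as [L|[L|L]]; [exact L|exfalso|exfalso].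
  + assert (K := Fp_zero_unique p a z Hp ltac:(lra) ltac:(lra) L Ez); lra.
  + destruct (Rlt_le_dec a (alpha2 p)) as [Q|Q]; [|assert (K := Fp_neg_right p a Hp ltac:(lra)); lra].
    destruct (ivt_pos_neg (Fp p) a (alpha2 p) Q) as (y & Hy & Ey); try assumption; [intros; apply Fp_continuous; lra|].
    assert (K := Fp_zero_unique p y z Hp ltac:(lra) ltac:(lra) Ey Ez); lra.
Qed.

Lemma t_p_eq (p : R) : t_ p = alpha_ p * profile p (alpha_ p).
Proof. unfold t_, profile; rewrite Rpower_Ropp; reflexivity. Qed.

(** * Solution of the one-variable problem *)

Lemma feasible_le (p t s be : R) : 0 < p -> 0 <= s -> 0 <= be -> profile p be = t -> t <= profile p s -> s <= be.
Proof.
intros Hp Hs Hbe E H; apply Rnot_lt_le; intros N.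
assert (K := profile_decreasing p be s Hp ltac:(lra)); lra.
Qed.

Lemma hump_preimage (p t b : R) : 0 < p -> 0 < t -> 0 < b -> t < b * profile p b ->
  exists al, 0 < al < b /\ al * profile p al = t.
Proof.
intros Hp Ht Hb H.
destruct (ivt_pos_neg (fun s => t - s * profile p s) 0 b Hb) as (z & Hz & E).
- intros c _; apply continuity_pt_minus; [apply continuity_pt_const; now intros x y|].
  apply derivable_continuous_pt, ex_derive_Reals_0; eexists; now apply is_derive_hump.
- lra.
- lra.
- exists z; split; [exact Hz|lra].
Qed.

(** Forces [be < 1] for all [t >= t_ p]. At [t = profile p 1] the point 1 is beta and the hump there
    also equals [t]; between [al] and 1 the objective decreases, so [F_p] is positive at [al],
    whence [al < alpha_ p], and the hump is increasing there. *)
Lemma hump_one_lt_t_p (p : R) : 0 < p < 1 -> profile p 1 < t_ p.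
Proof.
intros Hp; destruct (alpha2_sqr p Hp) as [Ha2 _].
destruct (alpha_p_spec p Hp) as (Hap & _ & _ & Hneg).
assert (H0 := profile_pos p 1).
assert (K := hump_decreasing p (alpha2 p) 1 Hp ltac:(lra) ltac:(lra)).
destruct (hump_preimage p (profile p 1) (alpha2 p)) as (al & Hal & E); try lra.
rewrite t_p_eq, <- E.
set (t := profile p 1) in *.
assert (D : objective p t 1 < objective p t al).
{ apply objective_decreasing; [lra|lra|]; intros u Hu.
  assert (K1 := hump_between p al 1 u Hp ltac:(lra) Hu); rewrite E, Rmult_1_l in K1.
  change (Rmin t t < u * profile p u) in K1; rewrite Rmin_left in K1 by lra.
  assert (K2 := ratio_increasing p t u 1 ltac:(lra) H0 ltac:(lra)).
  rewrite (ratio_at p t 1) in K2 by (try reflexivity; exact H0).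
  assert (K3 : 0 < t / profile p u) by (apply Rdiv_lt_0_compat; [exact H0|apply profile_pos]).
  assert (0 < 1 - t / profile p u * u) by nra; nra. }
apply hump_increasing; try lra; split; [lra|].
apply Rnot_le_lt; intros N.
destruct (objective_compare p al 1 Hp ltac:(lra) ltac:(lra)) as [C1 C2]; [now rewrite E|].
rewrite E in C1, C2; apply C1 in D.
destruct N as [N|N]; [specialize (Hneg al ltac:(lra)); lra|].
destruct (alpha_p_spec p Hp) as (_ & Hz & _); rewrite N in Hz; lra.
Qed.

Theorem optimum_low (p t : R) : 0 < p < 1 -> 0 <= t <= t_ p ->
  exists al, (0 <= al < alpha2 p /\ t = al * profile p al /\ t <= profile p al /\
    (t = t_ p -> al = alpha_ p)) /\
  forall s, 0 <= s -> t <= profile p s -> objective p t s <= objective p t al /\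
    (objective p t s = objective p t al -> s = al \/ t = t_ p /\ profile p s = t).
Proof.
intros Hp Ht; destruct (alpha2_sqr p Hp) as [Ha2 _].
destruct (alpha_p_spec p Hp) as (Hap & Hz & Hpos & _).
destruct (proj1 Ht) as [Ht0|Ht0].
- assert (Hex : exists al, 0 < al <= alpha_ p /\ al * profile p al = t /\ (t = t_ p -> al = alpha_ p)).
  { rewrite t_p_eq in *; destruct (proj2 Ht) as [L|L].
    - destruct (hump_preimage p t (alpha_ p)) as (al & Hal & E); try lra.
      exists al; repeat split; lra.
    - exists (alpha_ p); repeat split; lra. }
  destruct Hex as (al & Hal & E & Htp); exists al.
  assert (H0 := profile_pos p al).
  split; [repeat split; try assumption; nra|].
  intros s Hs Hts.
  assert (Ht1 : t <= 1).
  { apply Rle_trans with (1 := Hts); rewrite <- (profile_0 p).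
    destruct Hs as [Hs|<-]; [left; apply profile_decreasing|]; lra. }
  destruct (profile_solution p t ltac:(lra) ltac:(lra)) as (be & Hbe & Eb).
  assert (Hab := alpha_lt_beta p al be ltac:(lra) ltac:(lra) Hbe ltac:(lra)).
  assert (Hsb := feasible_le p t s be ltac:(lra) Hs Hbe Eb Hts).
  destruct (objective_compare p al be Hp ltac:(lra) Hbe ltac:(lra)) as [C1 C2]; rewrite E in C1, C2.
  assert (Hle : objective p t be <= objective p t al /\ (objective p t be = objective p t al -> t = t_ p)).
  { destruct (proj2 Hal) as [L|L].
    - specialize (Hpos al ltac:(lra)); apply C1 in Hpos; split; intros; lra.
    - split; [rewrite (proj1 C2) by (rewrite L; exact Hz); lra|intros _; now rewrite t_p_eq, <- L]. }
  destruct (Req_dec s al) as [->|N1]; [split; [lra|now left]|].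
  destruct (Req_dec s be) as [->|N2].
  { split; [apply Hle|intros Q; right; split; [apply Hle, Q|exact Eb]]. }
  assert (K := objective_two_candidates p t al be s Hp ltac:(lra) E Eb Hab ltac:(lra) N1 N2).
  rewrite Rmax_left in K by apply Hle; lra.
(* At [t = 0] there is no beta; the objective reduces to [profile p s], which is largest at 0. *)
- subst t; exists 0; split; [repeat split; try lra; [left; apply profile_pos|]|].
  + intros Q; rewrite t_p_eq in Q; assert (H0 := profile_pos p (alpha_ p)).
    apply eq_sym, Rmult_integral in Q; lra.
  + intros s Hs _; unfold objective.
    replace (0 ^ 2) with 0 by ring; unfold Rdiv; rewrite !Rmult_0_l, !Rmult_0_r, !Rmult_0_l.
    destruct Hs as [Hs|<-]; [|split; [lra|now left]].
    assert (K := profile_decreasing p 0 s ltac:(lra) ltac:(lra)); split; lra.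
Qed.

(** Above the peak of the hump beta has no competitor. Below it, [t >= t_ p] places the alpha
    candidate in the range from [alpha_ p] on, where [F_p] is at most 0. *)
Theorem optimum_high (p t : R) : 0 < p < 1 -> t_ p <= t <= 1 ->
  exists be, (0 <= be < 1 /\ profile p be = t) /\
  forall s, 0 <= s -> t <= profile p s -> objective p t s <= objective p t be /\
    (objective p t s = objective p t be -> s = be \/ t = t_ p /\ s = alpha_ p).
Proof.
intros Hp Ht; destruct (alpha2_sqr p Hp) as [Ha2 _].
destruct (alpha_p_spec p Hp) as (Hap & Hz & _ & Hneg).
assert (H1 := hump_one_lt_t_p p Hp); assert (H0 := profile_pos p 1).
destruct (profile_solution p t ltac:(lra) ltac:(lra)) as (be & Hbe & Eb).
assert (Hbe1 : be < 1).
{ apply Rnot_le_lt; intros [N|N].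
  - assert (K := profile_decreasing p 1 be ltac:(lra) ltac:(lra)); lra.
  - rewrite <- N in Eb; lra. }
exists be; split; [repeat split; assumption|]; intros s Hs Hts.
assert (Hsb := feasible_le p t s be ltac:(lra) Hs Hbe Eb Hts).
destruct (Rle_lt_dec (alpha2 p * profile p (alpha2 p)) t) as [L|L].
- destruct Hsb as [Hsb| ->]; [|split; [lra|now left]].
  assert (K := objective_one_candidate p t be s Hp L Eb Hbe ltac:(lra)); split; lra.
- destruct (hump_preimage p t (alpha2 p)) as (al & Hal & E); try lra.
  assert (Hab := alpha_lt_beta p al be ltac:(lra) ltac:(lra) Hbe ltac:(lra)).
  assert (Hal2 : alpha_ p <= al).
  { apply Rnot_lt_le; intros N; assert (K := hump_increasing p al (alpha_ p) Hp ltac:(lra) ltac:(lra)).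
    rewrite t_p_eq in Ht; lra. }
  destruct (objective_compare p al be Hp ltac:(lra) Hbe ltac:(lra)) as [C1 C2]; rewrite E in C1, C2.
  assert (Hle : objective p t al <= objective p t be /\ (objective p t al = objective p t be -> t = t_ p /\ al = alpha_ p)).
  { destruct Hal2 as [Q|Q].
    - specialize (Hneg al ltac:(lra)).
      split; [apply Rnot_lt_le; intros X; apply C1 in X; lra|intros X; apply eq_sym, C2 in X; lra].
    - split; [rewrite (proj1 C2) by (rewrite <- Q; exact Hz); lra|intros _; now rewrite t_p_eq, Q, <- E]. }
  destruct (Req_dec s be) as [->|N2]; [split; [lra|now left]|].
  destruct (Req_dec s al) as [->|N1].
  { split; [apply Hle|intros Q; right; now apply Hle]. }
  assert (K := objective_two_candidates p t al be s Hp ltac:(lra) E Eb Hab ltac:(lra) N1 N2).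
  rewrite Rmax_right in K by apply Hle; split; lra.
Qed.

(** * Reduction to the one-variable problem *)

Lemma Rpow_nn_pos (x s : R) : 0 < x -> Rpow_nn x s = Rpower x s.
Proof. intros H; unfold Rpow_nn; destruct (Rlt_dec 0 x); [reflexivity|easy]. Qed.

Lemma Rpow_nn_0 (s : R) : Rpow_nn 0 s = 0.
Proof. unfold Rpow_nn; destruct (Rlt_dec 0 0); [lra|reflexivity]. Qed.

Lemma Rpow_nn_ge_0 (x s : R) : 0 <= Rpow_nn x s.
Proof. unfold Rpow_nn; destruct (Rlt_dec 0 x); [left; apply exp_pos|lra]. Qed.

Lemma Rpower_le_base (x y s : R) : 0 < x <= y -> 0 <= s -> Rpower x s <= Rpower y s.
Proof. intros H Hs; apply Rle_Rpower_l; lra. Qed.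

Lemma Rpow_nn_le (x y s : R) : 0 <= x <= y -> 0 <= s -> Rpow_nn x s <= Rpow_nn y s.
Proof.
intros H Hs; destruct (Rlt_le_dec 0 x) as [Hx|Hx].
- rewrite !Rpow_nn_pos by lra; apply Rpower_le_base; lra.
- replace x with 0 by lra; rewrite Rpow_nn_0; apply Rpow_nn_ge_0.
Qed.

Lemma Rpower_ge_self (u s : R) : 0 < u <= 1 -> s <= 1 -> u <= Rpower u s.
Proof.
intros Hu Hs; rewrite <- (Rpower_1 u) at 1 by lra; unfold Rpower; apply exp_monotone.
assert (ln u <= 0) by (rewrite <- ln_1; destruct (proj2 Hu) as [H| ->]; [left; apply ln_increasing|]; lra).
nra.
Qed.

(** For exponents at most 1, [x / (a + b) <= (x / (a + b))^s] for both summands, and the left-hand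
    sides add up to 1. It bounds the cost of replacing [|f|^2] by [|f|^2 + eps]. *)
Lemma Rpower_subadditive (a b s : R) : 0 < a -> 0 < b -> 0 <= s <= 1 ->
  Rpower (a + b) s <= Rpower a s + Rpower b s.
Proof.
intros Ha Hb Hs.
assert (H1 : forall x, 0 < x <= a + b -> Rpower (a + b) s * (x / (a + b)) <= Rpower x s).
{ intros x Hx; replace (Rpower x s) with (Rpower (a + b) s * Rpower (x / (a + b)) s).
  - apply Rmult_le_compat_l; [left; apply exp_pos|].
    apply Rpower_ge_self; [split; [apply Rdiv_lt_0_compat|apply Rle_div_l]|]; lra.
  - rewrite Rpower_mult_distr by (try apply Rdiv_lt_0_compat; lra); f_equal; field; lra. }
assert (K1 := H1 a ltac:(lra)); assert (K2 := H1 b ltac:(lra)).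
replace (Rpower (a + b) s) with (Rpower (a + b) s * (a / (a + b)) + Rpower (a + b) s * (b / (a + b))) by (field; lra).
lra.
Qed.

Lemma Rpower_small (s eps : R) : 0 < s -> 0 < eps -> exists d, 0 < d /\ Rpower d s <= eps.
Proof.
intros Hs He; exists (Rpower eps (/ s)); split; [apply exp_pos|].
rewrite Rpower_mult; replace (/ s * s) with 1 by (field; lra); rewrite Rpower_1; lra.
Qed.

Lemma continuous_Rpow_nn_pt (s x : R) : 0 < s -> 0 <= x -> continuous (fun y => Rpow_nn y s) x.
Proof.
intros Hs Hx P [eps HP].
destruct Hx as [Hx|<-].
- assert (K : continuous (fun y => Rpower y s) x).
  { unfold Rpower; cont; exact Hx. }
  assert (K2 := K _ (locally_ball (Rpower x s) eps)).
  assert (K3 : locally x (fun y => 0 < y)).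
  { exists (mkposreal x Hx); intros y Hy; apply Rabs_def2 in Hy; unfold minus, plus, opp in Hy; simpl in Hy; lra. }
  unfold filtermap in *.
  refine (filter_imp _ _ _ (filter_and _ _ K2 K3)); intros y [H1 H2].
  apply HP; rewrite !Rpow_nn_pos by assumption; exact H1.
- assert (He2 : 0 < eps / 2) by (assert (K := cond_pos eps); lra).
  destruct (Rpower_small s (eps / 2) Hs He2) as (d & Hd & Hdl).
  exists (mkposreal d Hd); intros y Hy; apply HP.
  assert (Hy' : y <= d).
  { apply Rabs_def2 in Hy; unfold minus, plus, opp in Hy; simpl in Hy; lra. }
  assert (K : Rpow_nn y s <= eps / 2).
  { destruct (Rlt_le_dec 0 y) as [Hy0|Hy0].
    - rewrite Rpow_nn_pos by exact Hy0; apply Rle_trans with (2 := Hdl), Rpower_le_base; lra.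
    - unfold Rpow_nn; destruct (Rlt_dec 0 y); lra. }
  assert (K0 := Rpow_nn_ge_0 y s); rewrite Rpow_nn_0.
  apply Rabs_def1; unfold minus, plus, opp; simpl; lra.
Qed.

Lemma continuous_Rpow_nn {T : UniformSpace} (s : R) (g : T -> R) (x : T) : 0 < s -> 0 <= g x ->
  continuous g x -> continuous (fun y => Rpow_nn (g y) s) x.
Proof.
intros Hs Hx Hg; apply (continuous_comp g (fun y => Rpow_nn y s)); [exact Hg|].
now apply continuous_Rpow_nn_pt.
Qed.

Lemma circle_mean_eq (p : R) (f : C -> C) (r : R) :
  circle_mean p f r = mean (fun t => Rpow_nn (Cmod (f (r * cis t)%C)) p).
Proof.
unfold circle_mean, mean; f_equal; apply RInt_ext; intros x _; f_equal; f_equal; f_equal.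
unfold cis, RtoC, Cmult; simpl; f_equal; ring.
Qed.

Lemma disk_open (r : R) (z : C) : disk r z -> locally (T := C_UniformSpace) z (disk r).
Proof. apply locally_Cmod_lt. Qed.

Lemma chol_in_disc (f : C -> C) : analytic_in_disc f -> chol (disk 1) f (C_derive f).
Proof. intros H; apply chol_of_analytic; [apply disk_open|exact H]. Qed.

Lemma chol_dilation (f : C -> C) (r : R) : 0 < r < 1 -> analytic_in_disc f ->
  chol (disk (/ r)) (fun z => f (r * z)%C) (fun z => r * C_derive f (r * z))%C.
Proof.
intros Hr Hf.
assert (E : forall z : C, (0 + r * z)%C = (r * z)%C) by (intros; ring).
apply (chol_ext _ (fun z => f (0 + r * z)%C) (fun z => r * C_derive f (0 + r * z))%C);
 [intros; now rewrite E|intros; now rewrite E|].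
apply (chol_comp_affine _ _ (disk 1)); [|now apply chol_in_disc].
unfold disk; intros w Hw; rewrite Cplus_0_l, Cmod_mult, Cmod_R, Rabs_pos_eq by lra.
apply Rmult_lt_compat_l with (r := r) in Hw; [|lra]; rewrite Rinv_r in Hw; lra.
Qed.

Lemma inv_gt_1 (r : R) : 0 < r < 1 -> 1 < / r.
Proof. intros Hr; rewrite <- Rinv_1; apply Rinv_lt_contravar; lra. Qed.

Lemma continuous_circle (f : C -> C) (r : R) : 0 < r < 1 -> analytic_in_disc f ->
  forall t, continuous (fun s => f (r * cis s)%C) t.
Proof.
intros Hr Hf; apply (chol_continuous_cis _ _ (/ r) (inv_gt_1 r Hr) (chol_dilation f r Hr Hf)).
Qed.

Lemma is_mean_limit_iota (p : R) (f : C -> C) (L : R) : is_mean_limit p f L ->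
  @iota R_CompleteSpace (is_mean_limit p f) = L.
Proof.
intros H; apply (iota_unique (V := R_CompleteNormedModule)); [|exact H].
intros y Hy.
exact (filterlim_locally_unique (V := R_NormedModule) _ _ _ Hy H).
Qed.

Lemma admissible_mean_limit (p t : R) (f : C -> C) : 0 < p -> admissible p t f ->
  exists L, is_mean_limit p f L /\ L <= 1.
Proof.
intros Hp [[Hf [L HL]] [Hn _]]; exists L; split; [exact HL|].
unfold Hp_norm in Hn; rewrite (is_mean_limit_iota p f L HL) in Hn.
apply Rnot_lt_le; intros N; rewrite Rpow_nn_pos in Hn by lra.
assert (K : Rpower 1 (/ p) < Rpower L (/ p)).
{ apply Rlt_Rpower_l; [now apply Rinv_0_lt_compat|lra]. }
rewrite Rpower_base_1 in K; lra.
Qed.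

(* [u] replaces log |f (r e^it)|, which is -oo at the zeros of [f]. *)
Lemma log_modulus_majorant (p t eta : R) (f : C -> C) : 0 < p < 1 -> admissible p t f -> 0 < eta < 1 ->
  exists (r : R) (u : R -> R), 1 - eta < r < 1 /\ 0 < r /\
   (forall x, continuous u x) /\ u (2 * PI) = u 0 /\
   mean (fun x => exp (p * u x)) <= 1 + eta /\
   (forall x, Cmod (f (r * cis x)%C) <= exp (u x)).
Proof.
intros Hp Hadm Heta.
destruct (admissible_mean_limit p t f ltac:(lra) Hadm) as (L & HL & HL1).
destruct Hadm as [[Hf _] _].
assert (He2 : 0 < eta / 2) by lra.
destruct (HL _ (locally_ball L (mkposreal _ He2))) as [d Hd].
set (r := 1 - Rmin (d / 2) (eta / 2)).
assert (M0 : 0 < Rmin (d / 2) (eta / 2)) by (apply Rmin_pos; assert (K := cond_pos d); lra).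
assert (M1 := Rmin_l (d / 2) (eta / 2)); assert (M2 := Rmin_r (d / 2) (eta / 2)).
assert (Hr : 0 < r < 1) by (unfold r; lra).
assert (Hm : circle_mean p f r <= 1 + eta / 2).
{ assert (K : ball L (mkposreal _ He2) (circle_mean p f r)).
  { apply (Hd r); [|lra]; apply Rabs_def1; unfold minus, plus, opp; simpl; unfold r; assert (K := cond_pos d); lra. }
  apply Rabs_def2 in K; unfold minus, plus, opp in K; simpl in K; lra. }
rewrite circle_mean_eq in Hm.
(* The regularized logarithm is [1/2 ln (|f|^2 + eps)]. By subadditivity it adds at most
   [eps^(p/2) <= eta / 2] to the mean; the other half of [eta] is spent on the choice of [r]. *)
destruct (Rpower_small (p / 2) (eta / 2) ltac:(lra) He2) as (eps & Heps & Hsmall).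
assert (Hc := continuous_circle f r Hr Hf).
assert (Hpos : forall x, 0 < Cmod (f (r * cis x)%C) ^ 2 + eps).
{ intros x; assert (K := pow2_ge_0 (Cmod (f (r * cis x)%C))); lra. }
exists r, (fun x => / 2 * ln (Cmod (f (r * cis x)%C) ^ 2 + eps)).
repeat split; try (unfold r; lra).
- intros x; specialize (Hpos x); cont.
- now rewrite cis_period.
- apply Rle_trans with (mean (fun x => Rpow_nn (Cmod (f (r * cis x)%C)) p + eta / 2)).
  + apply mean_le; intros x; [specialize (Hpos x); cont|cont|].
    { apply continuous_Rpow_nn; [lra|apply Cmod_ge_0|cont]. }
    intros _.
    replace (exp (p * (/ 2 * ln (Cmod (f (r * cis x)%C) ^ 2 + eps))))
      with (Rpower (Cmod (f (r * cis x)%C) ^ 2 + eps) (p / 2)) by (unfold Rpower; f_equal; field).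
    destruct (Rle_lt_or_eq_dec _ _ (Cmod_ge_0 (f (r * cis x)%C))) as [H|H].
    * assert (K := Rpower_subadditive (Cmod (f (r * cis x)%C) ^ 2) eps (p / 2) ltac:(nra) Heps ltac:(lra)).
      rewrite Rpow_nn_pos by exact H.
      replace (Rpower (Cmod (f (r * cis x)%C) ^ 2) (p / 2)) with (Rpower (Cmod (f (r * cis x)%C)) p) in K; [lra|].
      rewrite <- (Rpower_pow 2) by exact H; rewrite Rpower_mult; f_equal; simpl; field.
    * rewrite <- H, Rpow_nn_0; replace (0 ^ 2 + eps) with eps by ring; lra.
  + rewrite mean_plus, mean_const; [lra| |intros; cont].
    intros x; apply continuous_Rpow_nn; [lra|apply Cmod_ge_0|cont].
- intros x; set (m := Cmod (f (r * cis x)%C)) in *; specialize (Hpos x); fold m in Hpos.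
  assert (Hm0 : 0 <= m) by apply Cmod_ge_0.
  destruct Hm0 as [Hm0|Hm0]; [|rewrite <- Hm0; left; apply exp_pos].
  rewrite <- (exp_ln m Hm0) at 1; apply exp_monotone.
  assert (K : ln (m ^ 2) <= ln (m ^ 2 + eps)) by (apply ln_le; nra).
  replace (m ^ 2) with (m * m) in K at 1 by ring; rewrite ln_mult in K by exact Hm0; lra.
Qed.

Lemma Clog_1 : Clog 1 = 0%C.
Proof.
unfold Clog, Carg; rewrite Cmod_1, ln_1.
destruct (Rle_dec 0 (Im 1)) as [H|H]; [|simpl in H; lra].
simpl; replace (1 / 1) with 1 by field; now rewrite acos_1.
Qed.

(** Its exponential is the outer function [e^(c/p) (1 + b z)^(2/p)]; with [c = p * ln (profile p b)]
    it is the outer factor of the extremals. *)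
Definition outer_exponent (p b c : R) (z : C) : C := (RtoC (c / p) + RtoC (2 / p) * Clog (1 + b * z))%C.

Lemma chol_outer_exponent (p b c rho : R) : 0 <= b -> b * rho <= 1 ->
  chol (disk rho) (outer_exponent p b c) (fun z => RtoC (2 / p) * (b / (1 + b * z)))%C.
Proof.
intros Hb Hr z Hz; destruct (chol_log1p b rho Hb Hr z Hz) as [H1 H2]; split; [|cont].
apply (cderiv_eq _ _ (0 + RtoC (2 / p) * (b / (1 + b * z)))%C); [|cring].
apply (cderiv_plus (fun _ => RtoC (c / p))); [apply cderiv_const|now apply cderiv_scal].
Qed.

Lemma outer_exponent_0 (p b c : R) : outer_exponent p b c 0 = RtoC (c / p).
Proof.
unfold outer_exponent; replace (1 + b * 0)%C with (RtoC 1) by ring; rewrite Clog_1; ring.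
Qed.

Lemma Re_outer_exponent (p b c t : R) : 0 < p -> 0 <= b < 1 ->
  Re (outer_exponent p b c (cis t)) = (c + log_weight b t) / p.
Proof.
intros Hp Hb; unfold outer_exponent; rewrite re_plus, re_RtoC, re_scal_l, <- Re_Clog_cis by exact Hb.
field; lra.
Qed.

(* [b = c = 0] gives the upper bound; in the equality case [b] and [c] describe the limit of [p u],
   so that [d] tends to 0 in mean. *)
Lemma majorant_inequality (p t r b c : R) (f : C -> C) (u : R -> R) :
  0 < p < 1 -> 0 <= t -> analytic_in_disc f -> f 0%C = t -> 0 < r < 1 ->
  (forall x, continuous u x) -> u (2 * PI) = u 0 ->
  (forall x, Cmod (f (r * cis x)%C) <= exp (u x)) -> 0 <= b < 1 ->
  let a := t / exp (mean u) in
  let d := fun x => u x - (c + log_weight b x) / p in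
  a <= 1 /\
  exists b1 : C, Re b1 = (r * Re (C_derive f 0) - 2 * t * mean (fun x => u x * cos x)) / exp (mean u) /\
   forall z, Cmod z < 1 ->
    (1 - Cmod z) ^ 2 * Cmod (f (r * z) * Cexp (- outer_exponent p b c z) * Cexp (- schwarz d z) * (1 + a * z)
        - a - (b1 + a ^ 2) * z)%C ^ 2 <= 1 - Cmod (b1 + a ^ 2)%C ^ 2.
Proof.
intros Hp Ht Hf Hf0 Hr Hu Hper Hmaj Hb a d.
assert (Hw := fun x => continuous_log_weight b x Hb).
destruct (mean_log_weight b Hb) as [W0 W1].
set (rho := Rmin (/ r) (2 / (1 + b))).
assert (Hrho : 1 < rho) by (apply Rmin_glb_lt; [now apply inv_gt_1|apply Rlt_div_r; lra]).
assert (Hbr : b * rho <= 1).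
{ assert (K := Rmin_r (/ r) (2 / (1 + b))); fold rho in K.
  apply Rmult_le_compat_l with (r := b) in K; [|lra].
  apply Rle_trans with (1 := K); replace (b * (2 / (1 + b))) with (2 * b / (1 + b)) by (field; lra).
  apply Rle_div_l; lra. }
assert (Hfr : chol (disk rho) (fun z => f (r * z)%C) (fun z => r * C_derive f (r * z))%C).
{ apply (chol_weaken (disk (/ r))); [|now apply chol_dilation].
  unfold disk; intros z Hz; apply Rlt_le_trans with (1 := Hz), Rmin_l. }
assert (HG := chol_outer_exponent p b c rho (proj1 Hb) Hbr).
assert (HF := chol_mult _ _ _ _ _ Hfr (chol_Cexp _ _ _ (chol_opp _ _ _ HG))).
set (F := fun z => (f (r * z) * Cexp (- outer_exponent p b c z))%C) in HF.
cbv beta in HF.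
match type of HF with chol _ _ ?X => set (F' := X) in HF end.
assert (Hd : forall x, continuous d x) by (intros x; unfold d; cont).
assert (Hdper : d (2 * PI) = d 0) by (unfold d, log_weight; now rewrite Hper, cos_2PI, cos_0).
assert (Hbound : forall x, 0 <= x <= 2 * PI -> Cmod (F (cis x)) <= exp (d x)).
{ intros x _; unfold F, d; rewrite Cmod_mult, Cmod_Cexp, re_opp, Re_outer_exponent by (try exact Hb; lra).
  unfold Rminus; rewrite exp_plus; apply Rmult_le_compat_r; [left; apply exp_pos|apply Hmaj]. }
assert (Emd : mean d = mean u - c / p).
{ unfold d; rewrite (mean_ext _ (fun x => u x - (c / p + / p * log_weight b x))) by (intros; field; lra).
  rewrite mean_minus, mean_plus, mean_const, mean_scal, W0 by (intros; cont); ring. }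
assert (Emdc : mean (fun x => d x * cos x) = mean (fun x => u x * cos x) - b / p).
{ unfold d; rewrite (mean_ext _ (fun x => u x * cos x - (c / p * cos x + / p * (log_weight b x * cos x)))) by (intros; field; lra).
  rewrite mean_minus, mean_plus, !mean_scal, mean_cos, W1 by (intros; cont); field; lra. }
assert (R0 : (r * 0)%C = RtoC 0) by ring.
assert (EE : Cexp (- outer_exponent p b c 0) = exp (- (c / p))).
{ rewrite outer_exponent_0, <- RtoC_opp; apply Cexp_RtoC. }
assert (EF0 : F 0%C = (t * exp (- (c / p)))%C) by (unfold F; rewrite R0, Hf0, EE; ring).
assert (Eb0 : (F 0 * exp (- mean d))%C = RtoC a).
{ rewrite EF0, <- !RtoC_mult; f_equal; unfold a.
  rewrite Rmult_assoc, <- exp_plus, Emd; unfold Rdiv; rewrite <- exp_Ropp; do 2 f_equal; ring. }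
assert (SP := fun a0 z Hz => schwarz_pick F F' rho d a0 z Hrho HF Hd Hdper Hbound Hz).
cbv zeta in SP; rewrite Eb0 in SP.
set (b1 := ((F' 0 - F 0 * schwarz' d 0) * exp (- mean d))%C) in SP.
assert (HA := exp_pos (mean u)).
assert (Ha0 : 0 <= a) by (apply Rdiv_le_0_compat; assumption).
assert (Z0 : Cmod 0 < 1) by (rewrite Cmod_0; lra).
split.
(* With parameter 0 at [z = 0], the nonnegativity of the right-hand side already contains
   [a ^ 2 <= 1]. *)
{ assert (K := SP 0 0%C Z0).
  replace (F 0 * Cexp (- schwarz d 0) * (1 + 0 * 0) - a - (b1 + 0 * a) * 0)%C with
    (F 0 * Cexp (- schwarz d 0) - a)%C in K by ring.
  rewrite schwarz_0, <- RtoC_opp, Cexp_RtoC, Eb0 in K.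
  replace (a - a)%C with (RtoC 0) in K by ring; rewrite Cmod_0, (Cmod_R a), Rabs_pos_eq in K by exact Ha0.
  assert (K1 := pow2_ge_0 (Cmod (b1 + 0 * a)%C)); nra. }
exists b1; split.
- unfold b1, F'; rewrite R0, Hf0, EE, EF0.
  replace (1 + b * 0)%C with (RtoC 1) by ring.
  replace ((r * C_derive f 0 * exp (- (c / p)) + t * (exp (- (c / p)) * - (RtoC (2 / p) * (b / 1))) -
     t * exp (- (c / p)) * schwarz' d 0) * exp (- mean d))%C with
    ((exp (- (c / p)) * exp (- mean d))%R * (r * C_derive f 0 - t * RtoC (2 / p * b) - t * schwarz' d 0))%C
    by (rewrite !RtoC_mult; field; intros E; apply RtoC_inj in E; lra).
  rewrite re_scal_l; unfold Cminus; rewrite !re_plus, !re_opp, !re_scal_l, re_RtoC, Re_schwarz'_0, Emdc by exact Hd.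
  rewrite <- exp_plus, Emd.
  replace (- (c / p) + - (mean u - c / p)) with (- mean u) by ring.
  rewrite exp_Ropp; field; lra.
(* Taking the parameter equal to the value at 0 cancels [a ^ 2] on the right. What remains implies
   [Re b1 <= 1 - a ^ 2], the Schwarz-Pick inequality at 0. *)
- intros z Hz; assert (K := SP a z Hz).
  replace (RtoC a ^ 2)%C with (a * a)%C by ring.
  rewrite (Cmod_R a), Rabs_pos_eq in K by exact Ha0.
  unfold F in K; lra.
Qed.

(** * Sequences of majorants on circles tending to the boundary *)

Definition clim (x : nat -> C) (l : C) : Prop := filterlim x eventually (locally (T := C_UniformSpace) l).

Lemma clim_of_Cmod (x : nat -> C) (l : C) : is_lim_seq (fun n => Cmod (x n - l)) 0 -> clim x l.
Proof.
intros H P [eps HP]; apply is_lim_seq_spec in H; destruct (H eps) as [N HN].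
exists N; intros n Hn; apply HP, Cmod_ball.
specialize (HN n Hn); rewrite Rminus_0_r in HN; apply Rabs_def2 in HN; apply HN.
Qed.

Lemma filterlim_Cpair_op (op : C -> C -> C) (x y : nat -> C) (l m : C) :
  (forall q : C * C, continuous (fun q : C * C => op (fst q) (snd q)) q) ->
  clim x l -> clim y m -> clim (fun n => op (x n) (y n)) (op l m).
Proof.
intros Hop Hx Hy.
apply (filterlim_comp _ _ _ (fun n => (x n, y n)) (fun q => op (fst q) (snd q)) eventually
  (locally (T := prod_UniformSpace C_UniformSpace C_UniformSpace) (l, m))); [|apply (Hop (l, m))].
intros P [eps HP].
assert (Hx' := Hx _ (locally_ball l eps)); assert (Hy' := Hy _ (locally_ball m eps)).
unfold filtermap in *.
refine (filter_imp _ _ _ (filter_and _ _ Hx' Hy')).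
intros n [H1 H2]; apply HP; split; assumption.
Qed.

Lemma clim_plus (x y : nat -> C) (l m : C) : clim x l -> clim y m -> clim (fun n => x n + y n)%C (l + m)%C.
Proof.
apply (filterlim_Cpair_op Cplus); intros q; cont; [apply continuous_fst|apply continuous_snd].
Qed.

Lemma clim_mult (x y : nat -> C) (l m : C) : clim x l -> clim y m -> clim (fun n => x n * y n)%C (l * m)%C.
Proof.
apply (filterlim_Cpair_op Cmult); intros q; cont; [apply continuous_fst|apply continuous_snd].
Qed.

Lemma clim_const (c : C) : clim (fun _ => c) c.
Proof. apply filterlim_const. Qed.

Lemma clim_comp (F : C -> C) (x : nat -> C) (l : C) : continuous F l -> clim x l -> clim (fun n => F (x n)) (F l).
Proof. intros HF Hx; exact (filterlim_comp _ _ _ _ _ _ _ _ Hx HF). Qed.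

Lemma clim_opp (x : nat -> C) (l : C) : clim x l -> clim (fun n => - x n)%C (- l)%C.
Proof. apply (clim_comp Copp); cont; apply continuous_id. Qed.

Lemma clim_RtoC (x : nat -> R) (l : R) : is_lim_seq x l -> clim (fun n => RtoC (x n)) l.
Proof.
intros Hx; assert (K : continuous RtoC l) by (apply (continuous_RtoC (fun x => x)), continuous_id).
exact (filterlim_comp _ _ _ _ _ _ _ _ Hx K).
Qed.

Lemma clim_unique (x : nat -> C) (l m : C) : clim x l -> clim x m -> l = m.
Proof. intros H1 H2; exact (filterlim_locally_unique (V := C_NormedModule) _ _ _ H1 H2). Qed.

Lemma bounded_cluster_point (x : nat -> R) (a b : R) : (forall n, a <= x n <= b) ->
  exists l, forall eps N, 0 < eps -> exists n, (N <= n)%nat /\ Rabs (x n - l) < eps.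
Proof.
intros H; destruct (Bolzano_Weierstrass x (fun c => a <= c <= b) (compact_P3 a b) H) as [l Hl].
exists l; intros eps N He.
destruct (Hl (disc l (mkposreal eps He)) N) as (n & Hn & K).
- exists (mkposreal eps He); now intros y Hy.
- exists n; split; assumption.
Qed.

(** Everything one circle yields. The factor [Rpower (1 + eta) (1 / p)] pays for a mean bounded by
    [1 + eta] only, and [Rmax 0] discards negative coefficients, for which the bound on the mean is
    Jensen's. *)
Lemma majorant_data (p t eta : R) (f : C -> C) : 0 < p < 1 -> 0 <= t -> admissible p t f -> 0 < eta < 1 ->
  exists (r : R) (u : R -> R), (1 - eta < r < 1 /\ 0 < r /\
   (forall x, continuous u x) /\ u (2 * PI) = u 0 /\
   (forall x, Cmod (f (r * cis x)%C) <= exp (u x))) /\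
   mean (fun x => exp (p * u x)) <= 1 + eta /\
   (exp (mean u) <= Rpower (1 + eta) (1 / p) * profile p (Rmax 0 (p * mean (fun x => u x * cos x))) /\
   t <= exp (mean u) /\
   r * Re (C_derive f 0) <= exp (mean u) - t ^ 2 / exp (mean u) + 2 / p * t * (p * mean (fun x => u x * cos x))).
Proof.
intros Hp Ht Hadm Heta.
destruct (log_modulus_majorant p t eta f Hp Hadm Heta) as (r & u & Hr & Hr0 & Hu & Hper & Hm & Hmaj).
exists r, u; split; [repeat split; try assumption; apply Hr|split; [exact Hm|]].
assert (Hf : analytic_in_disc f) by apply Hadm.
assert (Hf0 : f 0%C = t) by apply Hadm.
destruct (majorant_inequality p t r 0 0 f u Hp Ht Hf Hf0 ltac:(lra) Hu Hper Hmaj ltac:(lra)) as (Ha & b1 & Hb1 & H0).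
set (A := exp (mean u)) in *.
assert (HA : 0 < A) by apply exp_pos.
assert (Z0 : Cmod 0 < 1) by (rewrite Cmod_0; lra).
split; [|split].
- assert (LM := lebedev_milin (fun x => p * u x) (fun x => continuous_Rmult _ _ _ (continuous_const p x) (Hu x))).
  cbv beta zeta in LM.
  rewrite (mean_ext (fun x => p * u x * cos x) (fun x => p * (u x * cos x))) in LM by (intros; ring).
  rewrite !mean_scal in LM by (intros; cont).
  set (s := Rmax 0 (p * mean (fun x => u x * cos x))) in *.
  assert (H1 := one_plus_sqr_pos s).
  assert (K : exp (p * mean u) <= (1 + eta) / (1 + s ^ 2)) by (apply Rle_div_r; lra).
  assert (K2 : Rpower (exp (p * mean u)) (1 / p) <= Rpower ((1 + eta) / (1 + s ^ 2)) (1 / p)).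
  { apply Rpower_le_base; [split; [apply exp_pos|exact K]|apply Rlt_le, Rdiv_lt_0_compat; lra]. }
  replace (Rpower (exp (p * mean u)) (1 / p)) with A in K2.
  + apply Rle_trans with (1 := K2); right; unfold profile, Rdiv.
    rewrite <- Rpower_mult_distr by (try apply Rinv_0_lt_compat; lra); f_equal.
    unfold Rpower; f_equal; rewrite ln_Rinv by exact H1; ring.
  + unfold A, Rpower; rewrite ln_exp; f_equal; field; lra.
- apply Rmult_le_compat_r with (r := A) in Ha; [|lra].
  unfold Rdiv in Ha; rewrite Rmult_assoc, Rinv_l in Ha; lra.
- specialize (H0 0%C Z0).
  match type of H0 with ?x ^ 2 * ?y ^ 2 <= _ => assert (K0 := pow2_ge_0 (x * y)) end.
  rewrite Rpow_mult_distr in K0.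
  assert (K : Cmod (b1 + (t / A)%R ^ 2)%C <= 1).
  { assert (K1 := Cmod_ge_0 (b1 + (t / A)%R ^ 2)%C); nra. }
  assert (K2 := Rle_trans _ _ _ (Re_le_Cmod _) K).
  rewrite <- RtoC_pow, re_plus, re_RtoC, Hb1 in K2.
  set (D := Re (C_derive f 0)) in *; set (m := mean (fun x => u x * cos x)) in *.
  apply Rmult_le_compat_r with (r := A) in K2; [|lra].
  replace (((r * D - 2 * t * m) / A + (t / A) ^ 2) * A) with (r * D - 2 * t * m + t ^ 2 / A) in K2 by (field; lra).
  replace (2 / p * t * (p * m)) with (2 * t * m) by (field; lra); lra.
Qed.

Lemma is_lim_seq_comp_continuous (g : R -> R) (x : nat -> R) (l : R) :
  continuous g l -> is_lim_seq x l -> is_lim_seq (fun n => g (x n)) (g l).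
Proof. intros Hg Hx; exact (filterlim_comp _ _ _ _ _ _ _ _ Hx Hg). Qed.

Lemma continuous_profile (p x : R) : continuous (profile p) x.
Proof. assert (H := one_plus_sqr_pos x); unfold profile, Rpower; cont; simpl in H |- *; lra. Qed.

Lemma is_lim_seq_inv_shift (c : R) : is_lim_seq (fun n => / (INR n + c)) 0.
Proof.
change (Finite 0) with (Rbar_inv p_infty).
apply is_lim_seq_inv; [|easy].
apply (is_lim_seq_plus _ _ p_infty c); [apply is_lim_seq_INR|apply is_lim_seq_const|easy].
Qed.

Lemma is_lim_seq_minus_R (x y : nat -> R) (l m : R) :
  is_lim_seq x l -> is_lim_seq y m -> is_lim_seq (fun n => x n - y n) (l - m).
Proof. intros; now apply is_lim_seq_minus'. Qed.

Lemma is_lim_seq_div_R (x y : nat -> R) (l m : R) : m <> 0 ->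
  is_lim_seq x l -> is_lim_seq y m -> is_lim_seq (fun n => x n / y n) (l / m).
Proof.
intros Hm Hx Hy; apply is_lim_seq_div'; assumption.
Qed.

(** * The case of equality in the limit *)

Section Limit.

Variables (p t sigma D : R) (f : C -> C) (r eta : nat -> R) (u : nat -> R -> R).

Let A (k : nat) : R := exp (mean (u k)).
Let s (k : nat) : R := p * mean (fun x => u k x * cos x).

(** The convergence of [s] is stated only after multiplication by [t] and by [sigma]: for [t = 0]
    the derivative gives no lower control of [s], but then [sigma = 0] and both products are
    trivial. *)
Hypotheses (Hp : 0 < p < 1) (Ht : 0 <= t) (Hf : analytic_in_disc f) (Hf0 : f 0%C = t)
  (HD : Re (C_derive f 0) = D)
  (Hr : forall k, 0 < r k < 1) (Hu : forall k x, continuous (u k) x)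
  (Hper : forall k, u k (2 * PI) = u k 0)
  (Hmaj : forall k x, Cmod (f (r k * cis x)%C) <= exp (u k x))
  (Hmean : forall k, mean (fun x => exp (p * u k x)) <= 1 + eta k)
  (Leta : is_lim_seq eta 0) (Lr : is_lim_seq r 1)
  (LA : is_lim_seq A (profile p sigma))
  (Lts : is_lim_seq (fun k => t * s k) (t * sigma))
  (Lss : is_lim_seq (fun k => sigma * s k) (sigma * sigma))
  (Hobj : D = objective p t sigma) (Hsig : 0 <= sigma < 1).

Let c : R := p * ln (profile p sigma).

Ltac ucont := cont; try apply Hu.

(** This normalization gives the limiting weight [exp (c + log_weight sigma x)] mean 1. *)
Lemma exp_c : exp c * (1 + sigma ^ 2) = 1.
Proof.
unfold c, profile, Rpower; rewrite ln_exp.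
replace (p * (- (1 / p) * ln (1 + sigma ^ 2))) with (- ln (1 + sigma ^ 2)) by (field; lra).
assert (H := one_plus_sqr_pos sigma); rewrite exp_Ropp, exp_ln by exact H; field; lra.
Qed.

(** The two first Fourier coefficients converge to those of the comparison function, so the upper
    bound of the mean deficit tends to [1 - exp c * (1 + sigma ^ 2) = 0]. *)
Lemma mean_deficit_limit :
  is_lim_seq (fun k => mean (exp_deficit (fun x => p * u k x) sigma c)) 0.
Proof.
assert (Ec := exp_c).
apply is_lim_seq_le_le with (fun _ => 0) (fun k => 1 + eta k -
   exp c * ((1 + sigma ^ 2) * (1 + p * ln (A k) - c) + (2 * (sigma * s k) - 2 * sigma ^ 2))).
- intros k.
  assert (Hv : forall x, continuous (fun x => p * u k x) x) by (intros; ucont).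
  split.
  + apply mean_nonneg; [intros; now apply continuous_exp_deficit|apply exp_deficit_nonneg].
  + rewrite mean_exp_deficit by assumption; specialize (Hmean k).
    rewrite (mean_ext (fun x => p * u k x * cos x) (fun x => p * (u k x * cos x))) by (intros; ring).
    rewrite !mean_scal by (intros; ucont); unfold A; rewrite ln_exp; fold (s k).
    replace (2 * sigma * s k - 2 * sigma ^ 2) with (2 * (sigma * s k) - 2 * sigma ^ 2) by ring.
    lra.
- apply is_lim_seq_const.
- replace 0 with (1 + 0 - exp c * ((1 + sigma ^ 2) * (1 + p * ln (profile p sigma) - c) + (2 * (sigma * sigma) - 2 * sigma ^ 2))).
  + apply is_lim_seq_minus_R; [apply is_lim_seq_plus'; [apply is_lim_seq_const|exact Leta]|].
    apply is_lim_seq_mult'; [apply is_lim_seq_const|].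
    apply is_lim_seq_plus'.
    * apply is_lim_seq_mult'; [apply is_lim_seq_const|].
      apply is_lim_seq_minus_R; [|apply is_lim_seq_const].
      apply is_lim_seq_plus'; [apply is_lim_seq_const|].
      apply is_lim_seq_mult'; [apply is_lim_seq_const|].
      apply (is_lim_seq_comp_continuous ln); [|exact LA].
      apply (continuous_Rln (fun x => x)); [apply continuous_id|apply profile_pos].
    * apply is_lim_seq_minus_R; [|apply is_lim_seq_const].
      apply is_lim_seq_mult'; [apply is_lim_seq_const|exact Lss].
  + fold c; replace ((1 + sigma ^ 2) * (1 + c - c) + (2 * (sigma * sigma) - 2 * sigma ^ 2)) with (1 + sigma ^ 2) by ring.
    rewrite Ec; ring.
Qed.

Lemma mean_dist_limit :
  is_lim_seq (fun k => mean (fun x => Rabs (u k x - (c + log_weight sigma x) / p))) 0.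
Proof.
assert (Hw := fun x => continuous_log_weight sigma x Hsig).
assert (E : forall k, mean (fun x => Rabs (u k x - (c + log_weight sigma x) / p)) =
  / p * mean (fun x => Rabs (p * u k x - (c + log_weight sigma x)))).
{ intros k; rewrite <- mean_scal by (intros; ucont); apply mean_ext; intros x.
  rewrite <- (Rabs_pos_eq (/ p)) at 1 by (apply Rlt_le, Rinv_0_lt_compat; lra).
  rewrite <- Rabs_mult; f_equal; field; lra. }
apply is_lim_seq_ext with (1 := fun k => eq_sym (E k)).
replace (Finite 0) with (Finite (/ p * 0)) by (f_equal; ring).
apply is_lim_seq_mult'; [apply is_lim_seq_const|].
apply is_lim_seq_spec; intros eps.
set (tau := Rmin (eps / 2) (1 / 2)).
assert (Htau : 0 < tau) by (apply Rmin_pos; assert (K := cond_pos eps); lra).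
assert (Htau1 : tau <= eps / 2) by apply Rmin_l.
assert (Htau2 : tau <= 1 / 2) by apply Rmin_r.
set (q := tau * exp c * (1 - sigma) ^ 2).
assert (Hq : 0 < q).
{ unfold q; apply Rmult_lt_0_compat; [apply Rmult_lt_0_compat; [exact Htau|apply exp_pos]|nra]. }
assert (Hqe : 0 < q * (eps / 4)) by (apply Rmult_lt_0_compat; [exact Hq|assert (K := cond_pos eps); lra]).
assert (L := mean_deficit_limit); apply is_lim_seq_spec in L.
destruct (L (mkposreal _ Hqe)) as [N HN]; exists N; intros k Hk.
specialize (HN k Hk); simpl in HN; rewrite Rminus_0_r in HN |- *.
assert (Hv : forall x, continuous (fun x => p * u k x) x) by (intros; ucont).
assert (K := mean_dist_log_weight (fun x => p * u k x) sigma c tau Hsig Hv ltac:(lra)).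
fold q in K; apply Rabs_def2 in HN.
assert (K2 : mean (exp_deficit (fun x => p * u k x) sigma c) / q <= eps / 4) by (apply Rle_div_l; lra).
rewrite Rabs_pos_eq by (apply mean_nonneg; intros; [ucont|apply Rabs_pos]).
assert (K3 := cond_pos eps); lra.
Qed.

(** Since [D] is the value of the objective, the coefficient [e k] has real part tending to 1 while
    its modulus is at most 1, so it tends to 1. Then the remainder [Y k] vanishes in the limit, the
    Schwarz factor tends to 1 because [d k] tends to 0 in mean, and the identity is what is left. *)
Lemma limit_identity (z : C) : Cmod z < 1 ->
  (f z * (1 + RtoC (t / profile p sigma) * z) =
   (RtoC (t / profile p sigma) + z) * Cexp (outer_exponent p sigma c z))%C.
Proof.
intros Hz.
set (As := profile p sigma); assert (HAs : 0 < As) by apply profile_pos.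
assert (Hw := fun x => continuous_log_weight sigma x Hsig).
set (a := fun k => t / A k).
set (d := fun k x => u k x - (c + log_weight sigma x) / p).
destruct (functional_choice (fun k b1 =>
   Re b1 = (r k * D - 2 * t * mean (fun x => u k x * cos x)) / A k /\
   (1 - Cmod z) ^ 2 * Cmod (f (r k * z) * Cexp (- outer_exponent p sigma c z) * Cexp (- schwarz (d k) z) * (1 + a k * z)
        - a k - (b1 + a k ^ 2) * z)%C ^ 2 <= 1 - Cmod (b1 + a k ^ 2)%C ^ 2)) as [b1 Hb1].
{ intros k.
  destruct (majorant_inequality p t (r k) sigma c f (u k) Hp Ht Hf Hf0 (Hr k) (Hu k) (Hper k) (Hmaj k) Hsig)
    as (_ & b1 & H1 & H2).
  exists b1; rewrite <- HD; split; [exact H1|now apply H2]. }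
set (e := fun k => (b1 k + a k ^ 2)%C) in *.
set (Y := fun k => (f (r k * z) * Cexp (- outer_exponent p sigma c z) * Cexp (- schwarz (d k) z) * (1 + a k * z)
        - a k - e k * z)%C).
assert (La : is_lim_seq a (t / As)).
{ apply is_lim_seq_div_R; [lra|apply is_lim_seq_const|exact LA]. }
assert (LRe : is_lim_seq (fun k => Re (e k)) 1).
{ apply is_lim_seq_ext with (fun k => (r k * D - 2 / p * (t * s k)) / A k + a k * a k).
  - intros k; unfold e; rewrite <- RtoC_pow, re_plus, re_RtoC, (proj1 (Hb1 k)); unfold s; simpl; field.
    split; [apply Rgt_not_eq, exp_pos|lra].
  - replace (Finite 1) with (Finite ((1 * D - 2 / p * (t * sigma)) / As + t / As * (t / As))).
    + apply is_lim_seq_plus'; [|now apply is_lim_seq_mult'].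
      apply is_lim_seq_div_R; [lra| |exact LA].
      apply is_lim_seq_minus_R; apply is_lim_seq_mult'; try apply is_lim_seq_const; assumption.
    + f_equal; rewrite Hobj; unfold objective; fold As; field; split; lra. }
(* For [|e| <= 1], the quantity [2 - 2 Re e] dominates both [|e - 1|^2] and [1 - |e|^2], hence
   controls the convergence of [e] and of [Y]. *)
set (g := fun k => 2 - 2 * Re (e k)).
assert (Lg : is_lim_seq (fun k => sqrt (g k)) 0).
{ rewrite <- sqrt_0; apply (is_lim_seq_comp_continuous sqrt); [apply continuous_sqrt|].
  unfold g; replace 0 with (2 - 2 * 1) by ring.
  apply is_lim_seq_minus_R; [|apply is_lim_seq_mult']; try apply is_lim_seq_const; exact LRe. }
assert (He1 : forall k, Cmod (e k) <= 1).
{ intros k; destruct (Hb1 k) as [_ K]; fold (e k) in K.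
  match type of K with ?x ^ 2 * ?y ^ 2 <= _ => assert (K0 := pow2_ge_0 (x * y)) end.
  rewrite Rpow_mult_distr in K0; assert (K1 := Cmod_ge_0 (e k)); nra. }
assert (Hle : forall x y, 0 <= x -> x ^ 2 <= y -> x <= sqrt y).
{ intros x y Hx H; rewrite <- (sqrt_pow2 x Hx); now apply sqrt_le_1_alt. }
assert (Le : clim e 1%C).
{ apply clim_of_Cmod, is_lim_seq_le_le with (fun _ => 0) (fun k => sqrt (g k)); [|apply is_lim_seq_const|exact Lg].
  intros k; split; [apply Cmod_ge_0|]; apply Hle; [apply Cmod_ge_0|].
  unfold Cminus; rewrite Cmod2_plus, Cmod_opp, Cmod_1; unfold g.
  replace (Re (Cconj (e k) * - (1))%C) with (- Re (e k)) by (unfold Re, Cconj, Cmult; simpl; ring).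
  assert (K := He1 k); assert (K1 := Cmod_ge_0 (e k)); nra. }
assert (LY : clim Y 0%C).
{ apply clim_of_Cmod, is_lim_seq_le_le with (fun _ => 0) (fun k => / (1 - Cmod z) * sqrt (g k)).
  - intros k; split; [apply Cmod_ge_0|].
    replace (Y k - 0)%C with (Y k) by ring.
    apply Rmult_le_reg_l with (1 - Cmod z); [lra|].
    rewrite <- Rmult_assoc, Rinv_r, Rmult_1_l by lra.
    apply Hle; [apply Rmult_le_pos; [lra|apply Cmod_ge_0]|].
    rewrite Rpow_mult_distr; destruct (Hb1 k) as [_ K]; fold (e k) in K; fold (Y k) in K.
    apply Rle_trans with (1 := K); unfold g.
    assert (K0 := He1 k); assert (K1 := Cmod_ge_0 (e k)); assert (K2 := Re_le_Cmod (e k)); nra.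
  - apply is_lim_seq_const.
  - replace (Finite 0) with (Finite (/ (1 - Cmod z) * 0)) by (f_equal; ring).
    apply is_lim_seq_mult'; [apply is_lim_seq_const|exact Lg]. }
assert (LS : clim (fun k => schwarz (d k) z) 0%C).
{ apply clim_of_Cmod, is_lim_seq_le_le with (fun _ => 0) (fun k => 2 / (1 - Cmod z) * mean (fun x => Rabs (d k x))).
  - intros k; split; [apply Cmod_ge_0|].
    replace (schwarz (d k) z - 0)%C with (schwarz (d k) z) by ring.
    apply Cmod_schwarz_le; [|exact Hz]; intros x; unfold d; ucont.
  - apply is_lim_seq_const.
  - replace (Finite 0) with (Finite (2 / (1 - Cmod z) * 0)) by (f_equal; ring).
    apply is_lim_seq_mult'; [apply is_lim_seq_const|exact mean_dist_limit]. }
assert (LaC := clim_RtoC _ _ La).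
assert (Hfc : continuous f z).
{ destruct (chol_in_disc f Hf z Hz) as [K _]; exact (cderiv_continuous _ _ _ K). }
assert (Lrz : clim (fun k => r k * z)%C z).
{ assert (K : clim (fun k => r k * z)%C (1 * z)%C) by (apply clim_mult; [now apply clim_RtoC|apply clim_const]).
  now rewrite Cmult_1_l in K. }
assert (LX := clim_comp f _ _ Hfc Lrz).
assert (LE : clim (fun k => Cexp (- schwarz (d k) z)) (Cexp (- 0))).
{ apply (clim_comp Cexp); [apply (continuous_Cexp (fun w => w)), continuous_id|now apply clim_opp]. }
assert (LY' : clim Y (f z * Cexp (- outer_exponent p sigma c z) * Cexp (- 0) * (1 + RtoC (t / As) * z) - RtoC (t / As) - 1 * z)%C).
{ unfold Y; apply clim_plus; [apply clim_plus|apply clim_opp, clim_mult; [exact Le|apply clim_const]].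
  - apply clim_mult; [apply clim_mult; [apply clim_mult; [exact LX|apply clim_const]|exact LE]|].
    apply clim_plus; [apply clim_const|apply clim_mult; [exact LaC|apply clim_const]].
  - now apply clim_opp. }
assert (E := clim_unique _ _ _ LY' LY).
replace (- 0)%C with (RtoC 0) in E by ring; rewrite Cexp_0, Cexp_opp in E.
set (G := Cexp (outer_exponent p sigma c z)) in *.
assert (HG : G <> 0%C) by apply Cexp_neq0.
fold As.
replace (f z * (1 + RtoC (t / As) * z))%C with
  ((f z * / G * 1 * (1 + RtoC (t / As) * z) - RtoC (t / As) - 1 * z) * G + (RtoC (t / As) + z) * G)%C by (field; exact HG).
rewrite E; ring.
Qed.

End Limit.

(* On the disc this is [f_alpha] when [t = s * profile p s], and [f_beta] when [t = profile p s]. *)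
Definition Kfun (p t s : R) (z : C) : C :=
  ((RtoC (t / profile p s) + z) / (1 + RtoC (t / profile p s) * z) *
   (RtoC (profile p s) * Cpowr (1 + s * z) (2 / p)))%C.

Lemma Cexp_outer_exponent (p s : R) (z : C) : 0 < p ->
  Cexp (outer_exponent p s (p * ln (profile p s)) z) = (RtoC (profile p s) * Cpowr (1 + s * z) (2 / p))%C.
Proof.
intros Hp; unfold outer_exponent; rewrite Cexp_plus, Cexp_RtoC, <- Cpowr_Cexp.
replace (p * ln (profile p s) / p) with (ln (profile p s)) by (field; lra).
now rewrite exp_ln by apply profile_pos.
Qed.

Lemma one_plus_neq0 (a : R) (z : C) : 0 <= a <= 1 -> Cmod z < 1 -> (1 + a * z)%C <> 0%C.
Proof.
intros Ha Hz E.
assert (K : Cmod (- (1)) = Cmod (a * z)) by (f_equal; rewrite <- (Cplus_0_r (- (1))), <- E; ring).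
rewrite Cmod_opp, Cmod_1, Cmod_mult, Cmod_R, Rabs_pos_eq in K by lra.
assert (H0 := Cmod_ge_0 z); nra.
Qed.

(** One statement for two uses: applied to a function whose derivative would exceed [M] it gives the
    upper bound, applied to an extremal it identifies the function. The squeeze is
    [D <= objective p t sigma <= M <= D] at a cluster point sigma. *)
Theorem extremal_limit (p t M : R) (f : C -> C) : 0 < p < 1 -> 0 <= t <= 1 -> admissible p t f ->
  (forall s, 0 <= s -> t <= profile p s -> objective p t s <= M) ->
  M <= Re (C_derive f 0) ->
  Re (C_derive f 0) = M /\ exists sigma, 0 <= sigma /\ t <= profile p sigma /\ objective p t sigma = M /\
   (sigma < 1 -> eq_on_disc f (Kfun p t sigma)).
Proof.
intros Hp Ht Hadm Hopt HM.
assert (Hf : analytic_in_disc f) by apply Hadm.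
assert (Hf0 : f 0%C = t) by apply Hadm.
set (D := Re (C_derive f 0)) in *.
assert (Hn2 : forall n, 0 < / (INR n + 2) < 1).
{ intros n; assert (K := pos_INR n); split; [apply Rinv_0_lt_compat; lra|].
  rewrite <- Rinv_1; apply Rinv_lt_contravar; lra. }
destruct (functional_choice (fun (n : nat) (q : R * (R -> R)) =>
   (1 - / (INR n + 2) < fst q < 1 /\ 0 < fst q /\
   (forall x, continuous (snd q) x) /\ snd q (2 * PI) = snd q 0 /\
   (forall x, Cmod (f (fst q * cis x)%C) <= exp (snd q x))) /\
   mean (fun x => exp (p * snd q x)) <= 1 + / (INR n + 2) /\
   (exp (mean (snd q)) <= Rpower (1 + / (INR n + 2)) (1 / p) * profile p (Rmax 0 (p * mean (fun x => snd q x * cos x))) /\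
   t <= exp (mean (snd q)) /\
   fst q * D <= exp (mean (snd q)) - t ^ 2 / exp (mean (snd q)) + 2 / p * t * (p * mean (fun x => snd q x * cos x)))))
  as [g Hg].
{ intros n; destruct (majorant_data p t (/ (INR n + 2)) f Hp (proj1 Ht) Hadm (Hn2 n)) as (r & u & H).
  now exists (r, u). }
set (sp := fun n => Rmax 0 (p * mean (fun x => snd (g n) x * cos x))).
(* A lower bound for [exp (mean u)] bounds the cosine coefficient from above, as [profile] decreases
   to 0. It is [t] itself when [t > 0]; for [t = 0] it is [r * D >= 1/2], because
   [D >= M >= objective p 0 0 = 1]. *)
assert (Hlow : exists a0, 0 < a0 /\ forall n, a0 <= exp (mean (snd (g n)))).
{ destruct (proj1 Ht) as [Ht0|Ht0].
  - exists t; split; [exact Ht0|]; intros n; apply Hg.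
  - exists (1 / 2); split; [lra|]; intros n.
    destruct (Hg n) as ((H1 & _) & _ & (_ & _ & H2)).
    rewrite <- Ht0 in H2; unfold Rdiv in H2; rewrite pow_i, Rmult_0_r, !Rmult_0_l in H2 by lia.
    assert (K := Hopt 0 (Rle_refl 0)); rewrite profile_0 in K; specialize (K ltac:(lra)).
    unfold objective in K; rewrite profile_0, <- Ht0 in K.
    assert (K2 : / (INR n + 2) <= / 2) by (apply Rinv_le_contravar; [lra|assert (Q := pos_INR n); lra]).
    assert (K3 : 1 <= D) by lra.
    assert (1 / 2 * 1 <= fst (g n) * D) by (apply Rmult_le_compat; lra); lra. }
destruct Hlow as (a0 & Ha0 & Hlow).
assert (Hpow2 : forall n, Rpower (1 + / (INR n + 2)) (1 / p) <= Rpower 2 (1 / p)).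
{ intros n; apply Rpower_le_base; [specialize (Hn2 n); lra|apply Rlt_le, Rdiv_lt_0_compat; lra]. }
set (k2 := Rpower 2 (1 / p)) in *.
assert (Hk2 : 0 < k2) by apply exp_pos.
assert (Hc0 : 0 < Rmin 1 (a0 / k2) <= 1).
{ split; [apply Rmin_pos; [lra|now apply Rdiv_lt_0_compat]|apply Rmin_l]. }
(* From [a0 <= k2 * profile p (sp n)] one gets [profile p S <= profile p (sp n)], hence [sp n <= S];
   the cap 1 keeps the equation for [S] solvable. *)
destruct (profile_solution p _ ltac:(lra) Hc0) as (S & HS0 & HS).
assert (Hsp : forall n, 0 <= sp n <= S).
{ intros n; split; [apply Rmax_l|].
  apply (feasible_le p (Rmin 1 (a0 / k2)) (sp n) S); try assumption; [lra|apply Rmax_l|].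
  apply Rle_trans with (1 := Rmin_r _ _), Rle_div_l; [exact Hk2|].
  destruct (Hg n) as (_ & _ & (H1 & _)); fold (sp n) in H1; specialize (Hlow n); specialize (Hpow2 n).
  assert (K := profile_pos p (sp n)); nra. }
destruct (bounded_cluster_point sp 0 S Hsp) as [sigma Hsigma].
destruct (functional_choice (fun k n => (k <= n)%nat /\ Rabs (sp n - sigma) < / (INR k + 1))) as [phi Hphi].
{ intros k; apply Hsigma; apply Rinv_0_lt_compat; assert (K := pos_INR k); lra. }
set (r := fun k => fst (g (phi k))).
set (u := fun k => snd (g (phi k))).
set (eta := fun k => / (INR (phi k) + 2)).
set (A := fun k => exp (mean (u k))).
set (s := fun k => p * mean (fun x => u k x * cos x)).
assert (Ls : is_lim_seq (fun k => sp (phi k)) sigma).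
{ apply is_lim_seq_le_le with (fun k => sigma - / (INR k + 1)) (fun k => sigma + / (INR k + 1)).
  - intros k; destruct (Hphi k) as [_ K]; apply Rabs_def2 in K; lra.
  - replace (Finite sigma) with (Finite (sigma - 0)) by (f_equal; ring).
    apply is_lim_seq_minus_R; [apply is_lim_seq_const|apply is_lim_seq_inv_shift].
  - replace (Finite sigma) with (Finite (sigma + 0)) by (f_equal; ring).
    apply is_lim_seq_plus'; [apply is_lim_seq_const|apply is_lim_seq_inv_shift]. }
assert (Leta : is_lim_seq eta 0).
{ apply is_lim_seq_le_le with (fun _ => 0) (fun k => / (INR k + 1)); [|apply is_lim_seq_const|apply is_lim_seq_inv_shift].
  intros k; split; [left; apply Hn2|]; unfold eta.
  destruct (Hphi k) as [K _]; apply le_INR in K; assert (K0 := pos_INR k).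
  apply Rinv_le_contravar; lra. }
assert (Lr : is_lim_seq r 1).
{ apply is_lim_seq_le_le with (fun k => 1 - eta k) (fun _ => 1).
  - intros k; destruct (Hg (phi k)) as ((K & _) & _); unfold eta, r; lra.
  - replace (Finite 1) with (Finite (1 - 0)) by (f_equal; ring).
    apply is_lim_seq_minus_R; [apply is_lim_seq_const|exact Leta].
  - apply is_lim_seq_const. }
assert (HAs := profile_pos p sigma).
set (P := fun k => Rpower (1 + eta k) (1 / p) * profile p (sp (phi k))).
assert (LP : is_lim_seq P (profile p sigma)).
{ replace (Finite (profile p sigma)) with (Finite (1 * profile p sigma)) by (f_equal; ring).
  apply is_lim_seq_mult'.
  - replace 1 with (Rpower (1 + 0) (1 / p)) at 1 by (rewrite Rplus_0_r; apply Rpower_base_1).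
    apply (is_lim_seq_comp_continuous (fun x => Rpower (1 + x) (1 / p)) eta 0); [|exact Leta].
    unfold Rpower; cont; lra.
  - apply is_lim_seq_comp_continuous; [apply continuous_profile|exact Ls]. }
assert (HA : forall k, 0 < A k /\ A k <= P k /\ t <= A k /\
   r k * D <= A k - t ^ 2 / A k + 2 / p * t * s k /\ s k <= sp (phi k)).
{ intros k; destruct (Hg (phi k)) as (_ & _ & (H1 & H2 & H3)).
  repeat split; [apply exp_pos|exact H1|exact H2|exact H3|apply Rmax_r]. }
assert (Hs0 : 0 <= sigma).
{ apply (is_lim_seq_le (fun _ => 0) (fun k => sp (phi k)) 0 sigma); [intros; apply Hsp|apply is_lim_seq_const|exact Ls]. }
assert (Hfeas : t <= profile p sigma).
{ apply (is_lim_seq_le (fun _ => t) P t (profile p sigma)); [|apply is_lim_seq_const|exact LP].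
  intros k; destruct (HA k) as (_ & K1 & K2 & _); lra. }
set (O := fun k => P k - t ^ 2 / P k + 2 / p * t * sp (phi k)).
assert (LO : is_lim_seq O (objective p t sigma)).
{ unfold objective; apply is_lim_seq_plus'.
  - apply is_lim_seq_minus_R; [exact LP|]; apply is_lim_seq_div_R; [lra|apply is_lim_seq_const|exact LP].
  - apply is_lim_seq_mult'; [apply is_lim_seq_const|exact Ls]. }
assert (LrD : is_lim_seq (fun k => r k * D) D).
{ replace (Finite D) with (Finite (1 * D)) by (f_equal; ring).
  apply is_lim_seq_mult'; [exact Lr|apply is_lim_seq_const]. }
assert (H2p : 0 < 2 / p) by (apply Rdiv_lt_0_compat; lra).
(* The terms [- t^2 / A] and [2 / p * t * s] can only grow when [A] and [s] are replaced by [P] and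
   [sp]. So the gap in the objective bounds the gap [P - A], and its limit 0 makes [A] converge to
   the limit of [P]. *)
assert (HPA : forall k, P k - A k <= O k - r k * D).
{ intros k; destruct (HA k) as (K0 & K1 & K2 & K3 & K4); unfold O.
  assert (t ^ 2 / P k <= t ^ 2 / A k).
  { apply Rmult_le_compat_l; [apply pow2_ge_0|apply Rinv_le_contravar; assumption]. }
  assert (2 / p * t * s k <= 2 / p * t * sp (phi k)).
  { apply Rmult_le_compat_l; [apply Rmult_le_pos; lra|exact K4]. }
  lra. }
assert (LOD : is_lim_seq (fun k => O k - r k * D) (objective p t sigma - D)) by now apply is_lim_seq_minus_R.
assert (HDle : 0 <= objective p t sigma - D).
{ apply (is_lim_seq_le (fun _ => 0) (fun k => O k - r k * D) 0 (objective p t sigma - D)); [|apply is_lim_seq_const|exact LOD].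
  intros k; specialize (HPA k); destruct (HA k) as (_ & K1 & _); lra. }
assert (HoM := Hopt sigma Hs0 Hfeas).
assert (ED : D = M) by lra.
assert (EO : objective p t sigma = D) by lra.
split; [exact ED|]; exists sigma; split; [exact Hs0|split; [exact Hfeas|split; [lra|]]].
intros Hs1 z Hz; unfold in_disc in Hz.
assert (LA : is_lim_seq A (profile p sigma)).
{ apply is_lim_seq_le_le with (fun k => P k - (O k - r k * D)) P; [|  |exact LP].
  - intros k; specialize (HPA k); destruct (HA k) as (_ & K1 & _); lra.
  - replace (Finite (profile p sigma)) with (Finite (profile p sigma - (objective p t sigma - D))) by (f_equal; lra).
    now apply is_lim_seq_minus_R. }
assert (Lts : is_lim_seq (fun k => t * s k) (t * sigma)).
{ apply is_lim_seq_le_le with (fun k => p / 2 * (r k * D - (A k - t ^ 2 / A k))) (fun k => t * sp (phi k)).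
  - intros k; destruct (HA k) as (K0 & K1 & K2 & K3 & K4); split; [|apply Rmult_le_compat_l; lra].
    replace (t * s k) with (p / 2 * (2 / p * t * s k)) by (field; lra).
    apply Rmult_le_compat_l; lra.
  - replace (t * sigma) with (p / 2 * (D - (profile p sigma - t ^ 2 / profile p sigma)))
      by (rewrite <- EO; unfold objective; field; split; lra).
    apply is_lim_seq_mult'; [apply is_lim_seq_const|].
    apply is_lim_seq_minus_R; [exact LrD|].
    apply is_lim_seq_minus_R; [exact LA|]; apply is_lim_seq_div_R; [lra|apply is_lim_seq_const|exact LA].
  - apply is_lim_seq_mult'; [apply is_lim_seq_const|exact Ls]. }
(* For [t > 0], dividing the previous limit by [t] gives the convergence of [s]. For [t = 0] the
   objective is [profile], whose maximality forces [sigma = 0]. *)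
assert (Lss : is_lim_seq (fun k => sigma * s k) (sigma * sigma)).
{ destruct (proj1 Ht) as [Ht0|Ht0].
  - apply is_lim_seq_mult'; [apply is_lim_seq_const|].
    apply is_lim_seq_ext with (fun k => t * s k / t); [intros; field; lra|].
    replace sigma with (t * sigma / t) by (field; lra).
    apply is_lim_seq_div_R; [lra|exact Lts|apply is_lim_seq_const].
  - assert (E0 : sigma = 0).
    { destruct Hs0 as [Hs0|Hs0]; [exfalso|now symmetry].
      assert (K := profile_decreasing p 0 sigma ltac:(lra) ltac:(lra)); rewrite profile_0 in K.
      assert (K2 := Hopt 0 (Rle_refl 0)); rewrite profile_0 in K2; specialize (K2 ltac:(lra)).
      rewrite <- ED, <- EO in K2; unfold objective in K2; rewrite profile_0, <- Ht0 in K2.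
      unfold Rdiv in K2; rewrite pow_i, !Rmult_0_r, !Rmult_0_l in K2 by lia; lra. }
    rewrite E0; apply is_lim_seq_ext with (fun _ => 0); [intros; ring|rewrite Rmult_0_l; apply is_lim_seq_const]. }
assert (I := limit_identity p t sigma D f r eta u Hp (proj1 Ht) Hf Hf0 eq_refl).
specialize (I ltac:(intros k; destruct (Hg (phi k)) as ((K1 & K2 & _) & _); unfold r; lra)).
specialize (I ltac:(intros k; apply (Hg (phi k))) ltac:(intros k; apply (Hg (phi k))) ltac:(intros k; apply (Hg (phi k)))).
specialize (I ltac:(intros k; apply (Hg (phi k))) Leta Lr LA Lts Lss (eq_sym EO) (conj Hs0 Hs1) z Hz).
rewrite Cexp_outer_exponent in I by lra.
unfold Kfun.
assert (Hr1 : 0 <= t / profile p sigma <= 1).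
{ split; [apply Rdiv_le_0_compat; lra|apply Rle_div_l; lra]. }
assert (Hne := one_plus_neq0 _ z Hr1 Hz).
set (a := t / profile p sigma) in *.
replace (f z) with (f z * (1 + a * z) / (1 + a * z))%C by (field; exact Hne).
rewrite I; field; exact Hne.
Qed.

(** * The extremal functions *)

Lemma admissible_iff (p t : R) (f : C -> C) : 0 < p ->
  admissible p t f <->
  analytic_in_disc f /\ (exists L, is_mean_limit p f L /\ L <= 1) /\ f 0%C = t.
Proof.
intros Hp; split.
- intros H; split; [apply H|split; [now apply (admissible_mean_limit p t)|apply H]].
- intros (Hf & (L & HL & HL1) & Hf0); split; [split; [exact Hf|now exists L]|split; [|exact Hf0]].
  unfold Hp_norm; rewrite (is_mean_limit_iota p f L HL).
  destruct (Rlt_le_dec 0 L) as [H|H].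
  + rewrite Rpow_nn_pos by exact H; rewrite <- (Rpower_base_1 (/ p)); apply Rpower_le_base; [lra|].
    apply Rlt_le, Rinv_0_lt_compat, Hp.
  + unfold Rpow_nn; destruct (Rlt_dec 0 L); lra.
Qed.

Lemma chol_ext_disk (F G F' : C -> C) (r : R) : (forall z, disk r z -> F z = G z) ->
  chol (disk r) F F' -> chol (disk r) G F'.
Proof.
intros H HF z Hz; destruct (HF z Hz) as [H1 H2]; split; [|exact H2].
apply (cderiv_ext_loc F); [|exact H1].
exact (filter_imp _ _ H (disk_open r z Hz)).
Qed.

Lemma at_left_1_pos : at_left 1 (fun r => 0 < r < 1).
Proof.
exists (mkposreal 1 Rlt_0_1); intros r Hr Hlt; simpl in Hr.
apply Rabs_def2 in Hr; unfold minus, plus, opp in Hr; simpl in Hr; lra.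
Qed.

Lemma Cmod_circle (r t : R) : 0 < r -> Cmod (r * cis t) = r.
Proof. intros Hr; rewrite Cmod_mult, Cmod_cis, Cmod_R, Rabs_pos_eq; lra. Qed.

Lemma admissible_ext (p t : R) (f g : C -> C) : 0 < p -> eq_on_disc f g -> admissible p t f -> admissible p t g.
Proof.
intros Hp E H; apply admissible_iff in H; [|exact Hp]; destruct H as (Hf & (L & HL & HL1) & Hf0).
apply admissible_iff; [exact Hp|split; [|split]].
- intros z Hz; apply (analytic_of_chol g (C_derive f) 1); [|exact Hz].
  now apply (chol_ext_disk f); [|apply chol_in_disc].
- exists L; split; [|exact HL1]; unfold is_mean_limit.
  apply (filterlim_ext_loc (circle_mean p f)); [|exact HL].
  refine (filter_imp _ _ _ at_left_1_pos); intros r Hr; rewrite !circle_mean_eq.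
  apply mean_ext; intros x; rewrite E; [reflexivity|].
  unfold in_disc; rewrite Cmod_circle; lra.
- rewrite <- E; [exact Hf0|unfold in_disc; rewrite Cmod_0; lra].
Qed.

Lemma C_derive_ext (f g : C -> C) : eq_on_disc f g -> analytic_in_disc f -> C_derive f 0 = C_derive g 0.
Proof.
intros E Hf; symmetry; apply C_derive_cderiv.
apply (chol_ext_disk f g (C_derive f) 1 E (chol_in_disc f Hf)); unfold disk; rewrite Cmod_0; lra.
Qed.

Lemma extremal_ext (p t : R) (f g : C -> C) : 0 < p -> eq_on_disc f g -> extremal p t f -> extremal p t g.
Proof.
intros Hp E [H1 H2]; split; [now apply (admissible_ext p t f)|].
rewrite <- (C_derive_ext f g E); [exact H2|apply H1].
Qed.

Lemma chol_inv (D : C -> Prop) (F F' : C -> C) : (forall z, D z -> F z <> 0%C) -> chol D F F' ->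
  chol D (fun z => / F z)%C (fun z => - (F' z / (F z * F z)))%C.
Proof.
intros H0 HF z Hz; destruct (HF z Hz) as [H1 H2]; specialize (H0 z Hz).
assert (H3 := cderiv_continuous _ _ _ H1); split.
- apply (cderiv_eq _ _ (- / (F z * F z) * F' z)%C); [|cfield; exact H0].
  now apply (cderiv_comp Cinv F); [apply cderiv_inv|].
- cont; now apply Cmult_neq_0.
Qed.

Lemma blaschke_modulus (a : R) (z : C) :
  Cmod (a + z) ^ 2 = Cmod (1 + a * z) ^ 2 - (1 - a ^ 2) * (1 - Cmod z ^ 2).
Proof. rewrite !Cmod2_alt; destruct z as [x y]; unfold Re, Im; simpl; ring. Qed.

(** The defect of the squared modulus is [(1 - a^2) (1 - |z|^2) / |1 + a z|^2], and
    [|1 + a z| >= 1 - a] gives [k = (1 + a) / (1 - a)]. For [a = 1], the value occurring in the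
    second family of extremals, the quotient is identically 1 and [k = 0]. *)
Lemma blaschke_lower (a : R) : 0 <= a <= 1 -> exists k, 0 <= k /\ forall z, Cmod z < 1 ->
  1 - k * (1 - Cmod z ^ 2) <= Cmod ((a + z) / (1 + a * z)) ^ 2 <= 1.
Proof.
intros Ha.
assert (Hk : exists k, 0 <= k /\ 1 - a ^ 2 <= k * (1 - a) ^ 2).
{ destruct (Req_dec a 1) as [->|N]; [exists 0; lra|].
  exists ((1 + a) / (1 - a)); split; [apply Rdiv_le_0_compat; lra|].
  right; field; lra. }
destruct Hk as (k & Hk0 & Hk); exists k; split; [exact Hk0|]; intros z Hz.
assert (Hne := one_plus_neq0 a z Ha Hz).
assert (Hp := proj1 (Cmod_gt_0 _) Hne).
assert (E := blaschke_modulus a z); assert (Hz0 := Cmod_ge_0 z).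
assert (Hlow : 1 - a <= Cmod (1 + a * z)).
{ assert (K := Cmod_minus_ge 1 (- (a * z))); rewrite Cmod_1, Cmod_opp, Cmod_mult, Cmod_R, Rabs_pos_eq in K by lra.
  replace (1 - - (a * z))%C with (1 + a * z)%C in K by ring; nra. }
rewrite Cmod_div by exact Hne; unfold Rdiv; rewrite Rpow_mult_distr, pow_inv, E.
assert (Hp2 : 0 < Cmod (1 + a * z) ^ 2) by nra.
assert (Hq : 0 <= 1 - Cmod z ^ 2) by nra.
split.
- apply Rle_div_r; [exact Hp2|].
  assert ((1 - a) ^ 2 <= Cmod (1 + a * z) ^ 2) by (apply pow_incr; lra).
  assert (k * (1 - a) ^ 2 <= k * Cmod (1 + a * z) ^ 2) by (now apply Rmult_le_compat_l).
  nra.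
- apply Rle_div_l; [exact Hp2|].
  assert (0 <= (1 - a ^ 2) * (1 - Cmod z ^ 2)) by (apply Rmult_le_pos; nra); lra.
Qed.

Lemma Cmod_Cpowr (z : C) (s : R) : z <> 0%C -> Cmod (Cpowr z s) = Rpower (Cmod z) s.
Proof. intros Hz; rewrite Cpowr_Cexp, Cmod_Cexp, re_scal_l; reflexivity. Qed.

Lemma chol_Kfun (p t s : R) : 0 < p -> 0 <= t <= profile p s -> 0 <= s <= 1 ->
  exists K', chol (disk 1) (Kfun p t s) K' /\ K' 0%C = RtoC (objective p t s).
Proof.
intros Hp Ht Hs; assert (HA := profile_pos p s).
set (a := t / profile p s).
assert (Ha : 0 <= a <= 1) by (split; [apply Rdiv_le_0_compat; lra|apply Rle_div_l; lra]).
assert (H1 := chol_affine (disk 1) a 1).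
assert (H2 := chol_inv (disk 1) _ _ (fun z Hz => one_plus_neq0 a z Ha Hz) (chol_affine (disk 1) 1 a)).
assert (H3 := chol_Cexp _ _ _ (chol_mult _ _ _ _ _ (chol_affine (disk 1) (RtoC (2 / p)) 0) (chol_log1p s 1 (proj1 Hs) ltac:(lra)))).
assert (H4 := chol_mult _ _ _ _ _ (chol_affine (disk 1) (RtoC (profile p s)) 0) H3).
assert (H5 := chol_mult _ _ _ _ _ (chol_mult _ _ _ _ _ H1 H2) H4).
cbv beta in H5.
match type of H5 with chol _ ?X ?Y => exists Y; split; [apply (chol_ext_disk X)|] end.
- intros z Hz; unfold Kfun; fold a; rewrite Cpowr_Cexp.
  replace (RtoC (2 / p) + 0 * z)%C with (RtoC (2 / p)) by ring.
  unfold Cdiv; ring.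
- exact H5.
- replace (1 + s * 0)%C with (RtoC 1) by ring; rewrite Clog_1.
  replace ((RtoC (2 / p) + 0 * 0) * 0)%C with (RtoC 0) by ring; rewrite Cexp_0.
  replace (objective p t s) with (profile p s * (1 - a * a + a * (2 / p * s)))
    by (unfold objective, a; field; split; lra).
  rewrite !RtoC_mult, RtoC_plus, RtoC_minus, !RtoC_mult; field.
Qed.

Lemma Kfun_0 (p t s : R) : Kfun p t s 0 = t.
Proof.
assert (HA := profile_pos p s).
unfold Kfun; replace (1 + s * 0)%C with (RtoC 1) by ring.
rewrite Cpowr_Cexp, Clog_1.
replace (RtoC (2 / p) * 0)%C with (RtoC 0) by ring; rewrite Cexp_0.
replace t with (t / profile p s * profile p s) at 3 by (field; lra).
rewrite RtoC_mult; field.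
Qed.

Lemma Kfun_modulus (p t s : R) (z : C) : 0 < p -> 0 <= s <= 1 -> Cmod z < 1 ->
  Cmod (Kfun p t s z) = Cmod ((RtoC (t / profile p s) + z) / (1 + RtoC (t / profile p s) * z)) *
    Rpower (Cmod (1 + s * z) ^ 2 / (1 + s ^ 2)) (1 / p).
Proof.
intros Hp Hs Hz; assert (HA := profile_pos p s).
assert (Hne := one_plus_neq0 s z Hs Hz); assert (Hpos := proj1 (Cmod_gt_0 _) Hne).
unfold Kfun; rewrite Cmod_mult; f_equal.
rewrite Cmod_mult, Cmod_R, Rabs_pos_eq, Cmod_Cpowr by (try exact Hne; lra).
assert (H1 := one_plus_sqr_pos s).
unfold Rdiv; rewrite <- Rpower_mult_distr by (try apply Rinv_0_lt_compat; nra).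
rewrite <- (Rpower_pow 2) by exact Hpos; rewrite Rpower_mult.
unfold profile, Rpower; rewrite ln_Rinv by exact H1.
rewrite Rmult_comm; f_equal; f_equal; simpl; unfold Rdiv; ring.
Qed.

(** The power [p] of the outer modulus is [|1 + s z|^2 / (1 + s^2)], whose mean [h r] is explicit.
    The Blaschke factor lies between 1 and a bound tending to 1 uniformly on the circle, so the
    means are squeezed. *)
Lemma mean_limit_Kfun (p t s : R) : 0 < p -> 0 <= t <= profile p s -> 0 <= s <= 1 ->
  is_mean_limit p (Kfun p t s) 1.
Proof.
intros Hp Ht Hs; assert (HA := profile_pos p s).
set (a := t / profile p s).
assert (Ha : 0 <= a <= 1) by (split; [apply Rdiv_le_0_compat; lra|apply Rle_div_l; lra]).
destruct (blaschke_lower a Ha) as (k & Hk & HB).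
assert (H1 := one_plus_sqr_pos s).
set (h := fun r => (1 + (s * r) ^ 2) / (1 + s ^ 2)).
destruct (chol_Kfun p t s Hp Ht Hs) as (K' & HK & _).
assert (Hpt : forall r x, 0 < r < 1 ->
   Rpow_nn (1 - k * (1 - r ^ 2)) (p / 2) * (Cmod (1 + s * (r * cis x)) ^ 2 / (1 + s ^ 2))
    <= Rpow_nn (Cmod (Kfun p t s (r * cis x))) p <= Cmod (1 + s * (r * cis x)) ^ 2 / (1 + s ^ 2)).
{ intros r x Hr.
  assert (Hz : Cmod (r * cis x) < 1) by (rewrite Cmod_circle; lra).
  specialize (HB _ Hz); rewrite Cmod_circle in HB by lra.
  rewrite Kfun_modulus by assumption; fold a.
  assert (Hne := one_plus_neq0 s _ Hs Hz); assert (Hpos := proj1 (Cmod_gt_0 _) Hne).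
  set (b := Cmod ((a + r * cis x) / (1 + a * (r * cis x)))) in *.
  set (w := Cmod (1 + s * (r * cis x)) ^ 2 / (1 + s ^ 2)).
  assert (Hw : 0 < w) by (apply Rdiv_lt_0_compat; nra).
  assert (Hb : 0 <= b) by apply Cmod_ge_0.
  assert (E : Rpow_nn (b * Rpower w (1 / p)) p = Rpow_nn (b ^ 2) (p / 2) * w).
  { assert (Ew : 0 < Rpower w (1 / p)) by apply exp_pos.
    destruct Hb as [Hb|<-].
    - rewrite !Rpow_nn_pos by nra; rewrite <- Rpower_mult_distr, Rpower_mult by assumption.
      replace (1 / p * p) with 1 by (field; lra); rewrite Rpower_1 by exact Hw; f_equal.
      rewrite <- (Rpower_pow 2 b Hb), Rpower_mult; f_equal; simpl; field.
    - rewrite pow_i, Rmult_0_l, !Rpow_nn_0 by lia; ring. }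
  rewrite E; split.
  - apply Rmult_le_compat_r; [lra|].
    destruct (Rlt_le_dec 0 (1 - k * (1 - r ^ 2))) as [Q|Q].
    + apply Rpow_nn_le; lra.
    + unfold Rpow_nn at 1; destruct (Rlt_dec 0 (1 - k * (1 - r ^ 2))); [lra|apply Rpow_nn_ge_0].
  - rewrite <- (Rmult_1_l w) at 2; apply Rmult_le_compat_r; [lra|].
    apply Rle_trans with (Rpow_nn 1 (p / 2)).
    + apply Rpow_nn_le; [split; [apply pow2_ge_0|]|]; lra.
    + rewrite Rpow_nn_pos, Rpower_base_1; lra. }
assert (Hmean : forall r, 0 < r < 1 ->
   Rpow_nn (1 - k * (1 - r ^ 2)) (p / 2) * h r <= circle_mean p (Kfun p t s) r <= h r).
{ intros r Hr.
  assert (Hh : mean (fun x => Cmod (1 + s * (r * cis x)) ^ 2 / (1 + s ^ 2)) = h r).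
  { unfold h, Rdiv; rewrite <- (mean_Cmod2_affine (s * r)), (Rmult_comm (mean _)), <- mean_scal by (intros; cont).
    apply mean_ext; intros x; rewrite RtoC_mult, Cmult_assoc; ring. }
  assert (Hc : forall x, continuous (fun x => Rpow_nn (Cmod (Kfun p t s (r * cis x))) p) x).
  { intros x; apply continuous_Rpow_nn; [exact Hp|apply Cmod_ge_0|]; cont.
    apply (continuous_comp (fun x => r * cis x)%C (Kfun p t s)); [cont|].
    destruct (HK (r * cis x)%C) as [K _]; [unfold disk; rewrite Cmod_circle; lra|].
    exact (cderiv_continuous _ _ _ K). }
  rewrite circle_mean_eq; split.
  - rewrite <- Hh, <- mean_scal by (intros; cont; lra).
    apply mean_le; intros x; [cont; lra|apply Hc|intros _; now apply Hpt].
  - rewrite <- Hh; apply mean_le; intros x; [apply Hc|cont; lra|intros _; now apply Hpt]. }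
assert (Hleft : forall g : R -> R, continuous g 1 -> filterlim g (at_left 1) (locally (g 1))).
{ intros g Hg P HP; destruct (Hg P HP) as [e He]; exists e; intros y Hy _; exact (He y Hy). }
unfold is_mean_limit.
assert (Eh : h 1 = 1) by (unfold h; field; lra).
assert (Ch : continuous h 1) by (unfold h; cont; lra).
assert (El : Rpow_nn (1 - k * (1 - 1 ^ 2)) (p / 2) * h 1 = 1).
{ rewrite Eh; replace (1 - k * (1 - 1 ^ 2)) with 1 by ring; rewrite Rpow_nn_pos, Rpower_base_1; lra. }
apply (filterlim_le_le (fun r => Rpow_nn (1 - k * (1 - r ^ 2)) (p / 2) * h r) (circle_mean p (Kfun p t s)) h 1).
- refine (filter_imp _ _ _ at_left_1_pos); exact Hmean.
- change (Rbar_locally 1) with (locally 1).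
  rewrite <- El at 2; apply (Hleft (fun r => Rpow_nn (1 - k * (1 - r ^ 2)) (p / 2) * h r)).
  cont; apply continuous_Rpow_nn; [lra|lra|cont].
- change (Rbar_locally 1) with (locally 1).
  rewrite <- Eh at 2; now apply Hleft.
Qed.

Lemma Kfun_admissible (p t s : R) : 0 < p -> 0 <= t <= profile p s -> 0 <= s <= 1 ->
  admissible p t (Kfun p t s) /\ C_derive (Kfun p t s) 0 = RtoC (objective p t s).
Proof.
intros Hp Ht Hs; destruct (chol_Kfun p t s Hp Ht Hs) as (K' & HK & HK0).
split.
- apply admissible_iff; [exact Hp|split; [|split; [|apply Kfun_0]]].
  + intros z Hz; exact (analytic_of_chol _ _ 1 z HK Hz).
  + exists 1; split; [now apply mean_limit_Kfun|lra].
- apply C_derive_cderiv; rewrite <- HK0; apply HK; unfold disk; rewrite Cmod_0; lra.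
Qed.

Lemma f_alpha_eq (p t a : R) (z : C) : t = a * profile p a -> Kfun p t a z = f_alpha p a z.
Proof.
intros ->; assert (HA := profile_pos p a); unfold Kfun, f_alpha.
replace (a * profile p a / profile p a) with a by (field; lra).
unfold profile; rewrite Rpower_Ropp, RtoC_inv by apply Rgt_not_eq, exp_pos.
unfold Cdiv; ring.
Qed.

Lemma f_beta_eq (p t b : R) (z : C) : t = profile p b -> Cmod z < 1 -> Kfun p t b z = f_beta p b z.
Proof.
intros -> Hz; assert (HA := profile_pos p b); unfold Kfun, f_beta.
replace (profile p b / profile p b) with 1 by (field; lra).
assert (Hne := one_plus_neq0 1 z ltac:(lra) Hz); rewrite Cmult_1_l in Hne.
unfold profile; rewrite Rpower_Ropp, RtoC_inv by apply Rgt_not_eq, exp_pos.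
field; split; [|exact Hne].
intros E; apply RtoC_inj in E; revert E; apply Rgt_not_eq, exp_pos.
Qed.

(** A function beating the optimum would satisfy the assumptions of [extremal_limit], whose
    conclusion denies it; the supremum is attained by [Kfun p t s0]. Every other maximizer [s < 1]
    of the objective also yields an extremal, which accounts for the two functions at [t_ p]. *)
Lemma Phi1_optimum (p t s0 : R) : 0 < p < 1 -> 0 <= t <= 1 -> 0 <= s0 < 1 -> t <= profile p s0 ->
  (forall s, 0 <= s -> t <= profile p s -> objective p t s <= objective p t s0) ->
  Phi1 p t = Finite (objective p t s0) /\
  (forall s, 0 <= s < 1 -> t <= profile p s -> objective p t s = objective p t s0 -> extremal p t (Kfun p t s)) /\
  (forall f, extremal p t f -> exists s, 0 <= s /\ t <= profile p s /\ objective p t s = objective p t s0 /\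
     (s < 1 -> eq_on_disc f (Kfun p t s))).
Proof.
intros Hp Ht Hs0 Hfeas Hopt.
assert (HPhi : Phi1 p t = Finite (objective p t s0)).
{ apply is_lub_Rbar_unique; split.
  - intros x (f & Hadm & ->).
    destruct (Rle_lt_dec (Re (C_derive f 0)) (objective p t s0)) as [H|H]; [exact H|].
    destruct (extremal_limit p t _ f Hp Ht Hadm Hopt ltac:(lra)) as [E _]; simpl; lra.
  - intros b Hb; apply Hb.
    destruct (Kfun_admissible p t s0 ltac:(lra) ltac:(lra) ltac:(lra)) as [H1 H2].
    exists (Kfun p t s0); split; [exact H1|now rewrite H2, re_RtoC]. }
split; [exact HPhi|split].
- intros s Hs Hts E; destruct (Kfun_admissible p t s ltac:(lra) ltac:(lra) ltac:(lra)) as [H1 H2].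
  split; [exact H1|]; rewrite H2, re_RtoC, HPhi, E; reflexivity.
- intros f [Hadm HE]; rewrite HPhi in HE; injection HE as HE.
  destruct (extremal_limit p t _ f Hp Ht Hadm Hopt (Req_le _ _ (eq_sym HE))) as (_ & s & Hs).
  now exists s.
Qed.

Lemma is_alpha_unique (p t a b : R) : 0 < p < 1 -> is_alpha p t a -> is_alpha p t b -> a = b.
Proof.
intros Hp [Ha Ea] [Hb Eb]; destruct (Rtotal_order a b) as [H|[H|H]]; [|exact H|].
- assert (K := hump_increasing p a b Hp ltac:(lra) ltac:(lra)); unfold profile in K; lra.
- assert (K := hump_increasing p b a Hp ltac:(lra) ltac:(lra)); unfold profile in K; lra.
Qed.

Lemma is_beta_unique (p t a b : R) : 0 < p -> is_beta p t a -> is_beta p t b -> a = b.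
Proof.
intros Hp [Ha Ea] [Hb Eb]; apply (profile_injective p); try lra.
unfold profile; congruence.
Qed.

Lemma inv_Rpower_profile (p s : R) : 1 / Rpower (1 + s ^ 2) (1 / p) = profile p s.
Proof. unfold profile; rewrite Rpower_Ropp; unfold Rdiv; ring. Qed.

Lemma t_p_bounds (p : R) : 0 < p < 1 -> 0 < t_ p < 1.
Proof.
intros Hp; destruct (alpha2_sqr p Hp) as [Ha2 _].
destruct (alpha_p_spec p Hp) as (Hap & _); rewrite t_p_eq.
assert (H0 := profile_pos p (alpha_ p)).
assert (K := profile_decreasing p 0 (alpha_ p) ltac:(lra) ltac:(lra)); rewrite profile_0 in K.
split; nra.
Qed.

Theorem theorem12 :
  forall p : R, 0 < p < 1 ->
  (* (i) *)
  (forall t : R, 0 <= t <= t_ p ->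
     exists alpha : R, unique (is_alpha p t) alpha /\
       Phi1 p t =
         Finite (1 / Rpower (1 + alpha ^ 2) (1 / p)
                 * (1 + (2 / p - 1) * alpha ^ 2)) /\
       extremal p t (f_alpha p alpha)) /\
  (* (ii) *)
  (forall t : R, t_ p <= t <= 1 ->
     exists beta : R, unique (is_beta p t) beta /\
       Phi1 p t =
         Finite (1 / Rpower (1 + beta ^ 2) (1 / p) * (2 * beta / p)) /\
       extremal p t (f_beta p beta)) /\
  (* uniqueness for t <> t_p *)
  (forall t : R, 0 <= t <= 1 -> t <> t_ p ->
     forall f g : C -> C, extremal p t f -> extremal p t g ->
       eq_on_disc f g) /\
  (* the extremals for t = t_p *)
  (forall alpha beta : R,
     is_alpha p (t_ p) alpha -> is_beta p (t_ p) beta ->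
     forall f : C -> C,
       extremal p (t_ p) f <->
       eq_on_disc f (f_alpha p alpha) \/ eq_on_disc f (f_beta p beta)).
Proof.
intros p Hp.
destruct (alpha2_sqr p Hp) as [Ha2 _].
assert (Htp := t_p_bounds p Hp).
split; [|split; [|split]].
- intros t Ht.
  destruct (optimum_low p t Hp Ht) as (al & (Hal & E & Hfeas & _) & Hopt).
  assert (Hal' : is_alpha p t al) by now split.
  destruct (Phi1_optimum p t al Hp ltac:(lra) ltac:(lra) Hfeas (fun s H1 H2 => proj1 (Hopt s H1 H2))) as (HPhi & Hext & _).
  exists al; split; [|split].
  + split; [exact Hal'|]; intros b Hb; now apply (is_alpha_unique p t).
  + rewrite HPhi, inv_Rpower_profile, E, objective_alpha; reflexivity.
  + apply (extremal_ext p t (Kfun p t al)); [lra|intros z _; now apply f_alpha_eq|].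
    apply Hext; try assumption; [lra|reflexivity].
- intros t Ht.
  destruct (optimum_high p t Hp Ht) as (be & (Hbe & E) & Hopt).
  assert (Hbe' : is_beta p t be) by (split; [lra|now symmetry]).
  destruct (Phi1_optimum p t be Hp ltac:(lra) Hbe ltac:(lra) (fun s H1 H2 => proj1 (Hopt s H1 H2))) as (HPhi & Hext & _).
  exists be; split; [|split].
  + split; [exact Hbe'|]; intros b Hb; apply (is_beta_unique p t); try assumption; lra.
  + rewrite HPhi, inv_Rpower_profile, objective_beta, E by exact E; f_equal; field; lra.
  + apply (extremal_ext p t (Kfun p t be)); [lra|intros z Hz; now apply f_beta_eq|].
    apply Hext; try assumption; [lra|reflexivity].
- intros t Ht Hne f g Hf Hg.
  (* Away from [t_ p] the one-variable maximum is attained once, at a point below 1, so both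
     extremals equal the same [Kfun]. *)
  assert (Hone : exists s0, 0 <= s0 < 1 /\ t <= profile p s0 /\
    (forall s, 0 <= s -> t <= profile p s -> objective p t s <= objective p t s0) /\
    (forall s, 0 <= s -> t <= profile p s -> objective p t s = objective p t s0 -> s = s0)).
  { destruct (Rle_lt_dec t (t_ p)) as [L|L].
    - destruct (optimum_low p t Hp ltac:(lra)) as (al & (Hal & E & Hfeas & _) & Hopt).
      exists al; split; [lra|split; [exact Hfeas|split; intros s H1 H2; [now apply Hopt|]]].
      intros Es; destruct (proj2 (Hopt s H1 H2) Es) as [Q|[Q _]]; [exact Q|contradiction].
    - destruct (optimum_high p t Hp ltac:(lra)) as (be & (Hbe & E) & Hopt).
      exists be; split; [lra|split; [lra|split; intros s H1 H2; [now apply Hopt|]]].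
      intros Es; destruct (proj2 (Hopt s H1 H2) Es) as [Q|[Q _]]; [exact Q|contradiction]. }
  destruct Hone as (s0 & Hs0 & Hfeas & Hopt & Huniq).
  destruct (Phi1_optimum p t s0 Hp Ht Hs0 Hfeas Hopt) as (_ & _ & Hchar).
  destruct (Hchar f Hf) as (s & H1 & H2 & H3 & H4); destruct (Hchar g Hg) as (s' & H1' & H2' & H3' & H4').
  rewrite (Huniq s H1 H2 H3) in H4; rewrite (Huniq s' H1' H2' H3') in H4'.
  intros z Hz; rewrite (H4 (proj2 Hs0) z Hz), (H4' (proj2 Hs0) z Hz); reflexivity.
- intros al be Hal Hbe f.
  set (t := t_ p) in *.
  destruct (optimum_low p t Hp ltac:(unfold t in *; lra)) as (al0 & (Hal0 & E & Hfeas & Ealp) & Hopt).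
  assert (Eal : al = al0) by (apply (is_alpha_unique p t); try assumption; now split).
  subst al0.
  destruct (optimum_high p t Hp ltac:(unfold t in *; lra)) as (be0 & (Hbe0 & Eb) & Hopt').
  assert (Ebe : be = be0) by (apply (is_beta_unique p t); try assumption; [lra|split; [lra|now symmetry]]).
  subst be0.
  (* At [t_ p] both results apply: each of the two points is feasible and each is optimal. *)
  assert (Eobj : objective p t al = objective p t be).
  { apply Rle_antisym; [apply Hopt'|apply Hopt]; lra. }
  destruct (Phi1_optimum p t al Hp ltac:(unfold t in *; lra) ltac:(lra) Hfeas (fun s H1 H2 => proj1 (Hopt s H1 H2)))
    as (HPhi & Hext & Hchar).
  split.
  + intros Hf; destruct (Hchar f Hf) as (s & H1 & H2 & H3 & H4).
    destruct (proj2 (Hopt s H1 H2) H3) as [Q|[_ Q]].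
    * left; intros z Hz; subst s; rewrite H4 by (try exact Hz; lra); now apply f_alpha_eq.
    * right; assert (Es : s = be) by (apply (profile_injective p); lra); subst s.
      intros z Hz; rewrite H4 by (try exact Hz; lra); apply f_beta_eq; [now symmetry|exact Hz].
  + intros [Hf|Hf].
    * apply (extremal_ext p t (Kfun p t al)); [lra| |apply Hext; try assumption; [lra|reflexivity]].
      intros z Hz; rewrite Hf by exact Hz; now apply f_alpha_eq.
    * apply (extremal_ext p t (Kfun p t be)); [lra| |apply Hext; [lra|lra|now symmetry]].
      intros z Hz; rewrite Hf by exact Hz; apply f_beta_eq; [now symmetry|exact Hz].
Qed.
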